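(* Let $m,\tilde m\in\mathbb{N}$ with $m\le\tilde m$ and $m+\tilde m\in2\mathbb{N}$, and let $p\in\mathbb{N}_0$. (i) We have $$L_2(\mathbb{R})=\overline{\cdots+W_{p,-2}+W_{p,-1}+W_{p,0}+W_{p,1}+W_{p,2}+\cdots}=\overline{V_{p,0}+W_{p,0}+W_{p,1}+W_{p,2}+\cdots}.$$ (ii) Let in addition either $m=1$ or $p=0$. Then $$L_2(\mathbb{R})=\overline{\bigoplus_{j\in\mathbb{Z}}W_{p,j}}=\overline{V_{p,0}\oplus\bigoplus_{j=0}^\infty W_{p,j}},$$ where $\oplus$ denotes the (in general non-orthogonal) algebraic direct sum.
   Context: $\mathbb{N}=\{1,2,\dots\}$, $\mathbb{N}_0=\mathbb{N}\cup\{0\}$. Cardinal B-splines: $N_1=\chi_{[0,1)}$, $N_m(x)=\int_0^1N_{m-1}(x-t)\,dt$ for $m>1$. Quarks: $\varphi_q(x)=(x/\lceil m/2\rceil)^qN_m(x+\lfloor m/2\rfloor)$, $q\in\mathbb{N}_0$. Coefficients $b_k$: put $K=(m+\tilde m)/2$ and for $|z|=1$ let $\tilde a(z)=z^{-\lfloor\tilde m/2\rfloor}\big(\tfrac{1+z}{2}\big)^{\tilde m}\sum_{n=0}^{K-1}\binom{K-1+n}{n}\big(\tfrac{2-z-z^{-1}}{4}\big)^n$ (symbol of the Cohen--Daubechies--Feauveau dual generator). The finitely supported real sequence $(b_k)_{k\in\mathbb{Z}}$ of coefficients of the CDF spline wavelet is determined by $\frac12\sum_kb_kz^k=-z\,\overline{\tilde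 a(-z)}$ for $|z|=1$. Quarklets: $\psi_q=\sum_kb_k\varphi_q(2\cdot-k)$. For $j\in\mathbb{Z}$: $V_{p,j}=\overline{\mathrm{span}\{2^{j/2}\varphi_q(2^j\cdot-k):0\le q\le p,k\in\mathbb{Z}\}}$ and $W_{p,j}=\overline{\mathrm{span}\{2^{j/2}\psi_q(2^j\cdot-k):0\le q\le p,k\in\mathbb{Z}\}}$. Span means finite linear combinations, and $\overline{G}$ is the closure in $L_2(\mathbb{R})$. Sums of infinitely many subspaces are sets of finite sums of elements; $\oplus$ means in addition that the representation is unique. *)

(* Defs.v *)
From HB Require Import structures.
From mathcomp Require Import all_boot all_order all_algebra.
From mathcomp Require Import finmap.
From mathcomp Require Import complex.
From mathcomp Require Import all_classical all_reals all_analysis.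

Set Implicit Arguments.
Unset Strict Implicit.
Unset Printing Implicit Defensive.

Import Order.TTheory GRing.Theory Num.Theory.
Import numFieldNormedType.Exports.

Local Open Scope classical_set_scope.
Local Open Scope ring_scope.
Local Open Scope complex_scope.

Section Splines.
Context {R : realType}.

Local Notation mu := (@lebesgue_measure R).

(* [bspline_rec n] is N_{n+1}; [bspline m] is N_m for m >= 1 (and the
   irrelevant value N_1 for m = 0). *)
Fixpoint bspline_rec (n : nat) : R -> R :=
  match n with
  | 0 => \1_(`[0, 1[ : set R)
  | n'.+1 => fun x => \int[mu]_(t in `[0, 1]) bspline_rec n' (x - t)
  end.

Definition bspline (m : nat) : R -> R := bspline_rec m.-1.

(* [uphalf m] and [m./2] are the ceiling and the floor of m/2. *)
Definition quark (m q : nat) (x : R) : R :=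
  (x / (uphalf m)%:R) ^+ q * bspline m (x + (m./2)%:R).

Definition dual_symbol (m mt : nat) (z : R[i]) : R[i] :=
  let K := (m + mt)./2 in
  z ^- mt./2 * ((1 + z) / 2) ^+ mt *
  \sum_(n < K) 'C(K.-1 + n, n)%:R * ((2 - z - z^-1) / 4) ^+ n.

(* The sum over [setT] is the finite sum over the support of the summand. *)
Definition cdf_coefficients (m mt : nat) (b : int -> R) : Prop :=
  finite_set [set k | b k != 0] /\
  forall z : R[i], `|z| = 1 ->
    1 / 2 * (\sum_(k \in [set: int]) (b k)%:C * z ^ k)
    = - z * (dual_symbol m mt (- z))^*.

Definition quarklet (m : nat) (b : int -> R) (q : nat) (x : R) : R :=
  \sum_(k \in [set: int]) b k * quark m q (2 * x - k%:~R).

(* Elements of L_2(R) are represented by functions; equality in L_2(R) is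
   almost everywhere equality. *)
Definition L2 : set (R -> R) := [set f | f \in Lfun mu 2%:E].

(* Closed under almost everywhere equality, hence the same as the closure in
   the quotient. *)
Definition L2closure (G : set (R -> R)) : set (R -> R) :=
  [set f | L2 f /\ forall e : R, 0 < e ->
     exists2 g, G g & ('N[mu]_(2%:E) [EFin \o (f - g)%R] < e%:E)%E].

Definition linear_span (G : set (R -> R)) : set (R -> R) :=
  [set f | exists (n : nat) (c : 'I_n -> R) (g : 'I_n -> R -> R),
     (forall i, G (g i)) /\ f = \sum_(i < n) c i *: g i].

Definition dilate (f : R -> R) (j k : int) (x : R) : R :=
  2 `^ (j%:~R / 2) * f (2 ^ j * x - k%:~R).

Definition generated_space (F : nat -> R -> R) (p : nat) (j : int) :
    set (R -> R) :=
  L2closure (linear_span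
    [set g | exists (q : nat) (k : int), (q <= p)%N /\ g = dilate (F q) j k]).

Definition Vspace (m p : nat) (j : int) : set (R -> R) :=
  generated_space (quark m) p j.

Definition Wspace (m : nat) (b : int -> R) (p : nat) (j : int) : set (R -> R) :=
  generated_space (quarklet m b) p j.

(* The family V_{p,0}, W_{p,0}, W_{p,1}, W_{p,2}, ... *)
Definition VWspace (m : nat) (b : int -> R) (p : nat) (i : option nat) :
    set (R -> R) :=
  if i is Some j then Wspace m b p j%:Z else Vspace m p 0.

Definition subspace_sum (I : choiceType) (U : I -> set (R -> R)) :
    set (R -> R) :=
  [set f | exists (s : {fset I}) (u : I -> R -> R),
     (forall i, i \in s -> U i (u i)) /\ f = \sum_(i <- s) u i].

(* Two representations with different finite index sets are compared on a
   common finite index set after padding with zeros. *)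
Definition direct (I : choiceType) (U : I -> set (R -> R)) : Prop :=
  forall (s : {fset I}) (u v : I -> R -> R),
    (forall i, i \in s -> U i (u i)) -> (forall i, i \in s -> U i (v i)) ->
    \sum_(i <- s) u i = \sum_(i <- s) v i %[ae mu] ->
    forall i, i \in s -> u i = v i %[ae mu].

End Splines.

(* Main.v *)
From HB Require Import structures.
Require Import Defs.
From mathcomp Require Import all_boot all_order all_algebra.
From mathcomp Require Import finmap complex.
From mathcomp Require Import all_classical all_reals all_analysis.
From mathcomp Require Import measurable_realfun.
From mathcomp Require Import ring lra zify.

Set Implicit Arguments.
Unset Strict Implicit.
Unset Printing Implicit Defensive.

Import Order.TTheory GRing.Theory Num.Theory.
Import numFieldNormedType.Exports.

Local Open Scope classical_set_scope.
Local Open Scope ring_scope.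

(** The spaces of order [p] contain those of order 0, so that density is a statement
    about the spline [phi] and the wavelet [psi].  Let [A] and [B] be their masks, as
    polynomials shifted by a common even power.  The definition of the coefficients and
    the Bezout identity of the Daubechies polynomials ([daubechies_bezout]) give
    [A(X) B(-X) - A(-X) B(X) = X^(4 M + 1)] ([cdf_determinant]).  In the space domain
    this is [reconstruction]: each spline of the scale [j + 1] is a finite combination
    of splines and wavelets of the scale [j].  Iterating from the scale 0 and using that
    splines of all fine scales are total ([splines_total], from the partition of unity)
    gives the density of the sum of [V_0] and the [W_j], [j >= 0].

    For the wavelets of all scales, let [L] be a functional, a limit of inner products,
    that annihilates them.  By [reconstruction] the sequences [c_j(k) = L(phi_{j,k})]
    satisfy [c_{j+1} = S c_j] for all integers [j], where [S] is the subdivision operator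
    of a finite mask.  Each [c_j] is square summable, hence
    [h(k) = c_j(n - k) c_i(k) - c_i(n - k) c_j(k)] is absolutely summable, and it is
    odd under the reflection [n - k].  Because [S] occurs symmetrically in both factors,
    the oddness of the preimages under [S^J] shows that the sum of [h] over every residue
    class modulo [2^J] is zero.  For large [J] a class consists of a single index and a
    remote part, so that [h = 0]: any two of the [c_j] are proportional.  Then
    [c_j(k)] is geometric in [j]; as [phi_{j,k}] tends weakly to zero for [j] to plus and
    minus infinity, it vanishes ([subdivision_orbit_eq0]), and [L = 0] because the splines
    are total ([affine_system_total]).

    For uniqueness, among finitely many spaces the one of the largest scale [J] is split
    off first ([direct_of_largest]).  If [m = 1] or [p = 0] the [V_j] increase, so that
    the others lie in [V_J], and the question is whether [V_J] and [W_J] have only the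
    zero class in common.  There are local functionals [theta_q] whose translates
    annihilate [V_J] and are triangular against the translates of the [psi_q], with a
    Kronecker symbol on the diagonal.  For [p = 0] it is the high-pass combination of
    functionals that are biorthogonal to [phi] ([highpass_dualP]), and the determinant
    gives the Kronecker symbol; for [m = 1] it compares the two halves of a cell
    ([haar_dual]).  An element of [W_J] on which all of them vanish is zero by the
    inequality of Bessel, applied to one [q] after the other
    ([triangular_dual_eq0]). *)

(** * Sequences under subdivision *)

Section NullSums.
Context {R : realType}.
Implicit Types (h : int -> R) (c d : int -> R).

(** The net of finite partial sums tends to zero. *)
Definition null_sum h := forall e : R, 0 < e -> exists F0 : {fset int},
  forall F : {fset int}, (F0 `<=` F)%fset -> `|\sum_(k <- F) h k| <= e.

Definition abs_summable h := exists B : R,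
  forall F : {fset int}, \sum_(k <- F) `|h k| <= B.

Definition square_summable c := exists B : R,
  forall F : {fset int}, \sum_(k <- F) c k ^+ 2 <= B.

Lemma null_sum0 : null_sum (fun=> 0).
Proof. by move=> e e0; exists fset0 => F _; rewrite big1// normr0 ltW. Qed.

Lemma null_sumD h1 h2 : null_sum h1 -> null_sum h2 ->
  null_sum (fun k => h1 k + h2 k).
Proof.
move=> n1 n2 e e0.
have [F1 H1] := n1 (e / 2) (divr_gt0 e0 (ltr0Sn _ 1)).
have [F2 H2] := n2 (e / 2) (divr_gt0 e0 (ltr0Sn _ 1)).
exists (F1 `|` F2)%fset => F /fsubUsetP[s1 s2].
rewrite big_split/= (le_trans (ler_normD _ _))// [leRHS]splitr.
by rewrite lerD ?H1 ?H2.
Qed.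

Lemma null_sumZ a h : null_sum h -> null_sum (fun k => a * h k).
Proof.
move=> n e e0.
have a0 : 0 < `|a| + 1 by rewrite ltr_wpDl.
have [F0 H0] := n (e / (`|a| + 1)) (divr_gt0 e0 a0).
exists F0 => F s; rewrite -mulr_sumr normrM.
apply: le_trans (_ : (`|a| + 1) * (e / (`|a| + 1)) <= e).
  by rewrite ler_pM ?H0// lerDl.
by rewrite mulrC divfK// gt_eqF.
Qed.

Lemma null_sum_big (I : Type) (s : seq I) (P : pred I) (h : I -> int -> R) :
  (forall i, P i -> null_sum (h i)) ->
  null_sum (fun k => \sum_(i <- s | P i) h i k).
Proof.
move=> H; elim: s => [|i s IH].
  by under eq_fun do rewrite big_nil; exact: null_sum0.
rewrite [X in null_sum X](_ : _ = (fun k => (if P i then h i k else 0) +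
    \sum_(i <- s | P i) h i k)); last first.
  by apply/funext => k; rewrite big_cons; case: ifP; rewrite ?add0r.
apply: (@null_sumD (fun k => if P i then h i k else 0)) => //.
by have [/H//|_] := boolP (P i); exact: null_sum0.
Qed.

Lemma sum_fset_split (F0 F : {fset int}) (h : int -> R) : (F0 `<=` F)%fset ->
  \sum_(k <- F) h k = \sum_(k <- F0) h k + \sum_(k <- (F `\` F0)%fset) h k.
Proof.
move=> s; rewrite (big_fsetID _ (mem F0))/=.
by congr (_ + _); apply: eq_fbigl => x; rewrite !inE/= ?andbT andbC//;
  case: (boolP (x \in F0)) => // /(fsubsetP s) ->.
Qed.

(** The finite partial sums come within [e] of their supremum, so every sum that
    avoids a large enough finite set is at most [e]. *)
Lemma abs_summable_tail h : abs_summable h -> forall e : R, 0 < e ->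
  exists F0 : {fset int}, forall F : {fset int},
    [disjoint F0 & F]%fset -> \sum_(k <- F) `|h k| <= e.
Proof.
move=> [B hB] e e0.
pose A : set R := [set x | exists F : {fset int}, x = \sum_(k <- F) `|h k|].
have supA : has_sup A.
  split; first by exists (\sum_(k <- fset0) `|h k|); exists fset0.
  by exists B => _ [F ->]; exact: hB.
have [x [F0 ->] hF0] := sup_adherent e0 supA.
exists F0 => F dis.
have : \sum_(k <- (F0 `|` F)%fset) `|h k| <= sup A.
  by apply: ub_le_sup; [case: supA | exists (F0 `|` F)%fset].
rewrite (sum_fset_split _ (fsubsetUl F0 F)) fsetDUl fsetDv fset0U.
by move: dis; rewrite fdisjoint_sym => /fsetDidPl -> H; move: hF0 H; lra.
Qed.

Lemma ler_sum_fset (F : {fset int}) (h1 h2 : int -> R) :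
  (forall k, h1 k <= h2 k) -> \sum_(k <- F) h1 k <= \sum_(k <- F) h2 k.
Proof. by move=> H; apply: ler_sum. Qed.

Lemma sum_antisym_eq0 h (n : int) (F : {fset int}) :
  (forall k, h (n - k) = - h k) -> (forall k, k \in F -> n - k \in F) ->
  \sum_(k <- F) h k = 0.
Proof.
move=> anti sF.
have : \sum_(k <- F) h k = \sum_(k <- [fset (n - k)%R | k in F]%fset) h k.
  apply: eq_fbigl => x; apply/idP/imfsetP => /= [/sF xF|[y /sF yF -> //]].
  by exists (n - x) => //; rewrite subKr.
rewrite big_imfset/=; last by move=> x y _ _; exact: subrI.
under [X in _ = X -> _]eq_bigr do rewrite anti.
by rewrite sumrN; lra.
Qed.

(** Cancellation in pairs: a reflection of the integers that changes the sign
    of the summand. *)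
Lemma null_sum_antisym h (n : int) : abs_summable h ->
  (forall k, h (n - k) = - h k) -> null_sum h.
Proof.
move=> hs anti e e0; have [F0 H0] := abs_summable_tail hs e0.
pose F1 := (F0 `|` [fset (n - k)%R | k in F0])%fset.
exists F1 => F s1; rewrite (sum_fset_split _ s1).
rewrite (sum_antisym_eq0 anti) ?add0r.
  rewrite (le_trans (ler_norm_sum _ _ _))// H0//.
  by apply/fdisjointP => x xF0; rewrite !inE xF0.
move=> k; rewrite !inE => /orP[kF|/imfsetP[y /= yF ->]].
  by apply/orP; right; apply/imfsetP; exists k.
by rewrite subKr yF.
Qed.

Lemma abs_summable_mul c d (f g : int -> int) : injective f -> injective g ->
  square_summable c -> square_summable d ->
  abs_summable (fun k => c (f k) * d (g k)).
Proof.
move=> fI gI [B1 H1] [B2 H2]; exists (B1 + B2) => F.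
apply: (@le_trans _ _ (\sum_(k <- F) (c (f k) ^+ 2 + d (g k) ^+ 2))).
  apply: ler_sum_fset => k; rewrite ler_norml.
  by have := sqr_ge0 (c (f k) + d (g k)); have := sqr_ge0 (c (f k) - d (g k)); nra.
rewrite big_split/= lerD//.
  have := H1 [fset f k | k in F]%fset; rewrite big_imfset//= => x y _ _; exact: fI.
have := H2 [fset g k | k in F]%fset; rewrite big_imfset//= => x y _ _; exact: gI.
Qed.

Lemma abs_summableB h1 h2 : abs_summable h1 -> abs_summable h2 ->
  abs_summable (fun k => h1 k - h2 k).
Proof.
move=> [B1 H1] [B2 H2]; exists (B1 + B2) => F.
apply: (@le_trans _ _ (\sum_(k <- F) (`|h1 k| + `|h2 k|))).
  by apply: ler_sum_fset => k; rewrite ler_normB.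
by rewrite big_split lerD ?H1 ?H2.
Qed.

(** The residue classes [r + 2^J Z] shrink to [r], so [h] must vanish at [r] as
    soon as its sums over all of them vanish. *)
Lemma dyadic_null_sums h (r : int) : abs_summable h ->
  (forall J : nat, null_sum (fun t => h (r + 2 ^+ J * t))) -> h r = 0.
Proof.
move=> hs H; apply/eqP; rewrite -normr_le0; apply/ler_addgt0Pl => e e0.
rewrite addr0.
have e20 : 0 < e / 2 by rewrite divr_gt0.
have [F0 H0] := abs_summable_tail hs e20.
pose J := (\sum_(k <- F0) `|k - r|%N)%N.
have JF k : k \in F0 -> (`|k - r| <= J)%N.
  by move=> kF; rewrite /J (big_fsetD1 k)//= leq_addr.
have pos : (0:int) < 2 ^+ J by rewrite exprn_gt0.
have [F1 H1] := H J _ e20.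
pose F := (0%Z |` F1)%fset.
have := H1 F (fsubsetU1 _ _).
rewrite (big_fsetD1 (0:int)) ?fset1U1//= mulr0 addr0.
have : `|\sum_(t <- (F `\ (0:int))%fset) h (r + 2 ^+ J * t)| <= e / 2.
  apply: le_trans (ler_norm_sum _ _ _) _.
  pose G := [fset (r + 2 ^+ J * t)%R | t in (F `\ (0:int))%fset]%fset.
  have := H0 G; rewrite big_imfset/=.
    apply; apply/fdisjointP => k kF0; apply/imfsetP => -[t /=].
    rewrite !inE => /andP[t0 _] kE; have := JF _ kF0.
    rewrite kE addrC addKr abszM abszX/= => le.
    have t1 : (0 < `|t|)%N by rewrite absz_gt0.
    by have := leq_trans (leq_pmulr (2 ^ J) t1) le; rewrite leqNgt ltn_expl.
  move=> x y _ _ /addrI; apply: mulfI; exact: lt0r_neq0.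
move: (\sum_(t <- _) _) => x Hx Hy.
have -> : h r = (h r + x) - x by ring.
rewrite (le_trans (ler_normB _ _))// [leRHS]splitr; exact: lerD.
Qed.

End NullSums.

Section Subdivision.
Context {R : realType} (A : seq int) (s : int -> R).

Definition upsample (c : int -> R) (k : int) : R :=
  if (2 %| k)%Z then c (k %/ 2)%Z else 0.

(** Upsampling followed by filtering, that is [sum_l s (k - 2 l) c l]. *)
Definition subdivision (c : int -> R) (k : int) : R :=
  \sum_(i <- A) s i * upsample c (k - i).

(** This vanishes for all [n] and [k] exactly when [c] and [d] are proportional. *)
Definition crossdiff (c d : int -> R) (n k : int) : R :=
  c (n - k) * d k - d (n - k) * c k.

Lemma subdivisionZ a (c : int -> R) : 
  subdivision (fun k => a * c k) = (fun k => a * subdivision c k).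
Proof.
apply/funext => k; rewrite /subdivision mulr_sumr; apply: eq_bigr => i _.
by rewrite /upsample; case: ifP => _; ring.
Qed.

(** Both factors of [c (n - k) * d k] are produced by the same mask, and the
    product of two mask entries does not remember which of them came from
    which factor; one level down, the residue class modulo [2 ^ J.+1] becomes
    a residue class modulo [2 ^ J]. *)
Lemma null_crossdiff_iter J (c d : int -> R) :
  square_summable c -> square_summable d -> forall n r,
  null_sum (fun t => crossdiff (iter J subdivision c) (iter J subdivision d) n
                       (r + 2 ^+ J * t)).
Proof.
move=> hc hd; elim: J => [|J IH] n r /=.
  have subI (m : int) : injective (fun k => m - k) by move=> x y; exact: subrI.
  have addI (m : int) : injective (fun k => m + k) by move=> x y; exact: addrI.
  apply: (@null_sum_antisym _ _ (n - r - r)); last first.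
    move=> k; rewrite /crossdiff !expr0 !mul1r.
    have -> : n - (r + (n - r - r - k)) = r + k by ring.
    have -> : r + (n - r - r - k) = n - (r + k) by ring.
    ring.
  by apply: abs_summableB; under eq_fun do rewrite expr0 mul1r;
    apply: (abs_summable_mul (f := fun t => n - (r + t)) (g := fun t => r + t))
      => //= x y /subrI; exact: addrI.
set c' := iter J subdivision c; set d' := iter J subdivision d.
rewrite [X in null_sum X](_ : _ = (fun t => \sum_(i <- A) \sum_(j <- A)
    (s i * s j) * (upsample c' (n - (r + 2 ^+ J.+1 * t) - i) *
                  upsample d' (r + 2 ^+ J.+1 * t - j) -
       upsample d' (n - (r + 2 ^+ J.+1 * t) - i) *
                  upsample c' (r + 2 ^+ J.+1 * t - j)))); last first.
  apply/funext => t; rewrite /crossdiff /subdivision !big_distrlr/= -sumrB.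
  apply: eq_bigr => i _; rewrite -sumrB; apply: eq_bigr => j _; ring.
apply: null_sum_big => i _; apply: null_sum_big => j _; apply: null_sumZ.
have [[u uE]|nu] := pselect (exists u, n - r - i = 2 * u); last first.
  rewrite [X in null_sum X](_ : _ = (fun=> 0)); first exact: null_sum0.
  apply/funext => t; rewrite /upsample.
  have -> : (2 %| n - (r + 2 ^+ J.+1 * t) - i)%Z = false.
    apply/negP => /dvdzP[q qE]; apply: nu; exists (q + 2 ^+ J * t).
    by move: qE; rewrite exprS; lia.
  by rewrite !mul0r subr0.
have [[v vE]|nv] := pselect (exists v, r - j = 2 * v); last first.
  rewrite [X in null_sum X](_ : _ = (fun=> 0)); first exact: null_sum0.
  apply/funext => t; rewrite /upsample.
  have -> : (2 %| r + 2 ^+ J.+1 * t - j)%Z = false.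
    apply/negP => /dvdzP[q qE]; apply: nv; exists (q - 2 ^+ J * t).
    by move: qE; rewrite exprS; lia.
  by rewrite !mulr0 subr0.
have := IH (u + v) v; congr null_sum; apply/funext => t; rewrite /crossdiff.
have -> : n - (r + 2 ^+ J.+1 * t) - i = (u - 2 ^+ J * t) * 2.
  by rewrite exprS; lia.
have -> : r + 2 ^+ J.+1 * t - j = (v + 2 ^+ J * t) * 2.
  by rewrite exprS; lia.
rewrite /upsample !dvdz_mull// !mulzK//.
by rewrite (_ : u + v - (v + 2 ^+ J * t) = u - 2 ^+ J * t)//; ring.
Qed.

(** Every member of a two-sided orbit is the image of another one under arbitrarily
    many steps.  By [null_crossdiff_iter] and [dyadic_null_sums] any two members are
    therefore proportional, so that the orbit is a geometric sequence at each [k]; if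
    it tends to zero at both ends it is zero. *)
Lemma subdivision_orbit_eq0 (c : int -> int -> R) :
  (forall j, c (j + 1) = subdivision (c j)) ->
  (forall j, square_summable (c j)) ->
  (forall k (e : R), 0 < e -> exists N : nat,
     forall j : int, (N <= `|j|)%N -> `|c j k| <= e) ->
  forall j k, c j k = 0.
Proof.
move=> cS c2 c0.
have cI J : forall j, c j = iter J subdivision (c (j - J%:Z)).
  elim: J => [|J IH] j; first by rewrite subr0.
  rewrite iterS -[in LHS](subrK 1 j) cS (IH (j - 1)).
  by congr (subdivision (iter J _ (c _))); lia.
have prop j i k l : c j k * c i l = c i k * c j l.
  apply/eqP; rewrite -subr_eq0; apply/eqP.
  have := @dyadic_null_sums _ (crossdiff (c j) (c i) (k + l)) l.
  rewrite [crossdiff _ _ _ l]/crossdiff addrK; apply.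
    by apply: abs_summableB; apply: abs_summable_mul => // x y; exact: subrI.
  by move=> J; rewrite (cI J j) (cI J i); exact: null_crossdiff_iter.
move=> j0 k0; apply/eqP; apply: contraT => nz.
pose lam := c (j0 + 1) k0 / c j0 k0.
have step j : c (j + 1) k0 = lam * c j k0.
  have E : (fun k => c j0 k0 * c j k) = (fun k => c j k0 * c j0 k).
    by apply/funext => k; exact: prop.
  have := congr1 (fun f => subdivision f k0) E.
  rewrite !subdivisionZ -!cS => {}E.
  by apply: (mulfI nz); rewrite E /lam mulrCA [in RHS]mulrA divfK// mulrC.
clearbody lam.
have gt0 : 0 < `|c j0 k0| / 2 by rewrite divr_gt0// normr_gt0.
have [N HN] := c0 k0 _ gt0.
have lt2 (x : R) : `|c j0 k0| <= x -> x <= `|c j0 k0| / 2 -> false.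
  by move=> h1 h2; have := gt0; lra.
have [l1|l1] := leP 1 `|lam|.
  have mon (n : nat) : `|c j0 k0| <= `|c (j0 + n%:Z) k0|.
    elim: n => [|n IH]; first by rewrite addr0.
    rewrite (_ : j0 + n.+1%:Z = j0 + n%:Z + 1) ?step ?normrM; last by lia.
    by apply: (le_trans IH); rewrite ler_peMl.
  apply: (lt2 _ (mon (N + `|j0|)%N)); apply: HN; lia.
have mon (n : nat) : `|c j0 k0| <= `|c (j0 - n%:Z) k0|.
  elim: n => [|n IH]; first by rewrite subr0.
  apply: (le_trans IH).
  rewrite (_ : j0 - n%:Z = j0 - n.+1%:Z + 1) ?step ?normrM; last by lia.
  by rewrite ler_piMl// ltW.
apply: (lt2 _ (mon (N + `|j0|)%N)); apply: HN; lia.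
Qed.

End Subdivision.

(** * Semi-inner products *)

Section Spans.
Context {R : realType} {V : lmodType R}.
Implicit Types (S G : set V) (x y : V).

Definition is_subspace S := S 0 /\ forall a x y, S x -> S y -> S (a *: x + y).

Definition lspan G : set V := [set x | exists (n : nat) (c : 'I_n -> R) (g : 'I_n -> V),
  (forall i, G (g i)) /\ x = \sum_(i < n) c i *: g i].

(** Combinations indexed by a finite set, so that each vector has one coefficient. *)
Definition fspan (g : int -> V) : set V := [set x | exists (F : {fset int}) (c : int -> R),
  x = \sum_(k <- F) c k *: g k].

Lemma subspaceZ S a x : is_subspace S -> S x -> S (a *: x).
Proof. by move=> [S0 SD] Sx; rewrite -[_ *: _]addr0; exact: SD. Qed.

Lemma subspaceD S x y : is_subspace S -> S x -> S y -> S (x + y).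
Proof. by move=> [S0 SD] Sx Sy; rewrite -[x]scale1r; exact: SD. Qed.

Lemma subspaceN S x : is_subspace S -> S x -> S (- x).
Proof. by move=> sS Sx; rewrite -scaleN1r; exact: subspaceZ. Qed.

Lemma subspaceB S x y : is_subspace S -> S x -> S y -> S (x - y).
Proof. by move=> sS Sx Sy; apply: subspaceD => //; exact: subspaceN. Qed.

Lemma subspace_sum_in S (I : eqType) (s : seq I) (f : I -> V) : is_subspace S ->
  (forall i, i \in s -> S (f i)) -> S (\sum_(i <- s) f i).
Proof.
move=> sS H; rewrite big_seq; elim/big_ind: _ => //; first by case: sS.
by move=> x y; exact: subspaceD.
Qed.

Lemma subspace_big S (I : Type) (s : seq I) (P : pred I) (f : I -> V) : is_subspace S ->
  (forall i, P i -> S (f i)) -> S (\sum_(i <- s | P i) f i).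
Proof.
move=> sS H; elim/big_ind: _ => //; first by case: sS.
by move=> x y; exact: subspaceD.
Qed.

Lemma lspan_min G S : is_subspace S -> G `<=` S -> lspan G `<=` S.
Proof.
move=> sS GS _ [n [c [g [Gg ->]]]]; apply: subspace_big => // i _.
by apply: subspaceZ => //; exact: GS.
Qed.

Lemma sub_lspan G : G `<=` lspan G.
Proof.
move=> x Gx; exists 1, (fun=> 1), (fun=> x); split => //.
by rewrite big_ord1 scale1r.
Qed.

Lemma lspan_subspace G : is_subspace (lspan G).
Proof.
split.
  by exists 0, (fun=> 0), (fun=> 0); split; [case | rewrite big_ord0].
move=> a x y [n [c [g [Gg ->]]]] [n' [c' [g' [Gg' ->]]]].
exists (n + n')%N,
  (fun i : 'I_(n + n') =>
     match fintype.split i with inl j => a * c j | inr j => c' j end),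
  (fun i : 'I_(n + n') =>
     match fintype.split i with inl j => g j | inr j => g' j end); split.
  by move=> i; case: fintype.split.
rewrite big_split_ord/= scaler_sumr; congr (_ + _); apply: eq_bigr => i _.
  by rewrite -[lshift n' i]/(unsplit (inl i)) unsplitK scalerA.
by rewrite -[rshift n i]/(unsplit (inr i)) unsplitK.
Qed.

Lemma lspan_mono G G' : G `<=` lspan G' -> lspan G `<=` lspan G'.
Proof. by move=> GG'; apply: lspan_min => //; exact: lspan_subspace. Qed.

Lemma fspan_subspace (g : int -> V) : is_subspace (fspan g).
Proof.
split; first by exists fset0, (fun=> 0); rewrite big_seq_fset0.
move=> a x y [F [c ->]] [F' [c' ->]].
have ext (F0 F1 : {fset int}) (d : int -> R) : (F0 `<=` F1)%fset ->
    \sum_(k <- F0) d k *: g k = \sum_(k <- F1) (if k \in F0 then d k else 0) *: g k.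
  move=> s; rewrite (big_fsetID _ (mem F0) F1)/= [X in _ + X]big_seq_cond.
  rewrite [X in _ + X]big1 ?addr0 => [|k]; last first.
    by rewrite !inE/= => /andP[/andP[_ /negPf ->] _]; rewrite scale0r.
  transitivity (\sum_(k <- F0) (if k \in F0 then d k else 0) *: g k).
    by rewrite big_seq [RHS]big_seq; apply: eq_bigr => k ->.
  apply: eq_fbigl => k; rewrite !inE/= andbC.
  by case: (boolP (k \in F0)) => //= /(fsubsetP s) ->.
exists (F `|` F')%fset, (fun k => a * (if k \in F then c k else 0) +
  (if k \in F' then c' k else 0)).
rewrite (ext _ _ c (fsubsetUl F F')) (ext _ _ c' (fsubsetUr F F')).
rewrite scaler_sumr -big_split/=; apply: eq_bigr => k _.
by rewrite scalerDl scalerA.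
Qed.

End Spans.

(** Positive semidefinite: functions that agree almost everywhere are at
    distance zero without being equal. *)
Record semi_inner {R : realType} {V : lmodType R} (ip : V -> V -> R) : Prop := SemiInner {
  semi_innerC : forall x y, ip x y = ip y x ;
  semi_innerP : forall a x y z, ip (a *: x + y) z = a * ip x z + ip y z ;
  semi_inner_ge0 : forall x, 0 <= ip x x }.

Section InnerProduct.
Context {R : realType} {V : lmodType R} (ip : V -> V -> R) (ipP : semi_inner ip).
Implicit Types (S G : set V) (x y z g : V).

Definition nrm x := Num.sqrt (ip x x).

Definition ipclosure S : set V := [set x | forall e : R, 0 < e -> exists2 y, S y & nrm (x - y) < e].

Lemma ipC x y : ip x y = ip y x. Proof. exact: semi_innerC. Qed.

Lemma ipP_l a x y z : ip (a *: x + y) z = a * ip x z + ip y z.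
Proof. exact: semi_innerP. Qed.

Lemma ipDl x y z : ip (x + y) z = ip x z + ip y z.
Proof. by rewrite -[x]scale1r ipP_l mul1r scale1r. Qed.

Lemma ip0l z : ip 0 z = 0.
Proof. by apply: (addIr (ip 0 z)); rewrite -ipDl !add0r. Qed.

Lemma ipZl a x z : ip (a *: x) z = a * ip x z.
Proof. by rewrite -[a *: x]addr0 ipP_l ip0l addr0. Qed.

Lemma ipNl x z : ip (- x) z = - ip x z.
Proof. by rewrite -scaleN1r ipZl mulN1r. Qed.

Lemma ipBl x y z : ip (x - y) z = ip x z - ip y z.
Proof. by rewrite ipDl ipNl. Qed.

Lemma ip_suml (I : Type) (s : seq I) (P : pred I) (f : I -> V) z :
  ip (\sum_(i <- s | P i) f i) z = \sum_(i <- s | P i) ip (f i) z.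
Proof. by elim/big_ind2: _ => //; [exact: ip0l | move=> _ x1 _ y1 <- <-; rewrite ipDl]. Qed.

Lemma ipDr x y z : ip z (x + y) = ip z x + ip z y.
Proof. by rewrite !(ipC z) ipDl. Qed.

Lemma ipZr a x z : ip z (a *: x) = a * ip z x.
Proof. by rewrite !(ipC z) ipZl. Qed.

Lemma ipBr x y z : ip z (x - y) = ip z x - ip z y.
Proof. by rewrite !(ipC z) ipBl. Qed.

Lemma ip_sumr (I : Type) (s : seq I) (P : pred I) (f : I -> V) z :
  ip z (\sum_(i <- s | P i) f i) = \sum_(i <- s | P i) ip z (f i).
Proof. by rewrite ipC ip_suml; apply: eq_bigr => i _; rewrite ipC. Qed.

Lemma nrm_ge0 x : 0 <= nrm x. Proof. exact: sqrtr_ge0. Qed.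
Hint Resolve nrm_ge0 : core.

Lemma nrm_sqr x : nrm x ^+ 2 = ip x x.
Proof. by rewrite sqr_sqrtr// semi_inner_ge0. Qed.

Lemma nrm0 : nrm 0 = 0. Proof. by rewrite /nrm ip0l sqrtr0. Qed.

Lemma nrmN x : nrm (- x) = nrm x.
Proof. by rewrite /nrm ipNl (ipC _ (- x)) ipNl opprK. Qed.

(** A nonnegative quadratic function of one real variable has a nonpositive
    discriminant. *)
Lemma quadratic_ge0 (A B C : R) : 0 <= A -> 0 <= C ->
  (forall t, 0 <= A * t ^+ 2 - 2 * B * t + C) -> B ^+ 2 <= A * C.
Proof.
move=> A0 C0 H; have [A00|An0] := eqVneq A 0; last first.
  have Ap : 0 < A by rewrite lt_neqAle eq_sym An0.
  have := H (B / A).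
  have -> : A * (B / A) ^+ 2 - 2 * B * (B / A) + C = (A * C - B ^+ 2) / A by field.
  by rewrite pmulr_lge0 ?invr_gt0// subr_ge0.
have [-> |Bn0] := eqVneq B 0; first by rewrite expr0n/= mulr_ge0.
have := H ((C + 1) / B); rewrite A00 mul0r add0r.
have -> : - (2 * B * ((C + 1) / B)) + C = - C - 2 by field.
by move=> h; exfalso; lra.
Qed.

Lemma cauchy_schwarz x y : `|ip x y| <= nrm x * nrm y.
Proof.
rewrite -(@ler_pXn2r _ 2)// ?nnegrE ?mulr_ge0// exprMn !nrm_sqr real_normK ?num_real//.
apply: quadratic_ge0; rewrite ?(semi_inner_ge0 ipP)// => t.
have := semi_inner_ge0 ipP (t *: x - y).
by rewrite ipBl !ipBr !ipZl !ipZr (ipC y x); lra.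
Qed.

Lemma nrmD x y : nrm (x + y) <= nrm x + nrm y.
Proof.
rewrite -(@ler_pXn2r _ 2)// ?nnegrE ?addr_ge0// sqrrD !nrm_sqr ipDl !ipDr (ipC y x).
by have := cauchy_schwarz x y; have := ler_norm (ip x y); lra.
Qed.

Lemma nrmB x y : nrm (x - y) <= nrm x + nrm y.
Proof. by rewrite -(nrmN y) nrmD. Qed.

Lemma nrmBC x y : nrm (x - y) = nrm (y - x).
Proof. by rewrite -nrmN opprB. Qed.

Lemma nrm_dist x y z : nrm (x - z) <= nrm (x - y) + nrm (y - z).
Proof. by rewrite -[in leLHS](subrK y x) -addrA nrmD. Qed.

Lemma nrmZ a x : nrm (a *: x) = `|a| * nrm x.
Proof. by rewrite /nrm ipZl ipZr mulrA -expr2 sqrtrM ?sqr_ge0// sqrtr_sqr. Qed.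

Lemma sub_ipclosure S : S `<=` ipclosure S.
Proof. by move=> x Sx e e0; exists x => //; rewrite subrr nrm0. Qed.

Lemma ipclosure_trans S T : S `<=` ipclosure T -> ipclosure S `<=` ipclosure T.
Proof.
move=> ST x nx e e0; have [y Sy xy] := nx _ (divr_gt0 e0 (ltr0Sn _ 1)).
have [z Tz yz] := ST y Sy _ (divr_gt0 e0 (ltr0Sn _ 1)).
by exists z => //; rewrite (le_lt_trans (nrm_dist _ y _))// [ltRHS]splitr ltrD.
Qed.

Lemma ipclosure_subspace S : is_subspace S -> is_subspace (ipclosure S).
Proof.
move=> sS; split; first by apply: sub_ipclosure; case: sS.
move=> a x y nx ny e e0.
have a0 : 0 < `|a| + 1 by rewrite ltr_wpDl.
have [x' Sx' xx'] := nx _ (divr_gt0 (divr_gt0 e0 (ltr0Sn _ 1)) a0).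
have [y' Sy' yy'] := ny _ (divr_gt0 e0 (ltr0Sn _ 1)).
exists (a *: x' + y'); first by apply: (proj2 sS).
rewrite opprD addrACA -scalerBr (le_lt_trans (nrmD _ _))// nrmZ [ltRHS]splitr.
apply: ler_ltD => //; rewrite ltr_pdivlMr// in xx'.
apply: le_trans (ltW xx'); rewrite mulrC ler_wpM2l// lerDl//.
Qed.

Lemma ipclosure_eq S x y : nrm (x - y) = 0 -> ipclosure S x -> ipclosure S y.
Proof.
move=> xy nx e e0; have [z Sz xz] := nx e e0; exists z => //.
by rewrite (le_lt_trans (nrm_dist _ x _))// nrmBC xy add0r.
Qed.

Lemma ipclosure_orthogonal G x z : (forall y, G y -> ip y z = 0) ->
  ipclosure (lspan G) x -> ip x z = 0.
Proof.
move=> Gz Gx; have {}Gz : lspan G `<=` [set y | ip y z = 0].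
  apply: lspan_min Gz; split => [|a u v uz vz]; first exact: ip0l.
  by rewrite /= ipP_l uz vz mulr0 addr0.
apply/eqP; rewrite -normr_le0; apply/ler_addgt0Pr => e e0; rewrite add0r.
have z0 : 0 < nrm z + 1 by rewrite ltr_wpDl.
have [y /Gz yz xy] := Gx _ (divr_gt0 e0 z0).
have -> : ip x z = ip (x - y) z by rewrite ipBl yz subr0.
rewrite (le_trans (cauchy_schwarz _ _))//; rewrite ltr_pdivlMr// in xy.
by have := nrm_ge0 (x - y); have := nrm_ge0 z; nra.
Qed.

(** A banded Gram matrix with bounded entries, as for the translates of a bounded
    function of compact support. *)
Section AlmostOrthogonal.
Variables (g : int -> V) (M : R) (r : nat).
Hypothesis gM : forall k l, `|ip (g k) (g l)| <= M.
Hypothesis gr : forall k l : int, (r <= `|k - l|)%N -> ip (g k) (g l) = 0.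

Lemma count_close (F : {fset int}) (k : int) :
  \sum_(l <- F) (if (`|k - l| < r)%N then 1 else 0) <= (2 * r)%:R :> R.
Proof.
rewrite -big_mkcond/= big_const_seq iter_addr_0 -mulr_natr mul1r ler_nat.
rewrite -size_filter.
have -> : (2 * r)%N = size [seq k - r%:Z + i%:Z | i <- iota 0 (2 * r)].
  by rewrite size_map size_iota.
apply: uniq_leq_size; first by rewrite filter_uniq ?fset_uniq.
move=> l; rewrite mem_filter => /andP[lt _]; apply/mapP.
exists `|(l - (k - r%:Z))%R|%N; last by lia.
by rewrite mem_iota; lia.
Qed.

(** Each product [c k * c l] of nearby coefficients is charged to the squares
    of its two factors, and each index is near to at most [2 * r] others. *)
Lemma almost_orthogonal_upper (F : {fset int}) (c : int -> R) :
  nrm (\sum_(k <- F) c k *: g k) ^+ 2 <= M * (2 * r)%:R * \sum_(k <- F) c k ^+ 2.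
Proof.
have M0 : 0 <= M by apply: le_trans (gM 0 0).
pose close (k l : int) : R := if (`|k - l| < r)%N then 1 else 0.
have close01 k l : 0 <= close k l by rewrite /close; case: ifP.
rewrite nrm_sqr ip_suml.
apply: (@le_trans _ _ (\sum_(k <- F) \sum_(l <- F)
    (M / 2 * (c k ^+ 2 * close k l) + M / 2 * (c l ^+ 2 * close k l)))).
  apply: ler_sum => k _; rewrite ip_sumr; apply: ler_sum => l _.
  rewrite ipZl ipZr /close; case: ltnP => [kl|/gr ->]; last by rewrite !mulr0 addr0.
  have := gM k l; move: (ip _ _) => u; rewrite ler_norml => /andP[u1 u2].
  have [s1 s2] : 0 <= (c k - c l) ^+ 2 /\ 0 <= (c k + c l) ^+ 2 by rewrite !sqr_ge0.
  rewrite !mulr1; nra.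
under eq_bigr do rewrite big_split/=.
rewrite big_split/= [X in _ + X]exchange_big/=.
have bound : \sum_(k <- F) \sum_(l <- F) M / 2 * (c k ^+ 2 * close k l) <=
    M / 2 * (2 * r)%:R * \sum_(k <- F) c k ^+ 2.
  rewrite mulr_sumr; apply: ler_sum => k _; rewrite -mulr_sumr -mulr_sumr.
  rewrite -[leRHS]mulrA ler_wpM2l ?divr_ge0// mulrC ler_wpM2r ?sqr_ge0//.
  exact: count_close.
have -> : \sum_(j <- F) \sum_(i <- F) M / 2 * (c j ^+ 2 * close i j) =
   \sum_(k <- F) \sum_(l <- F) M / 2 * (c k ^+ 2 * close k l).
  by apply: eq_bigr => k _; apply: eq_bigr => l _; rewrite /close distnC.
have -> : M * (2 * r)%:R * \sum_(k <- F) c k ^+ 2 =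
  M / 2 * (2 * r)%:R * \sum_(k <- F) c k ^+ 2 + M / 2 * (2 * r)%:R * \sum_(k <- F) c k ^+ 2.
  by field.
exact: lerD.
Qed.

(** The square sum of the values is a value at the vector that has these values as
    coefficients, whose norm is controlled by the same square sum. *)
Lemma functional_square_summable (L : V -> R) (C : R) : 0 <= C ->
  (forall a x y, L (a *: x + y) = a * L x + L y) ->
  (forall x, `|L x| <= C * nrm x) ->
  forall F : {fset int}, \sum_(k <- F) L (g k) ^+ 2 <= C ^+ 2 * (M * (2 * r)%:R).
Proof.
move=> C0 LP LC F; have M0 : 0 <= M by apply: le_trans (gM 0 0).
have L0 : L 0 = 0 by have := LP 1 0 0; rewrite scaler0 addr0; lra.
have LD x y : L (x + y) = L x + L y by have := LP 1 x y; rewrite scale1r mul1r.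
have LZ a x : L (a *: x) = a * L x by have := LP a x 0; rewrite L0 !addr0.
set s := \sum_(k <- F) _.
pose v := \sum_(k <- F) L (g k) *: g k.
have sE : s = L v.
  rewrite /s /v (big_morph L LD L0); apply: eq_bigr => k _.
  by rewrite LZ expr2.
have s0 : 0 <= s by apply: sumr_ge0 => k _; exact: sqr_ge0.
have vs := almost_orthogonal_upper F (fun k => L (g k)).
rewrite -/v -/s in vs.
have sv : s <= C * nrm v by rewrite sE (le_trans _ (LC v))// ler_norm.
have : s ^+ 2 <= C ^+ 2 * (M * (2 * r)%:R) * s.
  apply: le_trans (_ : (C * nrm v) ^+ 2 <= _); first by rewrite ler_pXn2r// nnegrE ?mulr_ge0.
  by rewrite exprMn -[leRHS]mulrA ler_wpM2l// sqr_ge0.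
rewrite expr2; have [-> _|sn] := eqVneq s 0; first by rewrite mulr_ge0 ?sqr_ge0// mulr_ge0.
by rewrite ler_pM2r// lt_neqAle eq_sym sn.
Qed.

Lemma bessel (F : {fset int}) x :
  \sum_(k <- F) ip x (g k) ^+ 2 <= nrm x ^+ 2 * (M * (2 * r)%:R).
Proof.
apply: (functional_square_summable (L := ip x)) => //.
  by move=> a y z; rewrite ipDr ipZr.
by move=> y; exact: cauchy_schwarz.
Qed.

End AlmostOrthogonal.

(** If [d] is the distance of [h] from [S] and [r n] are residuals of [h] whose
    norms tend to [d], then the [r n] are nearly orthogonal to [S], hence form a
    Cauchy sequence.  In an incomplete space they may have no limit; the functional
    [L g = lim ip (r n) g] takes its place, and [L h = 0] forces [d = 0]. *)
Lemma ipclosure_of_functionals S h : is_subspace S ->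
  (forall L : V -> R, (forall a x y, L (a *: x + y) = a * L x + L y) ->
     (forall e : R, 0 < e -> exists r, forall g, `|L g - ip r g| <= e * nrm g) ->
     (forall y, S y -> L y = 0) -> L h = 0) ->
  ipclosure S h.
Proof.
move=> sS HL.
pose A : set R := [set t | exists2 y, S y & t = ip (h - y) (h - y)].
have infA : has_inf A.
  split; first by exists (ip (h - 0) (h - 0)), 0 => //; case: sS.
  by exists 0 => _ [y _ ->]; exact: semi_inner_ge0.
pose d := inf A.
have dle y : S y -> d <= ip (h - y) (h - y).
  by move=> Sy; apply: ge_inf; [case: infA | exists y].
pose del (n : nat) : R := n.+1%:R^-1.
have del0 n : 0 < del n by rewrite invr_gt0.
have delmono n m : (n <= m)%N -> del m <= del n.
  by move=> nm; rewrite lef_pV2 ?posrE// ler_nat.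
have exy n : exists y, S y /\ ip (h - y) (h - y) < d + del n ^+ 2.
  have [_ [y Sy ->] yl] := inf_adherent (exprn_gt0 2 (del0 n)) infA.
  by exists y.
have [y yP] := choice exy.
pose r n := h - y n; have rE n : r n = h - y n by []; clearbody r.
have rS n z : S z -> `|ip (r n) z| <= del n * nrm z.
  move=> Sz; have [Sy ly] := yP n.
  rewrite -(@ler_pXn2r _ 2)// ?nnegrE ?mulr_ge0 ?(ltW (del0 n))//.
  rewrite exprMn nrm_sqr real_normK ?num_real// [leRHS]mulrC.
  apply: quadratic_ge0; rewrite ?(semi_inner_ge0 ipP) ?sqr_ge0// => t.
  have := dle (y n + t *: z) (subspaceD sS Sy (subspaceZ t sS Sz)).
  rewrite opprD addrA -rE ipBl !ipBr !ipZr !ipZl (ipC z (r n)).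
  by move: ly; rewrite -rE; lra.
have rr n m : nrm (r n - r m) <= del n + del m.
  have Sd : S (r n - r m).
    by rewrite !rE opprB addrC addrA subrK; apply: subspaceB => //; [case: (yP m)|case: (yP n)].
  have : nrm (r n - r m) ^+ 2 <= (del n + del m) * nrm (r n - r m).
    rewrite nrm_sqr ipBl.
    have := rS n _ Sd; have := rS m _ Sd; rewrite !ler_norml => /andP[a1 a2] /andP[b1 b2].
    lra.
  rewrite expr2; have [->|nn] := eqVneq (nrm (r n - r m)) 0.
    by move=> _; rewrite addr_ge0 ?ltW.
  by rewrite ler_pM2r// lt_neqAle eq_sym nn/=.
have cau g n m : `|ip (r n) g - ip (r m) g| <= (del n + del m) * nrm g.
  by rewrite -ipBl (le_trans (cauchy_schwarz _ _))// ler_wpM2r.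
have del_small (e : R) : 0 < e -> exists n, del n < e.
  move=> e0; exists (Num.truncn e^-1).
  by rewrite /del invf_plt ?posrE// truncnS_gt.
have cvgL g : cvgn (fun n => ip (r n) g).
  apply/cauchy_cvgP/cauchy_exP => e e0.
  have g1 : 0 < nrm g + 1 by rewrite ltr_wpDl.
  have [n0 Hn0] := del_small (e / 2 / (nrm g + 1)) (divr_gt0 (divr_gt0 e0 (ltr0Sn _ 1)) g1).
  rewrite ltr_pdivlMr// in Hn0.
  exists (ip (r n0) g); exists n0 => // n /= nn; rewrite /ball/=.
  rewrite (le_lt_trans (cau g n0 n))//; have := delmono _ _ nn => h1.
  by have := del0 n0; have := nrm_ge0 g; nra.
pose L g := limn (fun n => ip (r n) g).
have Lr g n : `|L g - ip (r n) g| <= (del n + del n) * nrm g.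
  have c1 : (fun m => `|ip (r m) g - ip (r n) g|) @ \oo --> `|L g - ip (r n) g|.
    by apply: cvg_norm; apply: cvgB; [exact: cvgL | exact: cvg_cst].
  rewrite -(cvg_lim _ c1)//; apply: limr_le.
    by apply/cvg_ex; exists `|L g - ip (r n) g|.
  exists n => // m /= nm.
  by rewrite (le_trans (cau g m n))// ler_wpM2r// lerD// delmono.
have LP a x z : L (a *: x + z) = a * L x + L z.
  rewrite /L [X in lim (X @ _)](_ : _ =
      (fun n => a * ip (r n) x) \+ (fun n => ip (r n) z)); last first.
    by apply/funext => n; rewrite ipDr ipZr.
  apply/cvg_lim => //; apply: cvgD; last exact: cvgL.
  by apply: cvgM; [exact: cvg_cst | exact: cvgL].
have small g : (forall n, `|L g| <= 3 * del n * nrm g) -> L g = 0.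
  move=> H; apply/eqP; rewrite -normr_le0; apply/ler_addgt0Pr => e e0.
  have g1 : 0 < nrm g + 1 by rewrite ltr_wpDl.
  have [n0 Hn0] := del_small (e / 3 / (nrm g + 1)) (divr_gt0 (divr_gt0 e0 (ltr0Sn _ 2)) g1).
  rewrite ltr_pdivlMr// in Hn0.
  by rewrite add0r (le_trans (H n0))//; have := del0 n0; have := nrm_ge0 g; nra.
have LS z : S z -> L z = 0.
  move=> Sz; apply: small => n; have := Lr z n; have := rS n z Sz.
  by rewrite !ler_norml => /andP[a1 a2] /andP[b1 b2]; apply/andP; split; lra.
have Lh : L h = 0.
  apply: HL => // e e0; have [n0 Hn0] := del_small (e / 2) (divr_gt0 e0 (ltr0Sn _ 1)).
  by exists (r n0) => g; rewrite (le_trans (Lr g n0))// ler_wpM2r//; lra.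
(* the residual itself is small *)
have resid n : nrm (r n) ^+ 2 <= del n * (4 * nrm h + nrm (r n)).
  have [Sy _] := yP n; rewrite nrm_sqr {2}rE ipBr.
  have := Lr h n; rewrite Lh add0r normrN => h1.
  have := rS n _ Sy => h2.
  have : nrm (y n) <= nrm h + nrm (r n) by rewrite (_ : y n = h - r n) ?nrmB// rE subKr.
  move: h1 h2; rewrite !ler_norml => /andP[a1 a2] /andP[b1 b2] c1.
  have := del0 n; have := nrm_ge0 h; nra.
move=> e e0.
have K0 : 0 < 4 * nrm h + e by rewrite ltr_wpDl// mulr_ge0.
have [n Hn] := del_small (e ^+ 2 / (4 * nrm h + e)) (divr_gt0 (exprn_gt0 2 e0) K0).
exists (y n); first by case: (yP n).
rewrite -rE ltNge; apply/negP => en.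
have := resid n; rewrite ltr_pdivlMr// in Hn.
have := nrm_ge0 h; have := del0 n; have := nrm_ge0 (r n) => p1 p2 p3.
have [d1|d1] := lerP (del n) e; nra.
Qed.

End InnerProduct.

(** * Affine systems and triangular dual systems *)

Section AffineSystems.
Context {R : realType} {V : lmodType R} (ip : V -> V -> R) (ipP : semi_inner ip).
Local Notation nrm := (nrm ip).
Local Notation ipclosure := (ipclosure ip).

(** Modulo the span of the [psi], the vector [phi (j + 1) k] is the combination of
    the [phi j l] with the coefficients of a subdivision mask.  A functional that
    annihilates the [psi] therefore takes on the [phi] values that form a two-sided
    orbit of the subdivision operator.  The values are square summable on each scale
    because the Gram matrices are banded, and they tend to zero as the scale tends to
    either end because the [phi j k] decay weakly; so they vanish. *)
Lemma affine_system_total (phi : int -> int -> V) (Psi : set V)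
    (A : seq int) (s : int -> R) (M : R) (r : nat) :
  (forall j k, lspan Psi (phi (j + 1) k -
     \sum_(i <- A) s i *: (if (2 %| k - i)%Z then phi j ((k - i) %/ 2)%Z else 0))) ->
  (forall j k l, `|ip (phi j k) (phi j l)| <= M) ->
  (forall j (k l : int), (r <= `|k - l|)%N -> ip (phi j k) (phi j l) = 0) ->
  (forall i l k (e : R), 0 < e -> exists N : nat, forall j : int, (N <= `|j|)%N ->
     `|ip (phi i l) (phi j k)| <= e) ->
  (forall h, ipclosure (lspan [set x | exists j k, x = phi j k]) h) ->
  forall h, ipclosure (lspan Psi) h.
Proof.
move=> refine phiM phir decay dense h.
apply: (ipclosure_of_functionals ipP) => [|L LP Lapp Lpsi]; first exact: lspan_subspace.
have L0 : L 0 = 0 by have := LP 1 0 0; rewrite scaler0 addr0; lra.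
have LD x y : L (x + y) = L x + L y by have := LP 1 x y; rewrite scale1r mul1r.
have LZ a x : L (a *: x) = a * L x by have := LP a x 0; rewrite L0 !addr0.
have LB x y : L (x - y) = L x - L y by rewrite LD -scaleN1r LZ mulN1r.
have [r1 Hr1] := Lapp 1 ltr01.
pose C := 1 + nrm r1.
have C0 : 0 <= C by rewrite addr_ge0// nrm_ge0.
have LC x : `|L x| <= C * nrm x.
  rewrite -[L x](subrK (ip r1 x)) (le_trans (ler_normD _ _))// /C mulrDl.
  by rewrite lerD//; exact: cauchy_schwarz.
have M0 : 0 <= M by apply: le_trans (phiM 0 0 0).
have phin j k : nrm (phi j k) <= M + 1.
  have := nrm_sqr ipP (phi j k); have := ler_norm (ip (phi j k) (phi j k)).
  by have := phiM j k k; have := nrm_ge0 ip (phi j k); nra.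
have Lphi0 : forall j k, L (phi j k) = 0.
  apply: (@subdivision_orbit_eq0 R A s (fun j k => L (phi j k))).
  - move=> j; apply/funext => k; have := Lpsi _ (refine j k).
    rewrite LB => /eqP; rewrite subr_eq0 => /eqP ->.
    rewrite (big_morph L LD L0) /subdivision; apply: eq_bigr => i _.
    by rewrite LZ /upsample; case: ifP => _; rewrite ?L0.
  - move=> j; exists (C ^+ 2 * (M * (2 * r)%:R)) => F.
    exact: (functional_square_summable ipP (phiM j) (phir j)).
  - move=> k e e0.
    have e4 : 0 < e / 3 / (M + 1) by rewrite !divr_gt0// ltr_wpDl.
    have [u Hu] := Lapp _ e4.
    have [v [n [c [g [gphi ->]]]] uv] := dense u _ e4.
    have [N HN] : exists N : nat, forall j : int, (N <= `|j|)%N ->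
        `|ip (\sum_(i < n) c i *: g i) (phi j k)| <= e / 3.
      have e1 : 0 < e / 3 by rewrite divr_gt0.
      elim/big_ind: _ (e / 3) e1 => [e' e'0|x y Hx Hy e' e'0|i _ e' e'0].
      + by exists 0 => j _; rewrite ip0l// normr0 ltW.
      + have [N1 H1] := Hx _ (divr_gt0 e'0 (ltr0Sn _ 1)).
        have [N2 H2] := Hy _ (divr_gt0 e'0 (ltr0Sn _ 1)).
        exists (maxn N1 N2) => j; rewrite geq_max => /andP[j1 j2].
        rewrite ipDl// (le_trans (ler_normD _ _))// [leRHS]splitr lerD//.
          exact: H1.
        exact: H2.
      + have [j1 [k1 ->]] := gphi i.
        have c1 : 0 < `|c i| + 1 by rewrite ltr_wpDl.
        have [N HN] := decay j1 k1 k _ (divr_gt0 e'0 c1).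
        exists N => j /HN; rewrite ipZl// normrM ler_pdivlMr// => H.
        by rewrite (le_trans _ H)// mulrC ler_wpM2l// lerDl.
    exists N => j /HN; set w := \sum_(i < n) _ in uv * => H.
    have e3 : e / 3 / (M + 1) * nrm (phi j k) <= e / 3.
      rewrite -[leRHS](divfK (x := M + 1)) ?gt_eqF ?ltr_wpDl// ler_wpM2l//.
      exact: ltW.
    have -> : L (phi j k) = (L (phi j k) - ip u (phi j k)) +
        ip (u - w) (phi j k) + ip w (phi j k) by rewrite ipBl//; ring.
    have -> : e = e / 3 + e / 3 + e / 3 by field.
    rewrite (le_trans (ler_normD _ _))// lerD// (le_trans (ler_normD _ _))// lerD//.
      exact: le_trans (Hu _) e3.
    rewrite (le_trans (cauchy_schwarz ipP _ _))//.
    by rewrite (le_trans _ e3)// ler_wpM2r ?nrm_ge0// ltW.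
(* [L] vanishes on a dense subspace and is bounded *)
have Lspan y : lspan [set x | exists j k, x = phi j k] y -> L y = 0.
  move=> [n [c [g [gphi ->]]]]; rewrite (big_morph L LD L0) big1// => i _.
  by have [j [k ->]] := gphi i; rewrite LZ Lphi0 mulr0.
apply/eqP; rewrite -normr_le0; apply/ler_addgt0Pr => e e0; rewrite add0r.
have C1 : 0 < C + 1 by rewrite ltr_wpDl.
have [y /Lspan Ly hy] := dense h _ (divr_gt0 e0 C1).
rewrite ltr_pdivlMr// in hy.
have -> : L h = L (h - y) by rewrite LB Ly subr0.
rewrite (le_trans (LC _))//; have := nrm_ge0 ip (h - y); nra.
Qed.

(** The test vectors [theta q] read off the coefficients of [w q], but may also see
    the [w q'] with [q' > q].  Hence the components are removed one at a time,
    starting from the highest [q]: if [x] is orthogonal to all test vectors, the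
    coefficients of the [w q] in an approximation of [x] are small by Bessel's
    inequality, and dropping them keeps the approximation. *)
Lemma triangular_dual_eq0 (w theta : nat -> int -> V) (p : nat) (x : V) :
  (forall q, (q < p)%N -> exists (M : R) (r : nat),
     (forall k l, `|ip (w q k) (w q l)| <= M) /\
     (forall k l : int, (r <= `|k - l|)%N -> ip (w q k) (w q l) = 0)) ->
  (forall q, (q < p)%N -> exists (M : R) (r : nat),
     (forall k l, `|ip (theta q k) (theta q l)| <= M) /\
     (forall k l : int, (r <= `|k - l|)%N -> ip (theta q k) (theta q l) = 0)) ->
  (forall q' q k l, (q' < q < p)%N -> ip (w q' k) (theta q l) = 0) ->
  (forall q k l, (q < p)%N -> ip (w q k) (theta q l) = (k == l)%:R) ->
  (forall q k, (q < p)%N -> ip x (theta q k) = 0) ->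
  ipclosure (lspan [set y | exists q k, (q < p)%N /\ y = w q k]) x -> nrm x = 0.
Proof.
elim: p => [|p IH] wM tM wt0 wt1 xt xw.
  apply/eqP; rewrite eq_le nrm_ge0 andbT; apply/ler_addgt0Pr => e e0; rewrite add0r.
  have [y [n [c [g [gE ->]]]] xy] := xw e e0.
  suff y0 : \sum_(i < n) c i *: g i = 0 by rewrite y0 subr0 in xy; exact: ltW.
  by apply: big1 => i _; have [q [k []]] := gE i.
apply: IH.
- by move=> q qp; apply: wM; rewrite ltnW.
- by move=> q qp; apply: tM; rewrite ltnW.
- by move=> q' q k l /andP[qq qp]; apply: wt0; rewrite qq ltnW.
- by move=> q k l qp; apply: wt1; rewrite ltnW.
- by move=> q k qp; apply: xt; rewrite ltnW.
set S := lspan _.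
have [Mw [rw [HMw Hrw]]] := wM p (ltnSn p).
have [Mt [rt [HMt Hrt]]] := tM p (ltnSn p).
have Mw0 : 0 <= Mw by apply: le_trans (HMw 0 0).
have Mt0 : 0 <= Mt by apply: le_trans (HMt 0 0).
have decomp y : lspan [set y | exists q k, (q < p.+1)%N /\ y = w q k] y ->
    exists y' y'', [/\ S y', fspan (w p) y'' & y = y' + y''].
  apply: (@lspan_min _ _ _ [set y0 | exists y' y'', [/\ S y', fspan (w p) y'' & y0 = y' + y'']]).
    split.
      exists 0, 0; split; rewrite ?addr0//.
        by case: (lspan_subspace [set y | exists q k, (q < p)%N /\ y = w q k]).
      by case: (fspan_subspace (w p)).
    move=> a _ _ [y1 [y2 [Sy1 Fy2 ->]]] [z1 [z2 [Sz1 Fz2 ->]]].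
    exists (a *: y1 + z1), (a *: y2 + z2); split.
    - exact: (proj2 (lspan_subspace _)).
    - exact: (proj2 (fspan_subspace _)).
    - by rewrite scalerDr addrACA.
  move=> z [q [k [qp ->]]]; move: qp; rewrite ltnS leq_eqVlt => /orP[/eqP ->|qp].
    exists 0, (w p k); split; rewrite ?add0r//.
      by case: (lspan_subspace [set y | exists q k, (q < p)%N /\ y = w q k]).
    by exists [fset k]%fset, (fun=> 1); rewrite big_seq_fset1 scale1r.
  exists (w q k), 0; split; rewrite ?addr0//.
    by apply: sub_lspan; exists q, k.
  by case: (fspan_subspace (w p)).
pose K := (Mw * (2 * rw)%:R) * (Mt * (2 * rt)%:R).
have K0 : 0 <= K by rewrite !mulr_ge0.
move=> e e0.
have K1 : 0 < 2 + K by rewrite ltr_wpDr.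
have [y /decomp [y' [y'' [Sy' [F [c y''E]] yE]]] xy] := xw _ (divr_gt0 e0 K1).
exists y' => //.
have cE k : k \in F -> c k = ip (y - x) (theta p k).
  move=> kF; rewrite ipBl// xt// subr0 yE ipDl//.
  have -> : ip y' (theta p k) = 0.
    have [n [d [g [gE ->]]]] := Sy'; rewrite ip_suml// big1// => i _.
    by have [q [l [qp ->]]] := gE i; rewrite ipZl// wt0 ?mulr0// qp ltnSn.
  rewrite add0r y''E ip_suml// (big_fsetD1 k)//= ipZl// wt1// eqxx mulr1.
  rewrite big_seq_cond big1 ?addr0// => l; rewrite !inE andbT => /andP[lk _].
  by rewrite ipZl// wt1// (negPf lk) mulr0.
have c2 : \sum_(k <- F) c k ^+ 2 <= nrm (x - y) ^+ 2 * (Mt * (2 * rt)%:R).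
  rewrite nrmBC// (le_trans _ (bessel ipP HMt Hrt F (y - x)))//.
  by rewrite big_seq [leRHS]big_seq; apply: ler_sum => k kF; rewrite cE.
have y2 : nrm y'' ^+ 2 <= nrm (x - y) ^+ 2 * K.
  rewrite y''E (le_trans (almost_orthogonal_upper ipP HMw Hrw F c))//.
  rewrite /K [leRHS]mulrCA ler_wpM2l// mulr_ge0//.
have : nrm (x - y') <= nrm (x - y) + nrm y''.
  by rewrite (_ : x - y' = (x - y) + y'') ?nrmD// yE opprD addrA subrK.
rewrite ltr_pdivlMr// in xy.
have n1 := nrm_ge0 ip (x - y); have n2 := nrm_ge0 ip y''.
have : nrm y'' <= nrm (x - y) * (1 + K).
  rewrite -(@ler_pXn2r _ 2)// ?nnegrE ?mulr_ge0 ?addr_ge0// exprMn.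
  by rewrite (le_trans y2)// ler_wpM2l ?sqr_ge0//; nra.
by move=> h1 h2; nra.
Qed.

End AffineSystems.

(** * Square integrable functions *)

Section L2.
Context {R : realType}.
Local Notation mu := (@lebesgue_measure R).
Implicit Types f g : R -> R.

(** Square integrable functions rather than their classes: the semi-inner product of
    this vector space vanishes on functions that are zero almost everywhere. *)
Definition L2T := LfunType mu (lee1n 2).

Definition L2fun f (Lf : L2 f) : L2T := Lfun_Sub (lee1n 2) (Lf : f \in Lfun mu 2%:E).
Lemma L2_L2T (h : L2T) : L2 (h : R -> R).
Proof. by rewrite /L2/=; exact: LfunP. Qed.

Lemma L2P f : L2 f <-> measurable_fun setT f /\ (\int[mu]_x ((f x) ^+ 2)%:E < +oo)%E.
Proof.
split.
  move=> Lf; split; first by move: Lf; rewrite /L2/= inE => /andP[/[!inE]].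
  have /integrableP[_] := Lfun2_integrable_sqr Lf.
  by under eq_integral do rewrite /= ger0_norm ?sqr_ge0//.
move=> [mf fi]; rewrite /L2/= inE; apply/andP; split; rewrite inE//=.
rewrite /finite_norm unlock/=.
apply: poweR_lty.
by under eq_integral do rewrite powR_mulrn// real_normK ?num_real//.
Qed.

Definition l2ip f g : R := \int[mu]_x (f x * g x).

Lemma L2_mul_integrable f g : L2 f -> L2 g -> mu.-integrable setT (fun x => (f x * g x)%:E).
Proof. by move=> Lf Lg; apply/Lfun1_integrable; exact: Lfun2_mul_Lfun1. Qed.

Lemma L2_semi_inner : semi_inner (fun f g : L2T => l2ip f g).
Proof.
split.
- by move=> f g; apply: eq_Rintegral => x _; rewrite mulrC.
- move=> a f g h; rewrite /l2ip -RintegralZl//; last exact: (L2_mul_integrable (L2_L2T f) (L2_L2T h)).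
  rewrite -RintegralD//.
  + by apply: eq_Rintegral => x _ /=; rewrite mulrDl mulrA.
  + apply: (@integrableZl _ _ _ mu setT measurableT a (fun x => (f x * h x)%:E)).
    exact: (L2_mul_integrable (L2_L2T f) (L2_L2T h)).
  + exact: (L2_mul_integrable (L2_L2T g) (L2_L2T h)).
- by move=> f; apply: Rintegral_ge0 => x _; rewrite -expr2 sqr_ge0.
Qed.

Definition l2nrm f : R := Num.sqrt (l2ip f f).

Lemma L2_norm f : L2 f -> ('N[mu]_2%:E[EFin \o f] = (l2nrm f)%:E)%E.
Proof.
move=> Lf; rewrite unlock/= /l2nrm.
under eq_integral do rewrite powR_mulrn// real_normK ?num_real// expr2.
rewrite -[X in (X `^ _)%E]fineK; last by apply: integrable_fin_num => //; exact: L2_mul_integrable.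
rewrite poweR_EFin powR12_sqrt//.
by apply: (@Rintegral_ge0 _ _ _ mu setT (fun x => f x * f x)) => x _; rewrite -expr2 sqr_ge0.
Qed.

Lemma L2B f g : L2 f -> L2 g -> L2 (f - g).
Proof. by move=> Lf Lg; exact: (L2_L2T (L2fun Lf - L2fun Lg)). Qed.

Local Notation ipH := (fun f g : L2T => l2ip f g).
Local Notation toR := (fun h : L2T => h : R -> R).

Lemma L2T_sumE (I : Type) (s : seq I) (P : pred I) (F : I -> L2T) :
  toR (\sum_(i <- s | P i) F i) = \sum_(i <- s | P i) toR (F i).
Proof. by elim/big_ind2: _ => // x1 x2 y1 y2 <- <-. Qed.

Lemma linear_span_lspan (G : set (R -> R)) : (forall g, G g -> L2 g) ->
  linear_span G = toR @` (lspan [set h : L2T | G h]).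
Proof.
move=> GL; apply/seteqP; split => [f [n [c [g [Gg ->]]]]|_ [h [n [c [g [Gg ->]]]] <-]]; last first.
  by exists n, c, (fun i => toR (g i)); split => //; rewrite L2T_sumE.
exists (\sum_(i < n) c i *: L2fun (GL _ (Gg i))); last by rewrite L2T_sumE.
exists n, c, (fun i => L2fun (GL _ (Gg i))); split => //.
Qed.

Lemma L2closureE (G : set L2T) f : L2closure (toR @` G) f <->
  exists2 h : L2T, ipclosure ipH G h & toR h = f.
Proof.
split=> [[Lf nf]|[h nh <-]]; last first.
  split; first exact: L2_L2T.
  move=> e e0; have [g Gg hg] := nh e e0; exists (toR g); first by exists g.
  rewrite L2_norm ?lte_fin//; exact: (L2_L2T (h - g)).
exists (L2fun Lf) => // e e0; have [_ [g Gg <-] fg] := nf e e0.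
exists g => //; move: fg; rewrite L2_norm ?lte_fin//.
by apply: L2B => //; exact: L2_L2T.
Qed.

Lemma L2closure_spanE (G : set (R -> R)) f : (forall g, G g -> L2 g) ->
  L2closure (linear_span G) f <->
  exists2 h : L2T, ipclosure ipH (lspan [set h : L2T | G h]) h & toR h = f.
Proof. by move=> GL; rewrite linear_span_lspan//; exact: L2closureE. Qed.

Lemma measurable_affine (c b : R) : measurable_fun setT (fun x : R => c * x + b).
Proof. by apply: measurable_funD => //; apply: measurable_funM. Qed.

Lemma lebesgue_measure_affine (c b : R) (A : set R) : 0 < c -> measurable A ->
  (mu ((fun x => (c * x + b)%R) @^-1` A) = c^-1%:E * mu A)%E.
Proof.
move=> c0 mA.
pose phi : measurableTypeR R -> measurableTypeR R := fun x => c * x + b.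
have mphi : measurable_fun setT phi := measurable_affine c b.
pose nu := mscale (NngNum (ltW c0)) (pushforward mu phi).
suff : mu A = nu mphi A.
  by rewrite /nu /mscale/= /pushforward => ->; rewrite muleA -EFinM mulVf ?gt_eqF// mul1e.
apply: lebesgue_measure_unique => //= _ [[u v]] _ <-.
rewrite /nu /mscale/= /pushforward.
rewrite (_ : phi @^-1` _ = `](u - b) / c, (v - b) / c]%classic); last first.
  apply/seteqP; split => x /=; rewrite !in_itv/= /phi ltr_pdivrMr// ler_pdivlMr//;
    by rewrite ltrBlDr lerBrDr (mulrC x).
rewrite !lebesgue_measure_itv/= !lte_fin ltr_pM2r ?invr_gt0// ltrD2r.
case: ifP => _; last by rewrite mule0.
by rewrite -!EFinB -EFinM; congr (_%:E); field; rewrite gt_eqF.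
Qed.

(** The affine map pushes the Lebesgue measure forward to a multiple of itself. *)
Lemma ge0_integral_affine (c b : R) (f : R -> \bar R) : 0 < c ->
  measurable_fun setT f -> (forall x, 0 <= f x)%E ->
  (\int[mu]_x f (c * x + b)%R = c^-1%:E * \int[mu]_x f x)%E.
Proof.
move=> c0 mf f0; have ci0 : 0 <= c^-1 by rewrite invr_ge0 ltW.
pose phi : measurableTypeR R -> measurableTypeR R := fun x => c * x + b.
have mphi : measurable_fun setT phi := measurable_affine c b.
transitivity (\int[mu]_(x in phi @^-1` setT) (f \o phi) x)%E; first by rewrite preimage_setT.
rewrite -(@ge0_integral_pushforward _ _ _ _ _ phi mphi _ setT f measurableT mf (fun _ _ => f0 _)).
rewrite -(@ge0_integral_mscale _ _ _ mu setT measurableT (NngNum ci0) f)//.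
by apply: eq_measure_integral => A mA _; rewrite [LHS](lebesgue_measure_affine b c0 mA).
Qed.

Lemma Rintegral_affine (c b : R) (f : R -> R) : 0 < c ->
  mu.-integrable setT (EFin \o f) ->
  \int[mu]_x f (c * x + b) = c^-1 * \int[mu]_x f x.
Proof.
move=> c0 fi; rewrite -RintegralZl// /Rintegral.
have mf : measurable_fun setT (EFin \o f) := measurable_int mu fi.
congr fine; under [RHS]eq_integral do rewrite EFinM.
rewrite integralZl// [LHS]integralE [X in (_ * X)%E]integralE.
have E (g : R -> \bar R) : measurable_fun setT g -> (forall x, 0 <= g x)%E ->
  (\int[mu]_x g (c * x + b)%R = c^-1%:E * \int[mu]_x g x)%E by exact: ge0_integral_affine.
have /= Ep := E _ (measurable_funepos mf) (funepos_ge0 _).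
have /= En := E _ (measurable_funeneg mf) (funeneg_ge0 _).
rewrite muleBr//; last first.
  apply: fin_num_adde_defl; rewrite fin_numN; apply: integrable_fin_num => //.
  exact: integrable_funeneg.
pose phi (x : measurableTypeR R) := c * x + b.
rewrite -[LHS]/(\int[mu]_x ((EFin \o f) \o phi)^\+ x -
  \int[mu]_x ((EFin \o f) \o phi)^\- x)%E.
under [X in (X - _)%E]eq_integral do rewrite funepos_comp/=.
under [X in (_ - X)%E]eq_integral do rewrite funeneg_comp/=.
exact: (congr2 (fun a b => (a - b)%E) Ep En).
Qed.

End L2.

(** * Bounded functions of compact support *)

Section LocalFunctions.
Context {R : realType}.
Local Notation mu := (@lebesgue_measure R).
Implicit Types f g : R -> R.

Definition local f := measurable_fun setT f /\ exists (B : R) (r : nat),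
  forall x, `|f x| <= B /\ (r%:R <= `|x| -> f x = 0).

Lemma local_integrable f : local f -> mu.-integrable setT (EFin \o f).
Proof.
move=> [mf [B [r fB]]].
have B0 : 0 <= B by have [h _] := fB 0; exact: le_trans h.
apply: (@le_integrable _ _ _ mu setT measurableT _ (EFin \o (B \o* \1_(`[- r%:R, r%:R] : set R)))).
- exact/measurable_EFinP.
- move=> x _; rewrite /= lee_fin indicE; have [xB x0] := fB x.
  have [xr|xr] := lerP (r%:R : R) `|x|; first by rewrite x0// normr0.
  rewrite mem_set ?mulr1 ?mul1r; first by rewrite (le_trans xB) ?ler_norm.
  by move: xr; rewrite ltr_norml/= in_itv/= => /andP[/ltW -> /ltW ->].
- apply: (@integrableZr _ _ _ mu setT measurableT B (EFin \o \1_(`[- r%:R, r%:R] : set R))).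
  exact: integrable_indic_itv.
Qed.

Lemma localM f g : local f -> local g -> local (fun x => f x * g x).
Proof.
move=> [mf [B [r fB]]] [mg [B' [r' gB]]]; split; first exact: measurable_funM.
exists (B * B'), r => x; have [f1 f2] := fB x; have [g1 g2] := gB x; split.
  by rewrite normrM ler_pM.
by move=> /f2 ->; rewrite mul0r.
Qed.

Lemma localD f g : local f -> local g -> local (fun x => f x + g x).
Proof.
move=> [mf [B [r fB]]] [mg [B' [r' gB]]]; split; first exact: measurable_funD.
exists (B + B'), (maxn r r') => x; have [f1 f2] := fB x; have [g1 g2] := gB x; split.
  by rewrite (le_trans (ler_normD _ _)) ?lerD.
move=> H; rewrite f2 ?g2 ?addr0//; apply: le_trans H; rewrite ler_nat.
  by rewrite leq_maxr.
by rewrite leq_maxl.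
Qed.

Lemma local0 : local (fun=> 0).
Proof. by split=> //; exists 0, 0 => x; rewrite normr0. Qed.

Lemma localZ a f : local f -> local (fun x => a * f x).
Proof.
move=> [mf [B [r fB]]]; split; first exact: measurable_funM.
exists (`|a| * B), r => x; have [f1 f2] := fB x; split.
  by rewrite normrM ler_wpM2l.
by move=> /f2 ->; rewrite mulr0.
Qed.

Lemma local_sum (I : Type) (s : seq I) (F : I -> R -> R) :
  (forall i, local (F i)) -> local (fun x => \sum_(i <- s) F i x).
Proof.
move=> LF; elim: s => [|i s IH]; first by under eq_fun do rewrite big_nil; exact: local0.
by under eq_fun do rewrite big_cons; exact: localD.
Qed.

Lemma local_norm f : local f -> local (fun x => `|f x|).
Proof.
move=> [mf [B [r fB]]]; split; first exact: measurableT_comp.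
exists B, r => x; have [f1 f2] := fB x; rewrite normr_id; split => //.
by move=> /f2 ->; rewrite normr0.
Qed.

Lemma local_affine_neq0 c b f : c != 0 -> local f -> local (fun x => f (c * x + b)).
Proof.
move=> c0 [mf [B [r fB]]]; split.
  exact: (measurableT_comp mf (measurable_affine c b)).
have {}c0 : 0 < `|c| by rewrite normr_gt0.
exists B, (Num.truncn ((r%:R + `|b|) / `|c|)).+1 => x; have [f1 f2] := fB (c * x + b).
split => // H; apply: f2.
have : (r%:R + `|b|) / `|c| < `|x| by rewrite (lt_le_trans _ H)// truncnS_gt.
rewrite ltr_pdivrMr// => h.
rewrite -(lerD2r `|b|) (le_trans (ltW h))// mulrC -normrM.
by rewrite -[X in `|X| <= _](addrK b) ler_normB.
Qed.

Lemma local_affine c b f : 0 < c -> local f -> local (fun x => f (c * x + b)).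
Proof. by move=> /lt0r_neq0; exact: local_affine_neq0. Qed.

Lemma local_L2 f : local f -> L2 f.
Proof.
move=> lf; apply/L2P; split; first by case: lf.
have /local_integrable/integrableP[_] := localM lf lf.
by under eq_integral do rewrite /= ger0_norm -?expr2 ?sqr_ge0//.
Qed.

Lemma two_powR_sqr (j : int) : (2 `^ (j%:~R / 2)) ^+ 2 = 2 ^ j :> R.
Proof. by rewrite -powR_mulrn ?powR_ge0// -powRrM divfK// powR_intmul. Qed.

Lemma dilateE f j k : dilate f j k = (fun x => 2 `^ (j%:~R / 2) * f (2 ^ j * x + - k%:~R)).
Proof. by []. Qed.

Lemma local_dilate f j k : local f -> local (dilate f j k).
Proof. by move=> lf; rewrite dilateE; apply/localZ/local_affine => //; rewrite exprz_gt0. Qed.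

Lemma l2ip_affine (c b : R) f g : 0 < c -> L2 f -> L2 g ->
  l2ip (fun x => f (c * x + b)) (fun x => g (c * x + b)) = c^-1 * l2ip f g.
Proof.
move=> c0 Lf Lg.
exact: (@Rintegral_affine _ c b (fun x => f x * g x) c0 (L2_mul_integrable Lf Lg)).
Qed.

Lemma l2ipZ (a b : R) f g : L2 f -> L2 g ->
  l2ip (fun x => a * f x) (fun x => b * g x) = a * b * l2ip f g.
Proof.
move=> Lf Lg; rewrite /l2ip -RintegralZl//; last exact: L2_mul_integrable.
by apply: eq_Rintegral => x _; rewrite mulrACA.
Qed.

(** Only the relative position of two translates on the same scale matters. *)
Lemma l2ip_dilate f g j k l : local f -> local g ->
  l2ip (dilate f j k) (dilate g j l) = l2ip f (fun x => g (x + (k - l)%:~R)).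
Proof.
move=> lf lg; have j0 : 0 < (2 : R) ^ j by rewrite exprz_gt0.
have lg' : local (fun x => g (x + (k - l)%:~R)).
  have := local_affine (k - l)%:~R ltr01 lg.
  by under eq_fun do rewrite mul1r.
rewrite !dilateE l2ipZ; last 2 first.
- by apply/local_L2/local_affine.
- by apply/local_L2/local_affine.
rewrite -expr2 two_powR_sqr -[RHS](mulKf (lt0r_neq0 j0)) mulrCA; congr (_ * _).
rewrite -(@l2ip_affine _ (- k%:~R)) //; [|exact: local_L2|exact: local_L2].
rewrite /l2ip; apply: eq_Rintegral => x _; congr (_ * g _).
by rewrite rmorphB/=; ring.
Qed.

Lemma local_translate (b : R) f : local f -> local (fun x => f (x + b)).
Proof. by move=> lf; have := local_affine b ltr01 lf; under eq_fun do rewrite mul1r. Qed.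

Lemma l2ip_translates_far f g : local f -> local g -> exists r : nat,
  forall k : int, (r <= `|k|)%N -> l2ip f (fun x => g (x + k%:~R)) = 0.
Proof.
move=> [_ [B [r fB]]] [_ [B' [r' gB]]]; exists (r + r')%N => k rk.
rewrite /l2ip [RHS](_ : 0 = \int[mu]_x 0); last first.
  by rewrite /Rintegral integral0.
apply: eq_Rintegral => x _; have [_ f2] := fB x; have [_ g2] := gB (x + k%:~R).
have [/f2 ->|xr] := lerP (r%:R : R) `|x|; first by rewrite mul0r.
rewrite g2 ?mulr0//.
have : ((r + r')%N%:R : R) <= `|k%:~R| by rewrite -intr_norm -abszE -pmulrn ler_nat.
rewrite natrD => h.
have : `|k%:~R : R| <= `|x + k%:~R| + `|x| by rewrite -[X in `|X| <= _](addKr x) addrC ler_normB.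
lra.
Qed.

(** Dilation is unitary, so that bound and band width are those of the scale 0. *)
Lemma dilate_gram f : local f -> exists (M : R) (r : nat), forall j,
  (forall k l, `|l2ip (dilate f j k) (dilate f j l)| <= M) /\
  (forall k l : int, (r <= `|k - l|)%N -> l2ip (dilate f j k) (dilate f j l) = 0).
Proof.
move=> lf; have [r fr] := l2ip_translates_far lf lf.
exists (l2nrm f ^+ 2), r => j; split; last by move=> k l kl; rewrite l2ip_dilate ?fr.
move=> k l.
have nk i : l2nrm (dilate f j i) = l2nrm f.
  rewrite /l2nrm l2ip_dilate// subrr; congr Num.sqrt; apply: eq_Rintegral => x _.
  by rewrite addr0.
have := cauchy_schwarz L2_semi_inner (L2fun (local_L2 (local_dilate j k lf)))
  (L2fun (local_L2 (local_dilate j l lf))).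
by rewrite /nrm/= -/(l2nrm (dilate f j k)) -/(l2nrm (dilate f j l)) !nk expr2.
Qed.

Lemma l2ipC f g : l2ip f g = l2ip g f.
Proof. by apply: eq_Rintegral => x _; rewrite mulrC. Qed.

(** Bound one factor by its supremum and integrate the other. *)
Lemma dilate_scale_bound f g : local f -> local g -> exists K : R, 0 <= K /\ forall i j k l,
  `|l2ip (dilate f i l) (dilate g j k)| <= K * 2 `^ ((i - j)%:~R / 2).
Proof.
move=> lf lg; have [_ [B [r fB]]] := lf.
have B0 : 0 <= B by have [h _] := fB 0; exact: le_trans h.
pose I := \int[mu]_x `|g x|.
have I0 : 0 <= I by apply: Rintegral_ge0.
exists (B * I); split; first exact: mulr_ge0.
move=> i j k l.
have lD := local_dilate i l lf; have lE := local_dilate j k lg.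
have bi : mu.-integrable setT (EFin \o (fun x => B * 2 `^ (i%:~R / 2) * `|dilate g j k x|)).
  by apply/local_integrable/localZ/local_norm.
rewrite /l2ip (le_trans (le_normr_Rintegral _ _))//.
  exact: (local_integrable (localM lD lE)).
apply: (@le_trans _ _ (\int[mu]_x (B * 2 `^ (i%:~R / 2) * `|dilate g j k x|))).
  apply: le_Rintegral => //.
    by apply: (local_integrable (local_norm (localM lD lE))).
  move=> x _; rewrite normrM ler_wpM2r// /dilate normrM ger0_norm ?powR_ge0// mulrC.
  by rewrite ler_wpM2r ?powR_ge0//; have [] := fB (2 ^ i * x - l%:~R).
rewrite RintegralZl//; last exact: (local_integrable (local_norm lE)).
rewrite [X in _ * X](_ : _ = 2 `^ (j%:~R / 2) * (2 ^ j)^-1 * I); last first.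
  have j0 : 0 < (2 : R) ^ j by rewrite exprz_gt0.
  have lA : local (fun x => `|g (2 ^ j * x + - k%:~R)|).
    by apply/local_norm/local_affine.
  rewrite -mulrA -(@Rintegral_affine _ _ (- k%:~R) (fun x => `|g x|) j0); last first.
    exact: (local_integrable (local_norm lg)).
  rewrite -RintegralZl//; last exact: (local_integrable lA).
  by apply: eq_Rintegral => x _; rewrite /dilate normrM ger0_norm ?powR_ge0.
rewrite -two_powR_sqr rmorphB/= mulrBl powRB; last by rewrite pnatr_eq0 implybT.
by rewrite le_eqVlt; apply/orP; left; apply/eqP; field; rewrite gt_eqF ?powR_gt0.
Qed.

(** The pairing of two dilates is small as soon as their scales are far apart: take the
    supremum of the wide factor and the integral of the narrow one. *)
Lemma dilate_weak_decay f g : local f -> local g -> forall i l k (e : R), 0 < e ->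
  exists N : nat, forall j : int, (N <= `|j|)%N -> `|l2ip (dilate f i l) (dilate g j k)| <= e.
Proof.
move=> lf lg i l k e e0.
have [K1 [K10 H1]] := dilate_scale_bound lf lg.
have [K2 [K20 H2]] := dilate_scale_bound lg lf.
pose K := K1 + K2 + 1.
have K0 : 0 < K by rewrite /K; lra.
pose n := (Num.truncn ((K / e) ^+ 2)).+1.
have nK : (K / e) ^+ 2 < (2 : R) ^+ n.
  by rewrite (lt_trans (truncnS_gt _))// -natrX ltr_nat ltn_expl.
have small (d : int) : (n%:Z <= d) -> K * 2 `^ ((- d)%:~R / 2) <= e.
  move=> nd; rewrite -(@ler_pXn2r _ 2)// ?nnegrE ?mulr_ge0 ?powR_ge0 ?(ltW e0) ?(ltW K0)//.
  rewrite exprMn two_powR_sqr -invr_expz ler_pdivrMr ?exprz_gt0//.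
  rewrite mulrC -ler_pdivrMr ?exprn_gt0// -expr_div_n (le_trans (ltW nK))//.
  by rewrite exprnP ler_eXz2l// ltr1n.
exists (n + `|i|)%N => j nj.
have [ij|ij] := lerP i j.
  rewrite (le_trans (H1 _ _ _ _))// (le_trans _ (small (j - i) _))//; last by lia.
  by rewrite opprB ler_wpM2r ?powR_ge0// /K; lra.
rewrite l2ipC (le_trans (H2 _ _ _ _))// (le_trans _ (small (i - j) _))//; last by lia.
by rewrite opprB ler_wpM2r ?powR_ge0// /K; lra.
Qed.

End LocalFunctions.

(** * Polynomial pieces of B-splines *)

Section PolynomialIntegrals.
Context {R : realType}.
Local Notation mu := (@lebesgue_measure R).
Implicit Types p q : {poly R}.

(** The antiderivative that vanishes at 0. *)
Definition Pint p : {poly R} := \poly_(i < (size p).+1) (p`_i.-1 / i%:R).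

Lemma coef_Pint p i : (Pint p)`_i = p`_i.-1 / i%:R.
Proof.
rewrite coef_poly ltnS; case: ltnP => // ip.
have [->|i0] := posnP i; first by rewrite invr0 mulr0.
by rewrite nth_default ?mul0r// -ltnS prednK.
Qed.

Lemma deriv_Pint p : (Pint p)^`() = p.
Proof.
apply/polyP => i; rewrite coef_deriv coef_Pint/= -[LHS]mulr_natr divfK//.
Qed.

Lemma PintD p q : Pint (p + q) = Pint p + Pint q.
Proof. by apply/polyP => i; rewrite coefD !coef_Pint coefD mulrDl. Qed.

Lemma Pint0 : Pint 0 = 0.
Proof. by apply/polyP => i; rewrite coef_Pint !coef0 mul0r. Qed.

Lemma Pint_sum (I : Type) (s : seq I) (F : I -> {poly R}) :
  Pint (\sum_(i <- s) F i) = \sum_(i <- s) Pint (F i).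
Proof. exact: (big_morph Pint PintD Pint0). Qed.

Lemma Pint1_1 : (Pint 1).[1] = 1.
Proof.
suff -> : Pint 1 = 'X by rewrite hornerX.
apply/polyP => i; rewrite coef_Pint coefX coef1.
by case: i => [|[|i]]//=; rewrite ?invr0 ?mulr0 ?divr1 ?mul0r.
Qed.

Lemma Pint_0 p : (Pint p).[0] = 0.
Proof. by rewrite horner_coef0 coef_Pint invr0 mulr0. Qed.

Lemma Rintegral_deriv_poly p (a b : R) : a <= b ->
  \int[mu]_(t in `[a, b]) p^`().[t] = p.[b] - p.[a].
Proof.
rewrite le_eqVlt => /orP[/eqP <-|ab].
  by rewrite subrr set_itv1 Rintegral_set1.
rewrite /Rintegral (@continuous_FTC2 _ (horner p^`()) (horner p))//.
- by apply: continuous_subspaceT; exact: continuous_horner.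
- split.
  + by move=> x _; exact: derivable_horner.
  + by apply: cvg_at_right_filter; exact: continuous_horner.
  + by apply: cvg_at_left_filter; exact: continuous_horner.
- by move=> x _; rewrite derivE.
Qed.

Lemma Rintegral_poly_flip q (a b c : R) : a <= b ->
  \int[mu]_(t in `[a, b]) q.[c - t] = (Pint q).[c - a] - (Pint q).[c - b].
Proof.
move=> ab; pose P := - (Pint q \Po (c%:P - 'X)).
have PE x : P.[x] = - (Pint q).[c - x] by rewrite /P hornerN horner_comp !hornerE.
have dP : P^`() = q \Po (c%:P - 'X).
  by rewrite derivN deriv_comp deriv_Pint derivB derivC derivX sub0r mulrN1 opprK.
have := @Rintegral_deriv_poly P a b ab; rewrite !PE dP opprK [X in _ = X]addrC => <-.
by apply: eq_Rintegral => x _; rewrite horner_comp !hornerE.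
Qed.

Lemma poly_bound p : exists B : R, forall x, 0 <= x <= 1 -> `|p.[x]| <= B.
Proof.
exists (\sum_(i < size p) `|p`_i|) => x /andP[x0 x1].
rewrite horner_coef (le_trans (ler_norm_sum _ _ _))//; apply: ler_sum => i _.
by rewrite normrM ler_piMr// normrX ger0_norm// exprn_ile1.
Qed.

Definition box p (x : R) : R := \1_(`[0, 1[ : set R) x * p.[x].

Lemma local_box p : local (box p).
Proof.
have [B pB] := poly_bound p; split.
  apply: measurable_funM; last exact: measurable_poly.
  exact: measurable_indic.
exists B, 1 => x; rewrite /box indicE.
have B0 : 0 <= B by apply: le_trans (pB 0 _); rewrite ?lexx ?ler01.
have [|] := boolP (x \in `[0, 1[%classic); rewrite ?inE/= ?notin_setE/= in_itv/=.
  move=> /andP[x0 x1]; rewrite mul1r; split; first by rewrite pB// x0 ltW.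
  by rewrite ger0_norm// => /(lt_le_trans x1); rewrite ltxx.
by rewrite mul0r normr0.
Qed.

Lemma l2ip_box p q : l2ip (box p) (box q) = (Pint (p * q)).[1].
Proof.
have := @Rintegral_deriv_poly (Pint (p * q)) 0 1 ler01.
rewrite Pint_0 subr0 deriv_Pint => <-.
have il : mu.-integrable `[0, 1[ (EFin \o horner (p * q)).
  apply: (@integrableS _ _ _ mu `[0, 1] _) => //; first by apply: subset_itvl; rewrite bnd_simp.
  apply: continuous_compact_integrable; first exact: segment_compact.
  by apply: continuous_subspaceT; exact: continuous_horner.
rewrite -Rintegral_itv_bndo_bndc// Rintegral_mkcond /l2ip; apply: eq_Rintegral => x _.
rewrite patchE /box indicE; case: ifP => _; last by rewrite !mul0r.
by rewrite !mul1r hornerM.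
Qed.

(** The antiderivative of [p ^+ 2] is monotone on the unit interval; if it has equal
    end values, it is constant there, hence constant. *)
Lemma l2ip_box_eq0 p : l2ip (box p) (box p) = 0 -> p = 0.
Proof.
rewrite l2ip_box; set F := Pint _ => F1.
have pp a b : a <= b -> 0 <= F.[b] - F.[a].
  move=> ab; rewrite -Rintegral_deriv_poly// deriv_Pint; apply: Rintegral_ge0 => x _.
  by rewrite hornerM -expr2 sqr_ge0.
have F0 x : 0 <= x <= 1 -> F.[x] = 0.
  move=> /andP[x0 x1]; have := pp _ _ x0; have := pp _ _ x1.
  rewrite F1 Pint_0; lra.
suff : F = 0.
  move=> /(congr1 deriv); rewrite deriv_Pint deriv0 => /eqP.
  by rewrite mulf_eq0 orbb => /eqP.
apply: (@roots_geq_poly_eq0 _ _ [seq (i%:R : R)^-1 | i <- iota 1 (size F)]).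
- apply/allP => z /mapP[k]; rewrite mem_iota => /andP[k1 _] ->.
  apply/eqP/F0; rewrite invr_ge0 ler0n/= invf_le1 ?ler1n//.
  by rewrite ltr0n.
- rewrite map_inj_uniq ?iota_uniq// => i j /invr_inj/eqP.
  by rewrite eqr_nat => /eqP.
- by rewrite size_map size_iota.
Qed.

Lemma Pint_scale a p : Pint (a *: p) = a *: Pint p.
Proof. by apply/polyP => i; rewrite coefZ !coef_Pint coefZ mulrA. Qed.

(** The Gram matrix of linearly independent polynomials is invertible, and its
    inverse gives the coefficients of the dual system. *)
Lemma gram_dual n (u : 'I_n -> {poly R}) :
  (forall c : 'I_n -> R, \sum_i c i *: u i = 0 -> forall i, c i = 0) ->
  exists v : 'I_n -> {poly R}, forall i j, l2ip (box (v i)) (box (u j)) = (i == j)%:R.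
Proof.
move=> ind.
pose G : 'M[R]_n := \matrix_(i, j) l2ip (box (u i)) (box (u j)).
have lin c q : l2ip (box (\sum_i c i *: u i)) (box q) = \sum_i c i * l2ip (box (u i)) (box q).
  rewrite l2ip_box mulr_suml Pint_sum horner_sum; apply: eq_bigr => i _.
  by rewrite -scalerAl Pint_scale hornerZ l2ip_box.
have uG : G \in unitmx.
  rewrite -row_free_unit -kermx_eq0; apply/rowV0P => v /sub_kermxP vG.
  apply/rowP => i; rewrite mxE; apply: (ind (fun i => v 0 i)).
  apply: l2ip_box_eq0; rewrite lin big1// => j _.
  have := congr1 (fun M : 'rV_n => M 0 j) vG; rewrite !mxE => vGj.
  rewrite l2ipC lin -[RHS](mulr0 (v 0 j)) -[in RHS]vGj; congr (_ * _).
  by apply: eq_bigr => k _; rewrite mxE.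
exists (fun i => \sum_j (invmx G) i j *: u j) => i j; rewrite lin.
transitivity ((invmx G *m G) i j); last by rewrite mulVmx// mxE.
by rewrite mxE; apply: eq_bigr => k _; rewrite mxE.
Qed.

End PolynomialIntegrals.

Section BSplines.
Context {R : realType}.
Local Notation mu := (@lebesgue_measure R).
Local Notation N := (@bspline_rec R).

(** [pieces n i] is the polynomial that the spline [N n] is on [i, i + 1),
    in the local coordinate. *)
Fixpoint pieces (n : nat) (i : int) : {poly R} :=
  match n with
  | 0 => if i == 0 then 1 else 0
  | n'.+1 => Pint (pieces n' i) + (Pint (pieces n' (i - 1))).[1]%:P - Pint (pieces n' (i - 1))
  end.

Lemma piecesS n i : pieces n.+1 i =
  Pint (pieces n i) + (Pint (pieces n (i - 1))).[1]%:P - Pint (pieces n (i - 1)).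
Proof. by []. Qed.

Lemma pieces_out n (i : int) : (i < 0) || (n%:Z < i) -> pieces n i = 0.
Proof.
elim: n i => [|n IH] i /= Hi; first by case: eqP Hi => // ->.
by rewrite !IH ?Pint0 ?horner0 ?addr0 ?subr0//; apply/orP; case/orP: Hi => H; lia.
Qed.

(** The translates of a B-spline form a partition of unity, which averaging preserves. *)
Lemma sum_pieces n : \sum_(i < n.+1) pieces n i = 1.
Proof.
elim: n => [|n IH]; first by rewrite big_ord1.
rewrite /= big_split big_split/= sumrN.
have shift (F : {poly R} -> {poly R}) : F 0 = 0 ->
    \sum_(i < n.+2) F (pieces n (i%:Z - 1)) = \sum_(i < n.+1) F (pieces n i).
  move=> F0; rewrite big_ord_recl /= pieces_out ?F0 ?add0r//.
  apply: eq_bigr => i _; congr (F (pieces n _)); rewrite /bump/=; lia.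
rewrite (shift Pint Pint0) (shift (fun p => (Pint p).[1]%:P)); last by rewrite Pint0 horner0.
rewrite big_ord_recr/= (pieces_out (i := n.+1%:Z)) ?Pint0 ?addr0; last by lia.
rewrite addrAC subrr add0r -(big_morph _ (polyCD (R := R)) (polyC0 _)).
by rewrite -horner_sum -Pint_sum IH Pint1_1.
Qed.

(** Differentiation turns the coefficients into their consecutive differences, which
    vanish by induction; the common value of the coefficients is then zero because the
    pieces add up to 1. *)
Lemma pieces_free n (c : int -> R) :
  \sum_(i < n.+1) c i *: pieces n i = 0 -> forall i : nat, (i <= n)%N -> c i = 0.
Proof.
elim: n c => [|n IH] c.
  rewrite big_ord1/= => /eqP; rewrite scaler_eq0 oner_eq0 orbF => /eqP c0 i.
  by rewrite leqn0 => /eqP ->.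
move=> H; have D := congr1 deriv H; rewrite deriv0 raddf_sum/= in D.
have {}D : \sum_(i < n.+1) (c i%:Z - c (i%:Z + 1)) *: pieces n i = 0.
  rewrite -[RHS]D; under [RHS]eq_bigr do
    rewrite derivZ/= derivB derivD derivC addr0 !deriv_Pint scalerBr.
  rewrite [RHS]sumrB [X in _ = X - _]big_ord_recr/= (pieces_out (i := n.+1%:Z)) ?scaler0 ?addr0; last by lia.
  rewrite [X in _ = _ - X]big_ord_recl/= (pieces_out (i := 0 - 1)) ?scaler0 ?add0r; last by lia.
  rewrite -sumrB; apply: eq_bigr => i _; rewrite scalerBl /bump/=; congr (_ - c _ *: pieces n _); lia.
have cc i : (i <= n)%N -> c i%:Z = c i.+1%:Z.
  move=> /(IH (fun i => c i - c (i + 1)) D)/eqP; rewrite subr_eq0 => /eqP ->.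
  by congr c; lia.
have c0 i : (i <= n.+1)%N -> c i%:Z = c 0.
  by elim: i => // i IHi le; rewrite -cc// IHi// ltnW.
move=> i le; rewrite c0//; move: H.
rewrite (_ : \sum_(i < n.+2) _ = c 0 *: \sum_(i < n.+2) pieces n.+1 i); last first.
  by rewrite scaler_sumr; apply: eq_bigr => j _; rewrite c0// -ltnS.
by rewrite sum_pieces => /eqP; rewrite scaler_eq0 oner_eq0 orbF => /eqP.
Qed.

Lemma floor_split (x : R) : exists (i : int) (y : R), x = i%:~R + y /\ 0 <= y < 1.
Proof.
exists (Num.floor x), (x - (Num.floor x)%:~R); split; first by ring.
by rewrite subr_ge0 floor_le ltrBlDr addrC -intrD1 floorD1_gt.
Qed.

Lemma local_of_pieces n :
  (forall (i : int) (y : R), 0 <= y < 1 -> N n (i%:~R + y) = (pieces n i).[y]) -> local (N n).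
Proof.
move=> H.
have -> : N n = fun x => \sum_(i < n.+1) box (pieces n i) (x + (- i%:R)).
  apply/funext => x; have [i [y [xE y01]]] := floor_split x.
  have bE (j : nat) : box (pieces n j) (x - j%:R) = if j%:Z == i then (pieces n i).[y] else 0.
    rewrite /box indicE; case: eqP => [ji|ji].
      have xj : x - j%:R = y by rewrite xE -ji; ring.
      by rewrite xj mem_set ?mul1r -?ji//= in_itv.
    rewrite memNset ?mul0r//= in_itv/= => /andP[h1 h2]; apply: ji.
    move: y01 => /andP[y0 y1]; rewrite xE in h1 h2.
    have l1 : (j%:Z%:~R : R) < (i + 1)%:~R by rewrite intrD -pmulrn; lra.
    have l2 : (i%:~R : R) < (j%:Z + 1)%:~R by rewrite intrD -pmulrn; lra.
    by rewrite !ltr_int in l1 l2; lia.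
  rewrite {1}xE H//; under eq_bigr do rewrite bE.
  have [ii|ii] := boolP ((0 <= i) && (i <= n%:Z)).
    have [k ik] : exists k : nat, i = k by exists `|i|%N; lia.
    have kn : (k < n.+1)%N by move: ii; rewrite ik; lia.
    by rewrite (bigD1 (Ordinal kn))//= ik eqxx big1 ?addr0// => j /eqP jk;
      case: eqP => // -[jk']; exfalso; apply: jk; exact/val_inj.
  rewrite pieces_out ?horner0; last by lia.
  by rewrite big1// => j _; case: ifP.
apply: local_sum => i; apply: local_translate; exact: local_box.
Qed.

(** At the point [i + y] the averaging interval is cut at [y]: up to there the values
    of [N n] come from its piece on the cell [i], afterwards from that on [i - 1]. *)
Lemma bspline_pieces n (i : int) (y : R) : 0 <= y < 1 ->
  N n (i%:~R + y) = (pieces n i).[y].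
Proof.
elim: n i y => [|n IH] i y y01.
  rewrite /= indicE; have [->|i0] := eqVneq i 0.
    by rewrite mem_set ?hornerE//= add0r in_itv/=.
  rewrite memNset ?hornerE//= in_itv/= => /andP[h1 h2].
  have l1 : (i%:~R : R) < 1%:~R by rewrite /=; lra.
  have l2 : (- 1)%:~R < (i%:~R : R) by rewrite rmorphN/=; lra.
  by rewrite !ltr_int in l1 l2; move: i0; apply/negP/negPn/eqP; lia.
have lN := local_of_pieces IH.
have lf : local (fun t => N n (i%:~R + y - t)).
  have n1 : -1 != 0 :> R by rewrite oppr_eq0 oner_eq0.
  have := local_affine_neq0 (i%:~R + y) n1 lN.
  by under eq_fun do rewrite mulN1r addrC.
rewrite [LHS]/=.
have /andP[y0 y1] := y01.
have UE : `[0, 1]%classic = `[0, y]%classic `|` `]y, 1]%classic :> set R.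
  apply/seteqP; split => t /=; rewrite !in_itv/=.
    by move=> /andP[-> ->]/=; case: (lerP t y) => _; [left | right].
  by move=> [/andP[-> ty]|/andP[yt ->]]/=; [rewrite (le_trans ty) ?ltW|
    rewrite andbT (le_trans y0) ?ltW].
rewrite UE Rintegral_setU//; last 2 first.
- apply: (@integrableS _ _ _ mu setT) => //; last exact: local_integrable.
  by apply: measurableU.
- apply/disj_setPS => t /=; rewrite !in_itv/= => -[/andP[_ h1] /andP[h2 _]].
  by have := lt_le_trans h2 h1; rewrite ltxx.
have -> : \int[mu]_(t in `[0, y]) N n (i%:~R + y - t) =
    \int[mu]_(t in `[0, y]) (pieces n i).[y - t].
  apply: eq_Rintegral => t; rewrite inE/= in_itv/= => /andP[t0 ty].
  by rewrite -addrA IH// subr_ge0 ty/=; lra.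
have -> : \int[mu]_(t in `]y, 1]) N n (i%:~R + y - t) =
    \int[mu]_(t in `]y, 1]) (pieces n (i - 1)).[(y + 1) - t].
  apply: eq_Rintegral => t; rewrite inE/= in_itv/= => /andP[t0 ty].
  rewrite -IH; first by congr (N n _); rewrite rmorphB/=; ring.
  by apply/andP; split; lra.
rewrite Rintegral_poly_flip// Rintegral_itv_obnd_cbnd; last first.
  apply: (@integrableS _ _ _ mu `[y, 1]) => //; first by apply: subset_itvr; rewrite bnd_simp.
  apply: continuous_compact_integrable; first exact: segment_compact.
  apply: continuous_subspaceT.
  rewrite (_ : (fun t => _) = horner (pieces n (i - 1) \Po ((y + 1)%:P - 'X))).
    exact: continuous_horner.
  by apply/funext => t; rewrite horner_comp !hornerE.
rewrite Rintegral_poly_flip ?ltW// subr0 subrr Pint_0 subr0 addrK.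
rewrite (_ : y + 1 - y = 1); last by ring.
by rewrite piecesS hornerD hornerN hornerD hornerC addrA.
Qed.

Lemma local_bspline n : local (N n).
Proof. by apply: local_of_pieces; exact: bspline_pieces. Qed.

Lemma local_flip (c : R) f : local f -> local (fun t => f (c - t)).
Proof.
move=> lf; have n1 : -1 != 0 :> R by rewrite oppr_eq0 oner_eq0.
by have := local_affine_neq0 c n1 lf; under eq_fun do rewrite mulN1r addrC.
Qed.

Definition bspline_block (n w : nat) (x : R) : R := \sum_(k < w) N n (x - k%:R).

Lemma local_bspline_block n w : local (bspline_block n w).
Proof. by apply: local_sum => k; apply: local_translate; exact: local_bspline. Qed.

Lemma Rintegral_local_sum (D : set R) (w : nat) (F : 'I_w -> R -> R) : measurable D ->
  (forall i, local (F i)) ->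
  \int[mu]_(t in D) (\sum_(i < w) F i t) = \sum_(i < w) \int[mu]_(t in D) F i t.
Proof.
move=> mD LF; have IF f : local f -> mu.-integrable D (EFin \o f).
  by move=> /local_integrable; apply: integrableS.
elim: w F LF => [|w IH] F LF.
  rewrite big_ord0; under eq_Rintegral do rewrite big_ord0.
  by rewrite /Rintegral integral0.
rewrite big_ord_recl -IH//; under eq_Rintegral do rewrite big_ord_recl.
by rewrite RintegralD//; apply: IF => //; exact: local_sum.
Qed.

Lemma bspline_blockS n w x :
  bspline_block n.+1 w x = \int[mu]_(t in `[0, 1]) bspline_block n w (x - t).
Proof.
rewrite /bspline_block/= -Rintegral_local_sum//.
  by apply: eq_Rintegral => t _; apply: eq_bigr => k _; congr (N n _); ring.
by move=> k; apply: local_flip; exact: local_bspline.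
Qed.

Lemma Rintegral01_cst (c : R) : \int[mu]_(t in `[0, 1]) c = c.
Proof.
rewrite Rintegral_cst//; have := @lebesgue_measure_itv R `[0, 1].
by rewrite /= lte_fin ltr01 oppr0 adde0 => ->; rewrite mulr1.
Qed.

(** A finite part of the partition of unity.  Averaging keeps the bounds and widens the
    transition at either end by one unit. *)
Lemma bspline_block_bound n w x : [/\ 0 <= bspline_block n w x <= 1,
  (x < 0) || (w%:R + n%:R <= x) -> bspline_block n w x = 0 &
  n%:R <= x < w%:R -> bspline_block n w x = 1].
Proof.
elim: n x => [|n IH] x.
  have E : bspline_block 0 w x = (0 <= x < w%:R)%R%:R.
    rewrite /bspline_block/=; elim: w => [|w IHw].
      by rewrite big_ord0; case: (lerP 0 x) => //= x0; rewrite ltNge x0.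
    rewrite big_ord_recr/= IHw indicE mem_setE in_itv/= subr_ge0 ltrBlDr (addrC 1) -natr1.
    have w0 : 0 <= w%:R :> R by [].
    have [x0|x0] := lerP 0 x; have [xw|xw] := ltrP x w%:R => /=.
    - by rewrite addr0 (lt_trans xw) ?ltrDl.
    - by rewrite add0r.
    - by rewrite addr0.
    - by have := lt_le_trans x0 (le_trans w0 xw); rewrite ltxx.
  rewrite E addr0; split; first by rewrite ler0n lern1 leq_b1.
    by move=> /orP[x0|wx]; [rewrite (leNgt 0 x) x0 | rewrite (ltNge x) wx andbF].
  by move=> ->.
rewrite bspline_blockS.
have iB : mu.-integrable `[0, 1] (EFin \o (fun t => bspline_block n w (x - t))).
  apply: (@integrableS _ _ _ mu setT) => //.
  by apply/local_integrable/local_flip; exact: local_bspline_block.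
have i1 : mu.-integrable `[0, 1] (EFin \o (fun t : R => 1 : R)).
  apply: continuous_compact_integrable; first exact: segment_compact.
  by apply: continuous_subspaceT => t; exact: cvg_cst.
split.
- apply/andP; split; first by apply: Rintegral_ge0 => t _; have [/andP[]] := IH (x - t).
  rewrite -[leRHS](Rintegral01_cst 1); apply: le_Rintegral => // t _.
  by have [/andP[]] := IH (x - t).
- move=> H; rewrite -[RHS](Rintegral01_cst 0); apply: eq_Rintegral => t.
  rewrite inE/= in_itv/= => /andP[t0 t1]; have [_ h _] := IH (x - t); apply: h.
  by case/orP: H => H; apply/orP; [left | right; move: H; rewrite -natr1]; lra.
- move=> /andP[H1 H2]; rewrite -[RHS](Rintegral01_cst 1); apply: eq_Rintegral => t.
  rewrite inE/= in_itv/= => /andP[t0 t1]; have [_ _ h] := IH (x - t); apply: h.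
  by move: H1; rewrite -natr1 => H1; apply/andP; split; lra.
Qed.

End BSplines.

(** * Refinement and reconstruction *)

Section Refinement.
Context {R : realType}.

Local Notation mu := (@lebesgue_measure R).
Local Notation N := (@bspline_rec R).

Lemma Rintegral01_indic (g : R -> R) : local g ->
  \int[mu]_(t in `[0, 1]) g t = \int[mu]_t (N 0 t * g t).
Proof.
move=> lg; rewrite -Rintegral_itv_bndo_bndc; last first.
  by apply: (@integrableS _ _ _ mu setT) => //; exact: local_integrable.
rewrite Rintegral_mkcond; apply: eq_Rintegral => t _.
by rewrite patchE /= indicE; case: ifP => _; rewrite ?mul1r ?mul0r.
Qed.

Lemma unit_indic_refine (t : R) : N 0 t = N 0 (2 * t) + N 0 (2 * t - 1).
Proof.
rewrite /= !indicE !mem_setE !in_itv/= subr_ge0.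
have [t0|t0] := lerP 0 t; have [t1|t1] := ltrP t 1; have [u0|u0] := lerP 0 (2 * t);
  have [u1|u1] := ltrP (2 * t) 1; have [u2|u2] := ltrP (2 * t - 1) 1;
  rewrite /= ?addr0 ?add0r//; exfalso; lra.
Qed.

(** Averaging over the unit interval is averaging over its two halves. *)
Lemma average_dilated (f : R -> R) (x c : R) : local f ->
  \int[mu]_(t in `[0, 1]) f (2 * (x - t) - c) =
  2^-1 * (\int[mu]_(t in `[0, 1]) f (2 * x - c - t) +
          \int[mu]_(t in `[0, 1]) f (2 * x - (c + 1) - t)).
Proof.
move=> lf; have two0 : 0 < 2 :> R by [].
have m2 : -2 != 0 :> R by rewrite oppr_eq0.
have lf2 : local (fun t => f (2 * (x - t) - c)).
  have := local_affine_neq0 (2 * x - c) m2 lf.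
  by congr local; apply/funext => t; congr f; ring.
have lf1 d : local (fun t => f (d - t)) by exact: local_flip.
have lN := @local_bspline R 0.
rewrite !Rintegral01_indic//.
pose h d t := N 0 t * f (d - t).
have lh d : local (h d) by apply: localM.
have ih d b : mu.-integrable setT (EFin \o (fun t => h d (2 * t + b))).
  by apply: local_integrable; exact: local_affine.
have E d b : \int[mu]_t h d (2 * t + b) = 2^-1 * \int[mu]_t h d t.
  by rewrite Rintegral_affine//; exact: local_integrable.
rewrite mulrDr -(E (2 * x - c) 0) -(E (2 * x - (c + 1)) (-1)) -RintegralD//.
apply: eq_Rintegral => t _; rewrite unit_indic_refine mulrDl /h addr0.
by congr (_ * f _ + _ * f _); ring.
Qed.

(** Every averaging adds a factor [(1 + z) / 2] to the mask, by [average_dilated]; in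
    coefficients this is the recursion of Pascal. *)
Lemma bspline_refine n (x : R) :
  N n x = 2^-1 ^+ n * \sum_(k < n.+2) 'C(n.+1, k)%:R * N n (2 * x - k%:R).
Proof.
elim: n x => [|n IH] x.
  rewrite expr0 mul1r big_ord_recl big_ord1 /= subr0 bin0 bin1 !mul1r.
  exact: unit_indic_refine.
have lN := @local_bspline R n.
have l2 c : local (fun t => N n (2 * (x - t) - c)).
  have m2 : -2 != 0 :> R by rewrite oppr_eq0.
  have := local_affine_neq0 (2 * x - c) m2 lN.
  by congr local; apply/funext => t; congr (N n); ring.
have NS y : N n.+1 y = \int[mu]_(t in `[0, 1]) N n (y - t) by [].
have -> : N n.+1 x = 2^-1 ^+ n * \sum_(k < n.+2) 'C(n.+1, k)%:R *
    (2^-1 * (N n.+1 (2 * x - k%:R) + N n.+1 (2 * x - (k%:R + 1)))).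
  rewrite [LHS]NS; under eq_Rintegral do rewrite IH.
  have lS : local (fun t => \sum_(k < n.+2) 'C(n.+1, k)%:R * N n (2 * (x - t) - k%:R)).
    by apply: local_sum => k; exact: localZ.
  rewrite RintegralZl//; last first.
    by apply: (@integrableS _ _ _ mu setT) => //; exact: local_integrable.
  congr (_ * _); rewrite Rintegral_local_sum//; last by move=> k; exact: localZ.
  apply: eq_bigr => k _; rewrite RintegralZl//; last first.
    by apply: (@integrableS _ _ _ mu setT) => //; exact: local_integrable.
  by congr (_ * _); rewrite average_dilated// !NS.
rewrite exprSr -mulrA; congr (_ * _); move: (N n.+1) => {NS} g.
rewrite mulr_sumr; transitivity (\sum_(k < n.+2) 2^-1 * ('C(n.+1, k)%:R * g (2 * x - k%:R)) +
   \sum_(k < n.+2) 2^-1 * ('C(n.+1, k)%:R * g (2 * x - k.+1%:R))).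
  by rewrite -big_split/=; apply: eq_bigr => k _; rewrite -[k.+1%:R]natr1; ring.
rewrite [RHS]big_ord_recl [X in X + _]big_ord_recl !bin0 -addrA; congr (_ + _).
rewrite [X in X + _](_ : _ = \sum_(i < n.+2) 2^-1 * ('C(n.+1, i.+1)%:R * g (2 * x - i.+1%:R))).
  by rewrite -big_split/=; apply: eq_bigr => k _; rewrite /bump/= add1n [in RHS]binS natrD; ring.
by rewrite [RHS]big_ord_recr/= (bin_small (ltnSn _)) mul0r mulr0 addr0.
Qed.

Lemma coef_compN (p : {poly R}) j : (p \Po (- 'X))`_j = (-1) ^+ j * p`_j.
Proof.
rewrite coef_comp_poly.
have E i : ((- 'X : {poly R}) ^+ i)`_j = (-1) ^+ i * (j == i)%:R.
  by rewrite -scaleN1r exprZn coefZ coefXn.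
under eq_bigr do rewrite E.
have [jp|jp] := ltnP j (size p); last first.
  rewrite nth_default// mulr0 big1// => i _.
  by rewrite gtn_eqF ?mulr0// (leq_trans (ltn_ord i)).
rewrite (bigD1 (Ordinal jp))//= eqxx big1 ?addr0 ?mulr1 1?mulrC// => i ij.
rewrite (_ : (j == i) = false) ?mulr0//.
by apply/negbTE; apply: contra ij => /eqP ji; exact/eqP/val_inj.
Qed.

Definition phi (m : nat) (x : R) : R := N m.-1 (x + (m./2)%:R).

Lemma quark0 m : quark m 0 = phi m :> (R -> R).
Proof. by apply/funext => x; rewrite /quark expr0 mul1r. Qed.

Lemma local_phi m : local (phi m).
Proof. by apply: local_translate; exact: local_bspline. Qed.

Variables (m M : nat).
Hypotheses (m0 : (0 < m)%N) (mM : (m./2 <= 2 * M)%N).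

(** The symbol of the refinement mask, multiplied by an even power of ['X] that
    turns it into a polynomial. *)
Definition mask_poly : {poly R} := 'X^(2 * M - m./2) * (2^-1 *: (1 + 'X)) ^+ m.

Lemma coef_mask_poly i : mask_poly`_i =
  if (i < 2 * M - m./2)%N then 0 else 2^-1 ^+ m * 'C(m, i - (2 * M - m./2))%:R.
Proof.
rewrite /mask_poly coefXnM; case: ifP => // _.
rewrite exprZn coefZ exprDn coef_sum; congr (_ * _).
set j := (i - _)%N; under eq_bigr do rewrite expr1n mul1r coefMn coefXn.
have [jm|jm] := ltnP j m.+1.
  rewrite (bigD1 (Ordinal jm))//= eqxx big1 ?addr0//.
  move=> k kj; rewrite (_ : (j == k) = false) ?mul0rn//.
  by apply/negbTE; apply: contra kj => /eqP kj; exact/eqP/val_inj.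
rewrite bin_small// big1// => k _; rewrite (_ : (j == k) = false) ?mul0rn//.
by apply/negbTE; rewrite neq_ltn (leq_trans (ltn_ord k) jm) orbT.
Qed.

(** The exponent [2 * M] of the shift in [mask_poly] is subtracted again from the
    index; it is even, so that all parities are those of the unshifted mask. *)
Lemma phi_refine (x : R) (l : int) :
  phi m (x - l%:~R) = \sum_(i < size mask_poly)
     2 * mask_poly`_i * phi m (2 * x - (2 * l + i%:Z - (2 * M)%:Z)%:~R).
Proof.
have E (F : nat -> R) n : (size mask_poly <= n)%N ->
    \sum_(i < size mask_poly) 2 * mask_poly`_i * F i = \sum_(i < n) 2 * mask_poly`_i * F i.
  move=> sn; rewrite (big_ord_widen n (fun i => 2 * mask_poly`_i * F i) sn).
  rewrite [RHS](bigID (fun i : 'I_n => (i < size mask_poly)%N))/=.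
  rewrite [X in _ = _ + X]big1 ?addr0// => i; rewrite -leqNgt => si.
  by rewrite nth_default ?mulr0 ?mul0r.
set d := (2 * M - m./2)%N.
have sz : (size mask_poly <= d + m.+1)%N.
  apply/leq_sizeP => i; rewrite coef_mask_poly -/d => di; case: ifP => // _.
  by rewrite bin_small ?mulr0//; lia.
rewrite (E (fun i => phi m (2 * x - (2 * l + i%:Z - (2 * M)%:Z)%:~R)) _ sz) big_split_ord/=.
rewrite big1 ?add0r => [|i _]; last by rewrite coef_mask_poly -/d ltn_ord mulr0 mul0r.
rewrite {1}/phi bspline_refine mulr_sumr.
rewrite prednK//; apply: eq_bigr => k _.
rewrite coef_mask_poly -/d ltnNge leq_addr/= addKn /phi mulrA; congr (_ * N _ _).
  have -> : 2^-1 ^+ m = 2^-1 * 2^-1 ^+ m.-1 :> R by rewrite -exprS prednK.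
  by field.
have -> : 2 * l + (d + k)%N%:Z - (2 * M)%N%:Z = 2 * l + k%:Z - (m./2)%:Z by rewrite /d; lia.
by rewrite rmorphB rmorphD rmorphM/=; ring.
Qed.

Variables (B : {poly R}) (psi : R -> R).
Hypothesis psi_refine : forall (x : R) (l : int), psi (x - l%:~R) =
  \sum_(i < size B) 2 * B`_i * phi m (2 * x - (2 * l + i%:Z - (2 * M)%:Z)%:~R).
Hypothesis det : mask_poly * (B \Po (- 'X)) - (mask_poly \Po (- 'X)) * B = 'X^((4 * M).+1).

Let A := mask_poly.

(** Half of the coefficients of [P(-X)]: those for which the matching translation on
    the coarse scale is an integer, namely [coarse_index]. *)
Definition parity_filter (P : {poly R}) (k : int) (j : nat) : R :=
  if (2 %| k - (2 * M).+1%:Z + j%:Z)%Z then (-1) ^+ j * P`_j else 0.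

Definition coarse_index (k : int) (j : nat) : int := ((k - (2 * M).+1%:Z + j%:Z) %/ 2)%Z.

(** With [Q P] the part of [P(-X)] whose exponents have the parity opposite to
    that of [k], the terms [A * B] in [2 * (Q B * A - Q A * B)] cancel and the
    determinant identity remains. *)
Lemma reconstruction (x : R) (k : int) : phi m (2 * x - k%:~R) =
  \sum_(j < size B) parity_filter B k j * phi m (x - (coarse_index k j)%:~R) -
  \sum_(j < size A) parity_filter A k j * psi (x - (coarse_index k j)%:~R).
Proof.
pose F n := phi m (2 * x - (k - (4 * M).+1%:Z + n%:Z)%:~R).
pose Nn := (size A + size B + (4 * M).+2)%N.
have NAB : (size A + size B <= Nn)%N by rewrite leq_addr.
have lt : ((4 * M).+1 < Nn)%N by rewrite leq_addl.
clearbody Nn.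
pose T (P : {poly R}) := \sum_(n < Nn) P`_n * F n.
have TD P Q : T (P - Q) = T P - T Q.
  by rewrite -sumrB; apply: eq_bigr => n _; rewrite coefB mulrBl.
pose Q (P : {poly R}) := \poly_(j < size P) parity_filter P k j.
have TQ (P P' : {poly R}) : (size P + size P' <= size A + size B)%N ->
    T (Q P * P') = \sum_(j < size P) parity_filter P k j * (\sum_(i < size P') P'`_i * F (i + j)%N).
  move=> /leq_trans/(_ NAB) sPP.
  transitivity (\sum_(n < Nn) (\sum_(j < size P) parity_filter P k j * ('X^j * P')`_n) * F n).
    apply: eq_bigr => n _; congr (_ * _).
    rewrite /Q poly_def mulr_suml coef_sum; apply: eq_bigr => j _.
    by rewrite -scalerAl coefZ.
  under eq_bigr do rewrite mulr_suml.
  rewrite exchange_big/=; apply: eq_bigr => j _; rewrite mulr_sumr.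
  rewrite -(big_mkord xpredT (fun n => parity_filter P k j * ('X^j * P')`_n * F n)).
  rewrite (@big_cat_nat _ _ _ j)//=; last first.
    by rewrite (leq_trans (ltnW (ltn_ord j)))// (leq_trans _ sPP) ?leq_addr.
  rewrite big_nat_cond big1 ?add0r => [|n /andP[/andP[_ nj] _]]; last first.
    by rewrite coefXnM nj mulr0 mul0r.
  have jp := ltn_ord j.
  rewrite -{1}[nat_of_ord j]add0n big_addn (@big_cat_nat _ _ _ (size P'))//=; last first.
    by rewrite leq_subRL ?(leq_trans _ sPP) ?leq_add2r ?(ltnW jp)// (leq_trans (ltnW jp))// leq_addr.
  rewrite [X in _ + X]big_nat_cond [X in _ + X]big1 ?addr0 => [|n /andP[/andP[nj _] _]]; last first.
    rewrite coefXnM ltnNge leq_addl/= addnK nth_default ?mulr0 ?mul0r//.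
  rewrite big_mkord; apply: eq_bigr => i _.
  by rewrite coefXnM ltnNge leq_addl/= addnK mulrA.
have sgnE (j : nat) : (2 %| k - (2 * M).+1%:Z + j%:Z)%Z = (odd `|k| != odd j).
  by lia.
have QE P : Q P = 2^-1 *: ((P \Po (- 'X)) - (-1) ^+ odd `|k| *: P).
  apply/polyP => j; rewrite coefZ coefB coefZ coef_compN coef_poly /parity_filter sgnE.
  case: ltnP => [_|/leq_sizeP/(_ _ (leqnn _)) ->]; last by rewrite !mulr0 subr0 mulr0.
  by rewrite -[in (-1) ^+ j]signr_odd; case: (odd j); case: (odd `|k|);
    rewrite /= ?expr0 ?expr1; field.
have key : Q B * A *+ 2 - Q A * B *+ 2 = 'X^((4 * M).+1).
  have half (P : {poly R}) : (2^-1 *: P) *+ 2 = P.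
    by rewrite -[_ *+ 2]scaler_nat scalerA divff// scale1r.
  rewrite -det !QE -/A -2!scalerAl 2!half 2!mulrBl -2!scalerAl (mulrC B A).
  by rewrite (mulrC (B \Po _)) opprB addrA addrNK.
have -> : phi m (2 * x - k%:~R) = T 'X^((4 * M).+1).
  rewrite /T (bigD1 (Ordinal lt))//= coefXn eqxx mul1r big1 ?addr0 => [|i ij].
    by rewrite /F subrK.
  rewrite coefXn (_ : (_ == _) = false) ?mul0r//.
  by apply/negbTE; apply: contra ij => /eqP ji; exact/eqP/val_inj.
have T2 P : T (P *+ 2) = 2 * T P.
  by rewrite /T mulr_sumr; apply: eq_bigr => n _; rewrite coefMn mulrA mulr_natl.
have coarse j : (2 %| k - (2 * M).+1%:Z + j%:Z)%Z ->
    k - (2 * M).+1%:Z + j%:Z = 2 * coarse_index k j.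
  by move=> d; rewrite /coarse_index mulrC divzK.
have M4 : (4 * M).+1%:Z = (2 * M).+1%:Z + (2 * M)%N%:Z by lia.
rewrite -key TD !T2 !TQ; [|by []|by rewrite addnC].
rewrite !mulr_sumr; congr (_ - _); apply: eq_bigr => j _.
  rewrite /parity_filter; case: ifP => [/coarse jk|_]; last by rewrite !mul0r mulr0.
  rewrite mulrCA; congr (_ * _); rewrite phi_refine// mulr_sumr; apply: eq_bigr => i _.
  rewrite mulrA /F; congr (_ * phi m (2 * x - _%:~R)).
  by rewrite -jk M4 PoszD; ring.
rewrite /parity_filter; case: ifP => [/coarse jk|_]; last by rewrite !mul0r mulr0.
rewrite mulrCA; congr (_ * _); rewrite psi_refine// mulr_sumr; apply: eq_bigr => i _.
rewrite mulrA /F; congr (_ * phi m (2 * x - _%:~R)).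
by rewrite -jk M4 PoszD; ring.
Qed.
End Refinement.

(** * The determinant of the two masks *)

Section Bezout.
Variable F : comPzRingType.

(** The sum in the symbol of the dual generator, as a polynomial in
    [y = (2 - z - z^-1) / 4]. *)
Definition daubechies_poly (K : nat) (y : F) : F := \sum_(n < K) 'C(K.-1 + n, n)%:R * y ^+ n.

(** Pascal's rule, summed. *)
Lemma partial_sum_binomial k j (y : F) :
  (1 - y) * (\sum_(n < j.+1) 'C(k.+1 + n, n)%:R * y ^+ n) =
  \sum_(n < j.+1) 'C(k + n, n)%:R * y ^+ n - 'C(k.+1 + j, j)%:R * y ^+ j.+1.
Proof.
elim: j => [|j IH]; first by rewrite !big_ord1 !addn0 !bin0 expr0 expr1; ring.
rewrite big_ord_recr [in RHS]big_ord_recr/= mulrDr IH.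
have -> : 'C(k.+1 + j.+1, j.+1)%:R = 'C(k + j.+1, j.+1)%:R + 'C(k.+1 + j, j)%:R :> F.
  by rewrite -natrD addSn binS addnS addSn.
rewrite [y ^+ j.+2]exprS; ring.
Qed.

Lemma daubechies_polyS k (y : F) :
  (1 - y) * daubechies_poly k.+2 y =
  daubechies_poly k.+1 y + 'C(k + k.+1, k.+1)%:R * y ^+ k.+1 * (1 - y - y).
Proof.
rewrite /daubechies_poly /= partial_sum_binomial big_ord_recr/=.
have -> : 'C(k.+1 + k.+1, k.+1)%:R = 'C(k + k.+1, k.+1)%:R *+ 2 :> F.
  rewrite -mulrnA; congr (_%:R); rewrite addSn binS muln2 -addnn; congr (_ + _)%N.
  by rewrite -[LHS]bin_sub ?addKn// leq_addr.
rewrite [y ^+ k.+2]exprS; ring.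
Qed.

(** The combination does not depend on [K]: by the recursion, passing from [K] to
    [K.+1] adds [1 - 2 y] and [1 - 2 x] with the same factor, and
    [(1 - 2 y) + (1 - 2 x) = 0]. *)
Lemma daubechies_bezout K (x y : F) : (0 < K)%N -> x + y = 1 ->
  x ^+ K * daubechies_poly K y + y ^+ K * daubechies_poly K x = 1.
Proof.
case: K => // k _ xy; have yE : y = 1 - x by rewrite -xy addrAC subrr add0r.
have xE : x = 1 - y by rewrite -xy addrK.
elim: k => [|k IH]; first by rewrite /daubechies_poly !big_ord1 !bin0 !expr0 !expr1 !mulr1.
rewrite (_ : x ^+ k.+2 * daubechies_poly k.+2 y =
  x ^+ k.+1 * ((1 - y) * daubechies_poly k.+2 y)); last by rewrite exprSr -mulrA -xE.
rewrite (_ : y ^+ k.+2 * daubechies_poly k.+2 x =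
  y ^+ k.+1 * ((1 - x) * daubechies_poly k.+2 x)); last by rewrite exprSr -mulrA -yE.
have s : 1 - y - y = - (1 - x - x) by rewrite yE; ring.
by rewrite !daubechies_polyS s -[RHS]IH; ring.
Qed.
End Bezout.

Section Determinant.
Context {R : realType}.
Local Open Scope complex_scope.
Local Notation C := (R[i]).
Local Notation emb := (real_complex R).

Lemma unit_circle_conj (z : C) : `|z| = 1 -> z^* = z^-1.
Proof.
case: z => x y; rewrite normc_def /= => /(congr1 (@complex.Re R))/= h.
have {}h : x ^+ 2 + y ^+ 2 = 1.
  by rewrite -[LHS]sqr_sqrtr ?addr_ge0 ?sqr_ge0// h expr1n.
have zz : (x +i* y) * (x +i* y)^* = 1.
  apply/eqP; rewrite eq_complex /= mulrN opprK -!expr2 h eqxx /=.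
  by rewrite mulrN addrC mulrC subrr.
have z0 : x +i* y != 0.
  by apply/eqP => z0; move/eqP: zz; rewrite z0 mul0r eq_sym oner_eq0.
by apply: (mulfI z0); rewrite zz divff.
Qed.

Lemma dual_symbol_conj m mt (z : C) : `|z| = 1 -> (dual_symbol m mt z)^*%R =
  z ^+ mt./2 * ((1 + z^-1) / 2) ^+ mt *
  daubechies_poly ((m + mt)./2) ((2 - z - z^-1) / 4).
Proof.
move=> z1; have zc := unit_circle_conj z1; rewrite -[LHS]/((dual_symbol m mt z)^*%C).
rewrite /dual_symbol !rmorphM/= conjc_inv !rmorphXn/= zc -exprVn invrK.
rewrite fmorph_div rmorphD rmorph_nat rmorph1 /= zc.
congr (_ * _ * _).
rewrite rmorph_sum/=; apply: eq_bigr => i _.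
rewrite rmorphM rmorphXn fmorph_div !rmorphB !rmorph_nat /= conjc_inv zc invrK.
by congr (_ * (_ / _) ^+ _); ring.
Qed.

(** Up to the shift by [2 * M], the symbols of the generator and of its dual multiply
    to a function of the cosine alone, [x^K P(1 - x)] with [x = (2 + z + z^-1) / 4]. *)
Lemma product_symbol m mt M (z : C) : z != 0 -> ~~ odd (m + mt) -> (m./2 <= 2 * M)%N ->
  z ^+ (2 * M - m./2) * ((1 + z) / 2) ^+ m *
    (z ^+ mt./2 * ((1 + z^-1) / 2) ^+ mt * daubechies_poly ((m + mt)./2) ((2 - z - z^-1) / 4))
  = z ^+ (2 * M) * (((2 + z + z^-1) / 4) ^+ ((m + mt)./2) *
     daubechies_poly ((m + mt)./2) ((2 - z - z^-1) / 4)).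
Proof.
move=> z0 ev hM; move: (daubechies_poly _ _) => P.
set K := ((m + mt)./2)%N; pose w := (1 + z^-1) / 2.
have -> : (1 + z) / 2 = z * w by rewrite /w; field.
have -> : (2 + z + z^-1) / 4 = z * w ^+ 2 by rewrite /w; field.
rewrite -/w; clearbody w; rewrite (exprMn m z w) (exprMn K z (w ^+ 2)) -exprM !mulrA; congr (_ * _).
have e1 : (2 * K = m + mt)%N by rewrite /K; lia.
have e2 : (2 * M - m./2 + m + mt./2 = 2 * M + K)%N by rewrite /K; lia.
rewrite e1 exprD.
have -> : z ^+ (2 * M) * z ^+ K = z ^+ (2 * M - m./2) * z ^+ m * z ^+ mt./2 by rewrite -!exprD e2.
by ring.
Qed.

(** Infinitely many points of the unit circle, in rational parametrization. *)
Definition circle_point (n : nat) : C :=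
  ((1 - n%:R ^+ 2) / (1 + n%:R ^+ 2)) +i* (2 * n%:R / (1 + n%:R ^+ 2)).

Lemma circle_pointP n : `|circle_point n| = 1.
Proof.
have n0 : 1 + n%:R ^+ 2 != 0 :> R by rewrite gt_eqF// ltr_pwDl// sqr_ge0.
rewrite normc_def /= (_ : _ + _ = 1) ?sqrtr1//; field.
exact: n0.
Qed.

Lemma circle_point_inj : injective circle_point.
Proof.
move=> i j [h _].
have n0 n : 1 + n%:R ^+ 2 != 0 :> R by rewrite gt_eqF// ltr_pwDl// sqr_ge0.
have : (i%:R : R) ^+ 2 = j%:R ^+ 2.
  have E n : (1 - n%:R ^+ 2) / (1 + n%:R ^+ 2) = 2 / (1 + n%:R ^+ 2) - 1 :> R by field; exact: n0.
  have : 2 / (1 + i%:R ^+ 2) = 2 / (1 + j%:R ^+ 2) :> R by move: h; rewrite !E; lra.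
  have t2 : (2 : R) != 0 by rewrite pnatr_eq0.
  by move=> /(mulfI t2)/invr_inj; lra.
by move=> /eqP; rewrite eqrXn2// eqr_nat => /eqP.
Qed.

(** The sum in the definition of the quarklets, over an explicit interval. *)
Lemma finsupp_sum (V : zmodType) (f : int -> V) (n : nat) :
  (forall k, f k != 0 -> (`|k| <= n)%N) ->
  \sum_(k \in [set: int]) f k = \sum_(i < (2 * n).+1) f (i%:Z - n%:Z).
Proof.
move=> H; rewrite (@fsbigE _ _ _ _ _ [seq i%:Z - n%:Z | i <- iota 0 (2 * n).+1])//.
- rewrite big_map -[in RHS](big_mkord xpredT (fun i => f (i%:Z - n%:Z))).
  by rewrite /index_iota subn0; apply: eq_bigl => i; rewrite in_setT.
- by rewrite map_inj_uniq ?iota_uniq// => i j; lia.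
- move=> k _ kn; apply/eqP; apply: contraNT kn => /H kn.
  apply/mapP; exists (`|(k + n%:Z)%R|)%N; last by lia.
  by rewrite mem_iota; lia.
Qed.

(** The wavelet mask as a polynomial: with [a] and [b] the two symbols, the
    definition of [b] makes [a(z) b(-z) - a(-z) b(z)] equal to [z] times the
    Bezout combination; it holds on the unit circle, hence identically. *)
Lemma cdf_determinant m mt (b : int -> R) : (0 < m)%N -> ~~ odd (m + mt) ->
  cdf_coefficients m mt b ->
  exists (M : nat) (B : {poly R}), [/\ (m./2 <= 2 * M)%N,
    forall k, b k != 0 -> (`|k| <= 2 * M)%N,
    (size B <= (4 * M).+1)%N,
    forall i : nat, b (i%:Z - (2 * M)%:Z) = 2 * B`_i &
    mask_poly m M * (B \Po (- 'X)) - (mask_poly m M \Po (- 'X)) * B = 'X^((4 * M).+1)].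
Proof.
move=> m0 ev [bfin bE].
pose M := (m + \sum_(k <- fset_set [set k | b k != 0%R]) `|k|)%N.
have bM k : b k != 0 -> (`|k| <= 2 * M)%N.
  move=> bk; have kS : k \in fset_set [set k | b k != 0] by rewrite in_fset_set// inE.
  by rewrite /M (big_fsetD1 k)//=; lia.
have mM : (m./2 <= 2 * M)%N by rewrite /M; lia.
clearbody M.
pose B : {poly R} := \poly_(i < (4 * M).+1) (b (i%:Z - (2 * M)%:Z) / 2).
have Bb (i : nat) : b (i%:Z - (2 * M)%:Z) = 2 * B`_i.
  rewrite coef_poly; case: ltnP => [_|li]; first by field.
  rewrite mulr0; apply/eqP; apply: contraTT li => /bM; lia.
exists M, B; split => //; first exact: size_poly.
apply: (@map_poly_inj _ _ emb).
apply/eqP; rewrite -subr_eq0; apply/eqP.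
pose A : {poly R} := mask_poly m M; rewrite -/A.
set D := _ - _.
have Bz z : `|z| = 1 -> (map_poly emb B).[z] = z ^+ (2 * M) * (- z * (dual_symbol m mt (- z))^*).
  move=> z1; have z0 : z != 0 by rewrite -normr_eq0 z1 oner_eq0.
  rewrite -bE// (@finsupp_sum _ _ (2 * M)); last first.
    move=> k; apply: contraNT => kM; rewrite (_ : b k = 0) ?mul0r//.
    by apply/eqP; apply: contraNT kM; exact: bM.
  rewrite (_ : (2 * (2 * M)).+1 = (4 * M).+1); last by lia.
  rewrite (@horner_coef_wide _ (4 * M).+1); last by rewrite size_map_poly size_poly.
  rewrite mulr_sumr mulr_sumr; apply: eq_bigr => i _.
  rewrite coef_map Bb rmorphM expfzDr// -invr_expz -!exprnP /=.
  rewrite (_ : (2 : R)%:C = 2); last by rewrite rmorph_nat.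
  by field; rewrite expf_neq0.
have Az z : (map_poly emb A).[z] = z ^+ (2 * M - m./2) * ((1 + z) / 2) ^+ m.
  rewrite /A /mask_poly rmorphM rmorphXn /= map_polyX hornerM hornerXn; congr (_ * _).
  rewrite rmorphXn horner_exp; congr (_ ^+ _).
  rewrite /= map_polyZ hornerZ rmorphD rmorph1 /= map_polyX hornerD hornerX hornerC mulrC.
  by rewrite fmorphV rmorph_nat.
clearbody A.
have Nz (P : {poly R}) z : (map_poly emb (P \Po (- 'X))).[z] = (map_poly emb P).[- z].
  by rewrite map_comp_poly rmorphN /= map_polyX horner_comp hornerN hornerX.
apply: (@roots_geq_poly_eq0 _ _ [seq circle_point i | i <- iota 0 (size D)]).
- apply/allP => z /mapP[i _ ->]; move: (circle_point i) (circle_pointP i) => {}z z1.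
  have z0 : z != 0 by rewrite -normr_eq0 z1 oner_eq0.
  have Nz1 : `|- z| = 1 by rewrite normrN.
  apply/eqP; rewrite /D hornerD hornerN rmorphB !rmorphM /= hornerD hornerN !hornerM.
  rewrite !Nz !Az !Bz// !opprK map_polyXn hornerXn !dual_symbol_conj//.
  have P1 := product_symbol z0 ev mM.
  have Nz0 : - z != 0 by rewrite oppr_eq0.
  have P2 := product_symbol Nz0 ev mM.
  set u := z ^+ (2 * M - m./2) * _ in P1 *.
  set v := (- z) ^+ (2 * M - m./2) * _ in P2 *.
  set a := z ^+ mt./2 * _ * _ in P1 *.
  set c := (- z) ^+ mt./2 * _ * _ in P2 *.
  have e2 : (- z) ^+ (2 * M) = z ^+ (2 * M) by rewrite exprNn exprM sqrrN !expr1n mul1r.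
  rewrite e2 in P2 *.
  have -> : u * (z ^+ (2 * M) * (z * a)) - v * (z ^+ (2 * M) * (- z * c)) -
     z ^+ (4 * M).+1 = z ^+ (2 * M) * z * (u * a + v * c) - z ^+ (4 * M).+1 by ring.
  rewrite P1 P2 -mulrDr.
  have -> : 2 - - z - (- z)^-1 = 2 + z + z^-1 by rewrite invrN !opprK.
  have -> : 2 + - z + (- z)^-1 = 2 - z - z^-1 by rewrite invrN.
  rewrite daubechies_bezout ?mulr1; last 2 first.
  - by lia.
  - by field.
  have -> : ((4 * M).+1 = 2 * M + 1 + 2 * M)%N by lia.
  by rewrite !exprD expr1 subrr.
- by rewrite map_inj_uniq ?iota_uniq//; exact: circle_point_inj.
- by rewrite size_map size_iota.
Qed.
End Determinant.

(** * Density of the spline spaces *)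

Section SplineDensity.
Context {R : realType}.
Local Notation mu := (@lebesgue_measure R).
Local Notation N := (@bspline_rec R).
Local Notation toR := (fun h : @L2T R => h : R -> R).
Local Notation ipH := (fun f g : @L2T R => l2ip f g).
Variable m : nat.
Hypothesis m0 : (0 < m)%N.

Definition spline_generators : set (@L2T R) :=
  [set h | exists (n : nat) (k : int), toR h = dilate (phi m) n%:Z k].

Definition spline_limit (f : R -> R) := exists2 h : @L2T R,
  ipclosure ipH (lspan spline_generators) h & toR h = f.

Lemma spline_limit_lin a f g : spline_limit f -> spline_limit g ->
  spline_limit (fun x => a * f x + g x).
Proof.
move=> [h Uh <-] [h' Uh' <-]; exists (a *: h + h'); last by [].
exact: (proj2 (ipclosure_subspace L2_semi_inner (lspan_subspace spline_generators)) a h h' Uh Uh').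
Qed.

Lemma spline_limit0 : spline_limit (fun=> 0).
Proof.
exists 0 => //.
by apply: (proj1 (ipclosure_subspace L2_semi_inner (lspan_subspace _))).
Qed.

Lemma spline_limitZ a f : spline_limit f -> spline_limit (fun x => a * f x).
Proof.
move=> Df; have := spline_limit_lin a Df spline_limit0.
by under eq_fun do rewrite addr0.
Qed.

Lemma spline_limitB f g : spline_limit f -> spline_limit g ->
  spline_limit (fun x => f x - g x).
Proof.
move=> Df Dg; have := spline_limit_lin (-1) Dg Df.
by under eq_fun do rewrite mulN1r addrC.
Qed.

Lemma spline_limit_sum n (F : 'I_n -> R -> R) : (forall i, spline_limit (F i)) ->
  spline_limit (fun x => \sum_i F i x).
Proof.
elim: n F => [|n IH] F DF.
  by under eq_fun do rewrite big_ord0; exact: spline_limit0.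
have := spline_limit_lin 1 (DF ord0) (IH (fun i => F (lift ord0 i)) (fun i => DF _)).
by congr spline_limit; apply/funext => x; rewrite big_ord_recl mul1r.
Qed.

Lemma spline_limit_closed f : L2 f -> (forall e : R, 0 < e -> exists g,
    spline_limit g /\ l2ip (fun x => f x - g x) (fun x => f x - g x) < e) ->
  spline_limit f.
Proof.
move=> Lf H; exists (L2fun Lf) => //.
apply: (ipclosure_trans L2_semi_inner (fun x Ux => Ux)) => e e0.
have [g [[h Uh hg] lt]] := H (e ^+ 2) (exprn_gt0 _ e0).
exists h => //; rewrite -(@ltr_pXn2r _ 2)// ?nnegrE ?(ltW e0) ?nrm_ge0//.
rewrite (nrm_sqr L2_semi_inner); move: lt; rewrite -hg; exact.
Qed.

Lemma spline_limit_phi (n : nat) (k : int) : spline_limit (fun x => phi m (2 ^ n%:Z * x - k%:~R)).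
Proof.
have ld := local_dilate n%:Z k (@local_phi R m).
have -> : (fun x : R => phi m (2 ^ n%:Z * x - k%:~R)) =
    (fun x : R => (2 `^ ((n%:Z)%:~R / 2))^-1 * dilate (phi m) n%:Z k x).
  by apply/funext => x; rewrite /dilate mulKf// gt_eqF// powR_gt0.
apply: spline_limitZ; exists (L2fun (local_L2 ld)) => //.
by apply/sub_ipclosure/sub_lspan => //; [exact: L2_semi_inner | exists n, k].
Qed.

Lemma local_indic_itv (a b : R) : local (\1_(`[a, b[ : set R)).
Proof.
split; first exact: measurable_indic.
exists 1, (Num.truncn (`|a| + `|b|)).+1 => x; split.
  by rewrite indicE; case: (_ \in _); rewrite ?normr1 ?normr0.
move=> xr; rewrite indicE memNset//= in_itv/= => /andP[ax xb].
have h : `|a| + `|b| < `|x| by rewrite (lt_le_trans (truncnS_gt _) xr).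
have : `|x| <= `|a| + `|b|.
  rewrite ler_norml; apply/andP; split.
    have := ler_norm (- a); rewrite normrN; have := normr_ge0 b; lra.
  by have := ler_norm b; have := normr_ge0 a; lra.
by rewrite leNgt h.
Qed.

Lemma Rintegral_indic_itv (a b : R) : a <= b -> \int[mu]_x \1_(`[a, b[ : set R) x = b - a.
Proof.
move=> ab; rewrite /Rintegral integral_indic// setIT.
have := @lebesgue_measure_itv R `[a, b[; rewrite /= lte_fin => ->.
by case: ltgtP ab => //= -> _; rewrite subrr.
Qed.

(** An interval indicator and the sum of the consecutive translates that fit into it
    differ only near the ends of the interval. *)
Lemma indic_block_error (al be : R) (W : nat) (y : R) :
  0 <= al < 1 -> W%:R <= be < W%:R + 1 ->
  (\1_(`[al, be[ : set R) y - bspline_block m.-1 W y) ^+ 2 <=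
  \1_(`[0, m%:R[ : set R) y + \1_(`[W%:R, W%:R + m%:R[ : set R) y.
Proof.
move=> /andP[a0 a1] /andP[b0 b1].
have [/andP[g0 g1] gz go] := bspline_block_bound m.-1 W y.
have mE : m%:R = m.-1%:R + 1 :> R by rewrite natr1 prednK.
have n0 : 0 <= m.-1%:R :> R by [].
have W0 : 0 <= W%:R :> R by [].
rewrite !indicE !mem_setE !in_itv/=.
have [y0|y0] := ltrP y 0.
  rewrite gz ?y0//.
  have -> : (al <= y) = false by apply/negbTE; rewrite -ltNge; lra.
  by rewrite subrr expr0n /= addr_ge0// ler0n.
have sq (b : bool) : ((b%:R : R) - bspline_block m.-1 W y) ^+ 2 <= 1.
  have b0' : 0 <= b%:R :> R by rewrite ler0n.
  have b1' : b%:R <= 1 :> R by rewrite lern1 leq_b1.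
  by move: (b%:R : R) (bspline_block _ _ _) b0' b1' g0 g1 => u v *; nra.
have [ym|ym] := ltrP y m%:R.
  by rewrite (le_trans (sq _))// lerDl ler0n.
have [yW|yW] := ltrP y W%:R.
  rewrite go; last by rewrite yW andbT; lra.
  have -> : al <= y by lra.
  have -> : y < be by lra.
  by rewrite subrr expr0n /= addr_ge0// ler0n.
have [yWm|yWm] := ltrP y (W%:R + m%:R).
  by rewrite (le_trans (sq _))// lerDr ler0n.
rewrite gz; last by apply/orP; right; lra.
have -> : (y < be) = false by apply/negbTE; rewrite -leNgt; lra.
by rewrite andbF subrr expr0n /= addr_ge0// ler0n.
Qed.

(** On the scale [n] the squared error has an integral of at most [2 m / 2^n]. *)
Lemma spline_limit_itv (a b : R) : a <= b -> spline_limit (\1_(`[a, b[ : set R)).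
Proof.
move=> ab; apply: spline_limit_closed; first exact/local_L2/local_indic_itv.
move=> e e0; pose n := (Num.truncn (2 * m%:R / e)).+1.
have p0 : 0 < (2 : R) ^ n%:Z by rewrite exprz_gt0.
have pn : 2 * m%:R / e < (2 : R) ^ n%:Z.
  by rewrite (lt_trans (truncnS_gt _))// -exprnP -natrX ltr_nat ltn_expl.
pose A := Num.floor (2 ^ n%:Z * a); pose B := Num.floor (2 ^ n%:Z * b).
have AB : A <= B by apply: le_floor; rewrite ler_pM2l.
pose W := `|B - A|%N.
have WE : B = A + W%:Z by rewrite /W; lia.
pose al := 2 ^ n%:Z * a - A%:~R; pose be := 2 ^ n%:Z * b - A%:~R.
have al01 : 0 <= al < 1.
  by rewrite subr_ge0 floor_le ltrBlDr addrC -intrD1 floorD1_gt.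
have be01 : W%:R <= be < W%:R + 1.
  have : B%:~R <= 2 ^ n%:Z * b < B%:~R + 1 by rewrite floor_le -intrD1 floorD1_gt.
  by rewrite WE intrD -pmulrn /be => /andP[h1 h2]; apply/andP; split; lra.
pose f y := \1_(`[al, be[ : set R) y - bspline_block m.-1 W y.
have lf : local f.
  have := localD (local_indic_itv al be) (localZ (-1) (local_bspline_block m.-1 W)).
  by congr local; apply/funext => x; rewrite mulN1r.
exists (fun x => bspline_block m.-1 W (2 ^ n%:Z * x - A%:~R)); split.
  have := spline_limit_sum (fun i : 'I_W => spline_limit_phi n (A + i%:Z + (m./2)%:Z)).
  congr spline_limit; apply/funext => x; apply: eq_bigr => i _.
  by rewrite /phi !intrD -!pmulrn; congr (N _ _); ring.
have E x : \1_(`[a, b[ : set R) x - bspline_block m.-1 W (2 ^ n%:Z * x - A%:~R) =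
    f (2 ^ n%:Z * x + - A%:~R).
  rewrite /f; congr (_%:R - _); rewrite !mem_setE !in_itv/= /al /be.
  by rewrite lerD2r ltrD2r ler_pM2l// ltr_pM2l.
rewrite (_ : (fun x => _) = (fun x => f (2 ^ n%:Z * x + - A%:~R))); last exact/funext.
rewrite l2ip_affine//; [|exact: local_L2..].
have li c d := local_indic_itv c d.
have bound : l2ip f f <= 2 * m%:R.
  rewrite /l2ip (le_trans (y := \int[mu]_y
    (\1_(`[0, m%:R[ : set R) y + \1_(`[W%:R, W%:R + m%:R[ : set R) y)))//.
    apply: le_Rintegral => //; first exact: (local_integrable (localM lf lf)).
      exact: (local_integrable (localD (li _ _) (li _ _))).
    by move=> y _; rewrite -expr2; exact: indic_block_error.
  rewrite RintegralD//; [|exact: (local_integrable (li _ _))..].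
  rewrite !Rintegral_indic_itv ?lerDl// subr0; lra.
rewrite mulrC ltr_pdivrMr// (le_lt_trans bound)//.
by move: pn; rewrite ltr_pdivrMr// [_ * e]mulrC.
Qed.

Definition window (T : nat) : set R := `[- T%:R, T%:R[.

Lemma measurable_window T : measurable (window T). Proof. exact: measurable_itv. Qed.

Lemma local_indicI (A : set R) T : measurable A -> local (\1_(A `&` window T)).
Proof.
move=> mA; split; first by apply: measurable_indic; apply: measurableI => //; exact: measurable_window.
have [_ [B [r H]]] := local_indic_itv (- T%:R) T%:R.
exists B, r => x; have [H1 H2] := H x.
rewrite indicE in_setI; move: H1 H2; rewrite indicE -/(window T).
case: (x \in A) => //= H1 H2; rewrite normr0; split => //.
by apply: le_trans H1.
Qed.

Lemma Rintegral_indicI (A : set R) T : measurable A ->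
  \int[mu]_x (\1_(A `&` window T) : R -> R) x = fine (mu (A `&` window T)).
Proof.
move=> mA; rewrite /Rintegral integral_indic ?setIT//.
by apply: measurableI => //; exact: measurable_window.
Qed.

Lemma window_fin (A : set R) T : measurable A -> mu (A `&` window T) \is a fin_num.
Proof.
move=> mA; have mW := measurable_window T.
rewrite ge0_fin_numE// (@le_lt_trans _ _ (mu (window T)))//.
  by apply: le_measure; rewrite ?inE; [exact: measurableI|exact: mW|move=> x []].
have := @lebesgue_measure_itv R `[- T%:R, T%:R[; rewrite /window /= => ->.
by case: ifP => _; rewrite ?ltry// -EFinB ltry.
Qed.

(** The sets whose intersection with a bounded window has an indicator in the closure
    form a Dynkin system that contains the rays, hence all Borel sets. *)
Lemma spline_limit_indic (A : set R) T : measurable A -> spline_limit (\1_(A `&` window T)).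
Proof.
move: A; pose P (A : set R) := spline_limit (\1_(A `&` window T)).
have TT : - T%:R <= T%:R :> R by rewrite ge0_cp.
have PT : P setT by rewrite /P setTI; exact: spline_limit_itv.
have PG A : RGenCInfty.G A -> P A.
  move=> [x ->]; rewrite /P.
  have -> : `[x, +oo[ `&` window T = `[Num.min (Num.max x (- T%:R)) T%:R, T%:R[%classic :> set R.
    apply/seteqP; split => y; rewrite /window /= !in_itv/= ?andbT ge_min ge_max.
      by move=> [-> /andP[-> ->]].
    move=> /andP[/orP[/andP[-> ->]|h1] h2]; first by rewrite h2.
    by have := lt_le_trans h2 h1; rewrite ltxx.
  by apply: spline_limit_itv; rewrite ge_min lexx orbT.
have PC (A : set R) : measurable A -> P A -> P (~` A).
  move=> mA PA; have := spline_limitB PT PA; rewrite /P; congr spline_limit.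
  apply/funext => x; rewrite !indicE !in_setI in_setT in_setC.
  by case: (x \in A); case: (x \in _); rewrite /= ?subrr ?subr0.
have PU (F : (set R)^nat) : (forall n, measurable (F n)) -> trivIset setT F ->
    (forall n, P (F n)) -> P (\bigcup_k F k).
  move=> mF tF PF.
  have mU : measurable (\bigcup_k F k) by exact: bigcup_measurable.
  apply: spline_limit_closed; first exact/local_L2/local_indicI.
  move=> e e0; pose B n := \big[setU/set0]_(i < n.+1) F i.
  have mB n : measurable (B n) by exact: bigsetU_measurable.
  have BU n : B n `<=` \bigcup_k F k by exact: bigsetU_bigcup.
  have PB n : P (B n).
    rewrite /P /B; elim: n.+1 => {n} [|n IH].
      by rewrite big_ord0 set0I indic0; exact: spline_limit0.
    have := spline_limit_lin 1 IH (PF n); congr spline_limit; apply/funext => x.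
    rewrite mul1r big_ord_recr/= !indicE !in_setI in_setU.
    have [xB|xB] := boolP (x \in \big[setU/set0]_(i < n) F i); last by rewrite /= add0r.
    have -> : (x \in F n) = false; last by rewrite /= addr0.
    apply/negbTE; rewrite notin_setE => xF; move: xB; rewrite inE.
    rewrite -bigcup_mkord => -[i /= iln xi].
    have /trivIsetP/(_ i n I I) tin := tF.
    have /tin : i != n by rewrite ltn_eqF.
    by move=> /seteqP[/(_ x) + _]; apply.
  have mW := measurable_window T.
  have cvg : mu (B n `&` window T) @[n --> \oo] --> mu (\bigcup_n (B n `&` window T)).
    apply: nondecreasing_cvg_mu.
    - move=> n; exact: (measurableI (B n) (window T) (mB n) mW).
    - by apply: bigcup_measurable => n _; exact: (measurableI (B n) (window T) (mB n) mW).
    - move=> n n' nn; apply/subsetPset; apply: setSI; rewrite /B.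
      by apply: subset_bigsetU; rewrite ltnS.
  rewrite -setI_bigcupl (_ : \bigcup_n B n = \bigcup_k F k) in cvg; last first.
    by rewrite /B; exact: bigcup_bigsetU_bigcup.
  rewrite -[X in _ --> X]fineK ?window_fin// in cvg.
  move: cvg => /fine_cvgP[_ cvg].
  have /cvgrPdist_lt/(_ e e0)[n _ Hn] := cvg.
  exists (\1_(B n `&` window T)); split; first exact: PB.
  have /= := Hn n (leqnn n).
  rewrite -!Rintegral_indicI// -RintegralB//; last 2 first.
  - exact/local_integrable/local_indicI.
  - exact/local_integrable/local_indicI.
  move=> lt; apply: le_lt_trans lt; rewrite (le_trans _ (ler_norm _))//.
  rewrite /l2ip le_eqVlt; apply/orP; left; apply/eqP; apply: eq_Rintegral => x _.
  rewrite !indicE !in_setI; case: (boolP (x \in B n)) => [xB|_].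
    have -> : x \in \bigcup_k F k by move: xB; rewrite !inE; exact: BU.
    by case: (x \in window T); rewrite /= subrr mulr0.
  by rewrite subr0; case: (_ && _); rewrite ?mulr1 ?mulr0.
move=> A mA.
have GE := RGenCInfty.measurableE R.
apply: (@dynkin_induction _ _ (@RGenCInfty.G R) P GE _ PT PG PC PU).
  move=> _ _ [x ->] [y ->]; exists (Num.max x y).
  by apply/seteqP; split => z /=; rewrite !in_itv/= !andbT ge_max => /andP.
by suff : (@RGenCInfty.G R).-sigma.-measurable A by []; rewrite -GE.
Qed.

Import HBNNSimple.

Lemma spline_limit_simple (g : {nnsfun R >-> R}) T :
  spline_limit (fun x => g x * \1_(window T) x).
Proof.
pose s := fset_set (range g).
have mg (i : 'I_#|`s|) : measurable (g @^-1` [set s`_i]) by exact: measurable_funPTI.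
have := spline_limit_sum (fun i : 'I_#|`s| =>
  spline_limitZ (s`_i) (spline_limit_indic T (mg i))).
congr spline_limit; apply/funext => x; rewrite fimfunEord mulr_suml.
by apply: eq_bigr => i _; rewrite -mulrA indicI.
Qed.

(** Simple functions from below, restricted to growing windows, converge in the mean by
    dominated convergence. *)
Lemma spline_limit_ge0 f : L2 f -> (forall x, 0 <= f x) -> spline_limit f.
Proof.
move=> Lf f0; have [mf fi] := (L2P f).1 Lf.
have mEf : measurable_fun setT (EFin \o f) by exact/measurable_EFinP.
pose a := nnsfun_approx measurableT mEf.
have a0 n x : 0 <= a n x by [].
have acvg x : a n x @[n --> \oo] --> f x.
  have := cvg_nnsfun_approx measurableT mEf (fun x _ => f0 x : (0 <= (EFin \o f) x)%E) (I : setT x).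
  by move/fine_cvgP => [].
have af n x : a n x <= f x.
  rewrite -(cvg_lim _ (acvg x))//; apply: nondecreasing_cvgn_le; last first.
    by apply/cvg_ex; exists (f x); exact: acvg.
  by move=> i j ij; have /(_ i j ij)/asboolP/(_ x) := nd_nnsfun_approx measurableT mEf.
pose g n x := a n x * \1_(window n) x.
have gf n x : 0 <= g n x <= f x.
  rewrite /g indicE; case: (_ \in _); rewrite ?mulr1 ?mulr0 ?f0 ?lexx//.
  by rewrite a0 af.
have mg n : measurable_fun setT (g n).
  apply: measurable_funM; first exact: measurable_funP.
  by apply: measurable_indic; exact: measurable_window.
have gcvg x : g n x @[n --> \oo] --> f x.
  apply: cvg_trans (acvg x); apply: near_eq_cvg.
  exists (Num.truncn `|x|).+1 => // n /= xn; rewrite /g indicE mem_set ?mulr1//.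
  have : `|x| < n%:R by rewrite (lt_le_trans (truncnS_gt _))// ler_nat.
  by rewrite ltr_norml /window /= in_itv/= => /andP[/ltW -> ->].
have := @dominated_convergence _ _ _ mu setT measurableT
  (fun n x => ((f x - g n x) ^+ 2)%:E) (cst 0%E) (fun x => (f x ^+ 2)%:E).
case.
- move=> n; apply/measurable_EFinP; apply: measurable_funX; exact: (measurable_funB mf (mg n)).
- exact: measurable_cst.
- apply: aeW => x _; apply: cvg_EFin; first exact: nearW.
  have h : (f x - g n x) @[n --> \oo] --> (0 : R).
    by rewrite -(subrr (f x)); apply: cvgB; [exact: cvg_cst | exact: gcvg].
  have : (f x - g n x) * (f x - g n x) @[n --> \oo] --> (0 : R).
    by rewrite -(mulr0 0); apply: cvgM.
  by under eq_fun do rewrite -expr2.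
- exact: Lfun2_integrable_sqr.
- apply: aeW => x n _ /=; rewrite lee_fin normrX.
  have /andP[h1 h2] := gf n x.
  by rewrite ler_pXn2r ?nnegrE ?normr_ge0 ?f0// ger0_norm ?subr_ge0//; lra.
move=> _ _; rewrite integral0 => H.
apply: spline_limit_closed => // e e0.
have /fine_cvgP[_ /cvgrPdist_lt/(_ e e0)[n _ Hn]] := H.
exists (g n); split; first exact: spline_limit_simple.
have := Hn n (leqnn n); rewrite /= sub0r normrN => h.
apply: le_lt_trans h; rewrite (le_trans _ (ler_norm _))// /l2ip /Rintegral.
Qed.

(** Positive and negative parts are limits of simple functions, whose level sets are
    dealt with by [spline_limit_indic]. *)
Lemma splines_total (h : @L2T R) : ipclosure ipH (lspan spline_generators) h.
Proof.
have [mh hi] := (L2P h).1 (L2_L2T h).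
have part (f : R -> R) : measurable_fun setT f -> (forall x, `|f x| <= `|h x|) -> L2 f.
  move=> mf fh; apply/L2P; split=> //; apply: le_lt_trans hi.
  apply: ge0_le_integral => //.
  - by move=> x _; rewrite lee_fin sqr_ge0.
  - by apply/measurable_EFinP; exact: measurable_funX.
  - by apply/measurable_EFinP; exact: measurable_funX.
  - move=> x _; rewrite lee_fin -(real_normK (num_real (f x))) -(real_normK (num_real (h x))).
    by rewrite ler_pXn2r ?nnegrE.
have D1 : spline_limit (fun x => Num.max (h x) 0).
  apply: spline_limit_ge0; last by move=> x; rewrite le_max lexx orbT.
  apply: part; first exact: measurable_maxr.
  by move=> x; case: (lerP (h x) 0); rewrite ?normr0.
have D2 : spline_limit (fun x => Num.max (- h x) 0).
  apply: spline_limit_ge0; last by move=> x; rewrite le_max lexx orbT.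
  apply: part; first by apply: measurable_maxr => //; exact: measurable_funN.
  by move=> x; case: (lerP (- h x) 0); rewrite ?normr0 ?normrN.
have [h' Uh' hE] := spline_limitB D1 D2.
apply: (ipclosure_eq L2_semi_inner _ Uh').
rewrite (_ : h' = h) ?subrr ?nrm0//; first exact: L2_semi_inner.
apply/LfuneqP => x; rewrite hE.
by case: (lerP (h x) 0); case: (lerP (- h x) 0); lra.
Qed.

End SplineDensity.

(** * Sums of function spaces *)

Section FunctionSpaces.
Context {R : realType}.
Local Notation mu := (@lebesgue_measure R).
Local Notation toR := (fun h : @L2T R => h : R -> R).
Local Notation ipH := (fun f g : @L2T R => l2ip f g).

Lemma ae_imp (P Q : R -> Prop) : (forall x, P x -> Q x) ->
  {ae mu, forall x, P x} -> {ae mu, forall x, Q x}.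
Proof.
move=> PQ hP; have F := ae_filter_ringOfSetsType mu.
by apply: filterS hP; exact: PQ.
Qed.

Lemma ae_imp2 (P Q S : R -> Prop) : (forall x, P x -> Q x -> S x) ->
  {ae mu, forall x, P x} -> {ae mu, forall x, Q x} -> {ae mu, forall x, S x}.
Proof.
move=> PQ hP hQ; have F := ae_filter_ringOfSetsType mu.
by apply: filterS2 hP hQ; exact: PQ.
Qed.

Lemma l2nrm0_ae (h : @L2T R) : nrm ipH h = 0 -> (h : R -> R) = 0 %[ae mu].
Proof.
move=> h0; apply: (@fine_Lnormr_eq0 _ _ _ mu 2%:E).
by rewrite L2_norm; [exact: h0 | exact: L2_L2T].
Qed.

Lemma ae_l2nrm0 (h : @L2T R) : (h : R -> R) = 0 %[ae mu] -> nrm ipH h = 0.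
Proof.
move=> h0; rewrite /nrm /l2ip /Rintegral.
rewrite (ae_eq_integral (cst 0%E))//.
- by rewrite integral0 sqrtr0.
- apply/measurable_EFinP; have [mh _] := (L2P h).1 (L2_L2T h).
  exact: measurable_funM.
- by apply: ae_imp h0 => x h0 _ /=; rewrite h0// mulr0.
Qed.

Lemma L2_ae_eq_nrm (h h' : @L2T R) : (h : R -> R) = h' %[ae mu] -> nrm ipH (h - h') = 0.
Proof.
move=> hh; apply: ae_l2nrm0; apply: ae_imp hh => x hx Ix.
by rewrite -[LHS]/(h x - h' x) (hx Ix) subrr.
Qed.

Section DirectSums.
Variables (I : choiceType) (U : I -> set (R -> R)).
Hypothesis Usub : forall i, is_subspace (U i).

Lemma fset_sum_extend (V : zmodType) (s s' : {fset I}) (u : I -> V) : (s `<=` s')%fset ->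
  \sum_(i <- s) u i = \sum_(i <- s') (if i \in s then u i else 0).
Proof.
move=> ss; rewrite -(big_fset_incl _ ss) => [|i _ /negPf -> //].
by rewrite big_seq [RHS]big_seq; apply: eq_bigr => i ->.
Qed.

Lemma subspace_sum_subspace : is_subspace (subspace_sum U).
Proof.
have U0 i : U i 0 by case: (Usub i).
split; first by exists fset0, (fun=> 0); split => [i|]; rewrite ?big_seq_fset0.
move=> a x y [s [u [Uu ->]]] [s' [u' [Uu' ->]]].
exists (s `|` s')%fset, (fun i => a *: (if i \in s then u i else 0) +
  (if i \in s' then u' i else 0)); split.
  by move=> i _; apply: (proj2 (Usub i)); case: ifP => // h; [exact: Uu | exact: Uu'].
rewrite (fset_sum_extend u (fsubsetUl s s')) (fset_sum_extend u' (fsubsetUr s s')).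
by rewrite scaler_sumr -big_split.
Qed.

Lemma sub_subspace_sum i : U i `<=` subspace_sum U.
Proof.
move=> f Uf; exists [fset i]%fset, (fun=> f); split; last by rewrite big_seq_fset1.
by move=> j; rewrite !inE => /eqP ->.
Qed.

(** Directness is a matter of one member of the index set at a time: the largest one,
    when the other spaces lie in a space that it meets trivially. *)
Lemma direct_of_largest :
  (forall s : {fset I}, s != fset0 -> exists2 J, J \in s & exists X : set (R -> R),
     [/\ is_subspace X, (forall i, i \in s -> i != J -> U i `<=` X) &
       forall f g, U J f -> X g -> f = g %[ae mu] -> f = 0 %[ae mu]]) ->
  direct U.
Proof.
move=> top.
have null : forall n (s : {fset I}) (w : I -> R -> R), #|` s| = n ->
    (forall i, i \in s -> U i (w i)) -> \sum_(i <- s) w i = 0 %[ae mu] ->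
    forall i, i \in s -> w i = 0 %[ae mu].
  elim=> [|n IH] s w sn Uw w0 i iS.
    by move: sn iS => /eqP; rewrite cardfs_eq0 => /eqP ->; rewrite inE.
  have sN0 : s != fset0 by rewrite -cardfs_eq0 sn.
  have [J JS [X [Xsub UX triv]]] := top s sN0.
  have wJ : w J = 0 %[ae mu].
    apply: (triv _ (- \sum_(i <- (s `\ J)%fset) w i)); first exact: Uw.
      apply: subspaceN => //; apply: subspace_sum_in => // k; rewrite !inE => /andP[kJ ks].
      by apply: (UX k ks kJ); exact: Uw.
    apply: ae_imp w0 => x h Ix; have {h} := h Ix.
    by rewrite (big_fsetD1 J)//= => /eqP; rewrite addr_eq0 => /eqP.
  have [->//|iJ] := eqVneq i J.
  apply: (IH (s `\ J)%fset w) => //.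
  - by move: (cardfsD1 J s); rewrite JS sn add1n => -[].
  - by move=> k; rewrite !inE => /andP[_]; exact: Uw.
  - apply: ae_imp2 w0 wJ => x h h' Ix; have {h} := h Ix; have {h'} := h' Ix.
    by rewrite (big_fsetD1 J)//= => h'; rewrite [X in X -> _]/= -[(_ + _) x]/(_ x + _ x) h' add0r.
  - by rewrite !inE iJ.
move=> s u v Uu Uv uv i iS.
have Uuv j : j \in s -> U j (u j - v j).
  by move=> js; apply: subspaceB; [exact: Usub | exact: Uu | exact: Uv].
have uv0 : \sum_(i <- s) (u i - v i) = 0 %[ae mu].
  apply: ae_imp uv => x h Ix; rewrite sumrB.
  by rewrite -[LHS]/((\sum_(i <- s) u i) x - (\sum_(i <- s) v i) x) (h Ix) subrr.
apply: ae_imp (null _ s (fun i => u i - v i) erefl Uuv uv0 i iS) => x h Ix.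
by apply/eqP; rewrite -subr_eq0; apply/eqP; exact: (h Ix).
Qed.
End DirectSums.
End FunctionSpaces.

(** * Density of the quarklets *)

Section GeneratedSpaces.
Context {R : realType}.
Local Notation mu := (@lebesgue_measure R).
Local Notation toR := (fun h : @L2T R => h : R -> R).
Local Notation ipH := (fun f g : @L2T R => l2ip f g).
Implicit Types (F G : nat -> R -> R) (p q : nat) (j k : int).

Definition generators F p j : set (R -> R) :=
  [set g | exists (q : nat) (k : int), (q <= p)%N /\ g = dilate (F q) j k].

Lemma generators_L2 F p j g : (forall q, local (F q)) -> generators F p j g -> L2 g.
Proof. by move=> LF [q [k [_ ->]]]; apply: local_L2; exact: local_dilate. Qed.

(** The spaces generated by local functions are closures in the
    semi-inner product space of square integrable functions. *)
Lemma generated_spaceP F p j f : (forall q, local (F q)) ->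
  generated_space F p j f <-> exists2 h : @L2T R,
    ipclosure ipH (lspan [set h : @L2T R | generators F p j h]) h & toR h = f.
Proof. by move=> LF; apply: L2closure_spanE => g; exact: generators_L2. Qed.

Lemma generated_space_subspace F p j : (forall q, local (F q)) ->
  is_subspace (generated_space F p j).
Proof.
move=> LF; have [S0 SD] := ipclosure_subspace L2_semi_inner
  (lspan_subspace [set h : @L2T R | generators F p j h]).
split; first by apply/(generated_spaceP p j _ LF); exists 0.
move=> a x y /(generated_spaceP p j _ LF)[h Sh <-] /(generated_spaceP p j _ LF)[h' Sh' <-].
by apply/(generated_spaceP p j _ LF); exists (a *: h + h'); [exact: SD | ].
Qed.

Lemma generated_space_mono F G p p' j j' :
  (forall g, generators F p j g -> lspan (generators G p' j') g) ->
  generated_space F p j `<=` generated_space G p' j'.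
Proof.
move=> FG f [Lf nf]; split => // e e0; have [g gF fg] := nf e e0.
exists g => //; exact: (lspan_mono FG).
Qed.

Lemma sub_generated_space F p j : (forall q, local (F q)) ->
  generators F p j `<=` generated_space F p j.
Proof.
move=> LF g gF; apply/(generated_spaceP p j _ LF).
exists (L2fun (generators_L2 LF gF)) => //.
by apply: (sub_ipclosure L2_semi_inner); apply: sub_lspan.
Qed.

(** A two-scale relation of the generators gives inclusions of the spaces on
    consecutive scales. *)
Lemma generators_refine G p j (f : R -> R) k (n : nat) (c : 'I_n -> R) (r : 'I_n -> nat)
    (z : 'I_n -> int) : (forall i, (r i <= p)%N) ->
  (forall x, f x = \sum_(i < n) c i * G (r i) (2 * x - (z i)%:~R)) ->
  lspan (generators G p (j + 1)) (dilate f j k).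
Proof.
move=> rp fE; exists n, (fun i => c i * 2 `^ (- 2^-1)),
  (fun i => dilate (G (r i)) (j + 1) (2 * k + z i)); split.
  by move=> i; exists (r i), (2 * k + z i).
apply/funext => x; rewrite fct_sumE /dilate fE mulr_sumr; apply: eq_bigr => i _.
rewrite -[RHS]/(c i * 2 `^ (- 2^-1) * (2 `^ ((j + 1)%:~R / 2) *
  G (r i) (2 ^ (j + 1) * x - (2 * k + z i)%:~R))).
have -> : 2 `^ ((j + 1)%:~R / 2) = 2 `^ (2^-1) * 2 `^ (j%:~R / 2) :> R.
  by rewrite -powRD; [congr (_ `^ _); rewrite intrD; field | rewrite pnatr_eq0 implybT].
have -> : 2 `^ (- 2^-1) = (2 `^ (2^-1))^-1 :> R by rewrite powRN.
have -> : 2 ^ (j + 1) * x - (2 * k + z i)%:~R = 2 * (2 ^ j * x - k%:~R) - (z i)%:~R :> R.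
  by rewrite expfzDr// expr1z !intrD intrM; ring.
have p0 : 2 `^ (2^-1) != 0 :> R by rewrite gt_eqF// powR_gt0.
by field.
Qed.

Lemma local_quark m q : local (quark m q : R -> R).
Proof.
have lN : local (fun x : R => bspline m (x + (m./2)%:R)).
  by apply: local_translate; exact: local_bspline.
have [mN [B [r H]]] := lN; split.
  apply: measurable_funM => //; apply: measurable_funX.
  by apply: measurable_funM.
exists (((r%:R : R) / (uphalf m)%:R) ^+ q * B), r => x; have [H1 H2] := H x.
have B0 : 0 <= B by exact: le_trans H1.
split; last by move=> /H2 h; rewrite /quark h mulr0.
have [xr|xr] := lerP (r%:R : R) `|x|.
  by rewrite /quark H2// mulr0 normr0 mulr_ge0// exprn_ge0// divr_ge0.
rewrite /quark normrM ler_pM//; rewrite normrX; apply: lerXn2r; rewrite ?nnegrE ?divr_ge0//.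
by rewrite normrM normfV (ger0_norm (ler0n _ (uphalf m))) ler_wpM2r ?invr_ge0// ltW.
Qed.

Section Wavelets.
Variables (m : nat) (b : int -> R) (M : nat) (B : {poly R}).
Hypothesis bM : forall k, b k != 0 -> (`|k| <= 2 * M)%N.
Hypothesis sB : (size B <= (4 * M).+1)%N.
Hypothesis bB : forall i : nat, b (i%:Z - (2 * M)%:Z) = 2 * B`_i.

Lemma quarkletE q (x : R) : quarklet m b q x =
  \sum_(i < (4 * M).+1) 2 * B`_i * quark m q (2 * x - (i%:Z - (2 * M)%:Z)%:~R).
Proof.
rewrite /quarklet (@finsupp_sum _ _ (2 * M)); last first.
  move=> k; apply: contraNT => kM; rewrite (_ : b k = 0) ?mul0r//.
  by apply/eqP; apply: contraNT kM; exact: bM.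
rewrite (_ : (2 * (2 * M)).+1 = (4 * M).+1); last by lia.
by apply: eq_bigr => i _; rewrite bB.
Qed.

Lemma local_quarklet q : local (quarklet m b q).
Proof.
rewrite (_ : quarklet m b q = fun x => \sum_(i < (4 * M).+1)
  2 * B`_i * quark m q (2 * x + (- (i%:Z - (2 * M)%:Z)%:~R))); last first.
  by apply/funext => x; exact: quarkletE.
apply: local_sum => i; apply: localZ.
by apply: local_affine => //; exact: local_quark.
Qed.

Lemma Wspace_sub_Vspace p j : Wspace m b p j `<=` Vspace m p (j + 1).
Proof.
apply: generated_space_mono => _ [q [k [qp ->]]].
exact: (@generators_refine _ _ _ _ _ _ (fun i => 2 * B`_i) (fun=> q)
  (fun i : 'I_(4 * M).+1 => i%:Z - (2 * M)%:Z) (fun=> qp) (quarkletE q)).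
Qed.

(** The wavelet relation in the form of [phi_refine], with the mask [B]. *)
Lemma psi_refine (x : R) (l : int) : quarklet m b 0 (x - l%:~R) =
  \sum_(i < size B) 2 * B`_i * phi m (2 * x - (2 * l + i%:Z - (2 * M)%:Z)%:~R).
Proof.
rewrite quarkletE quark0.
rewrite (big_ord_widen _ (fun i => 2 * B`_i * phi m (2 * x - (2 * l + i%:Z - (2 * M)%:Z)%:~R)) sB).
rewrite [LHS](bigID (fun i : 'I_(4 * M).+1 => (i < size B)%N))/=.
rewrite [X in _ + X]big1 ?addr0 => [|i]; last first.
  by rewrite -leqNgt => si; rewrite nth_default ?mulr0 ?mul0r.
apply: eq_bigr => i _; congr (_ * phi m _).
by rewrite !intrB intrD intrM; ring.
Qed.

Hypothesis m0 : (0 < m)%N.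
Hypothesis mM : (m./2 <= 2 * M)%N.
Hypothesis det : mask_poly m M * (B \Po (- 'X)) - (mask_poly m M \Po (- 'X)) * B = 'X^((4 * M).+1).

Let A : {poly R} := mask_poly m M.

Lemma dilate_reconstruction (j k : int) (x : R) : dilate (phi m) (j + 1) k x =
  2 `^ (2^-1) * (\sum_(i < size B) parity_filter M B k i * dilate (phi m) j (coarse_index M k i) x -
   \sum_(i < size A) parity_filter M A k i * dilate (quarklet m b 0) j (coarse_index M k i) x).
Proof.
rewrite {1}/dilate.
have -> : 2 ^ (j + 1) * x - k%:~R = 2 * (2 ^ j * x) - k%:~R :> R.
  by rewrite expfzDr// expr1z; ring.
rewrite (reconstruction m0 mM psi_refine det).
have -> : 2 `^ ((j + 1)%:~R / 2) = 2 `^ (2^-1) * 2 `^ (j%:~R / 2) :> R.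
  by rewrite -powRD; [congr (_ `^ _); rewrite intrD; field | rewrite pnatr_eq0 implybT].
rewrite -mulrA; congr (_ * _); rewrite mulrBr !mulr_sumr.
by congr (_ - _); apply: eq_bigr => i _; rewrite /dilate mulrCA.
Qed.

Definition phiH (j k : int) : @L2T R := L2fun (local_L2 (local_dilate j k (local_phi m))).
Definition psiH (j k : int) : @L2T R := L2fun (local_L2 (local_dilate j k (local_quarklet 0))).

Lemma phiH_reconstruction (j k : int) : phiH (j + 1) k =
  \sum_(i < size B) (2 `^ (2^-1) * parity_filter M B k i) *: phiH j (coarse_index M k i) -
  \sum_(i < size A) (2 `^ (2^-1) * parity_filter M A k i) *: psiH j (coarse_index M k i).
Proof.
apply/LfuneqP => x.
have sumE (n : nat) (c : 'I_n -> R) (F : 'I_n -> @L2T R) :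
    (\sum_(i < n) c i *: F i : @L2T R) x = \sum_(i < n) c i * F i x :> R.
  by rewrite L2T_sumE fct_sumE.
rewrite -[LHS]/(dilate (phi m) (j + 1) k x) dilate_reconstruction mulrBr !mulr_sumr.
pose w (P : {poly R}) (i : nat) : R := 2 `^ (2^-1) * parity_filter M P k i.
transitivity ((\sum_(i < size B) w B i *: phiH j (coarse_index M k i) : @L2T R) x
  - (\sum_(i < size A) w A i *: psiH j (coarse_index M k i) : @L2T R) x); last by [].
by rewrite !sumE; congr (_ - _); apply: eq_bigr => i _; rewrite /w -mulrA.
Qed.

(** Starting from the scale 0, reconstruction reaches all finer scales. *)
Lemma multilevel_total (h : @L2T R) : ipclosure ipH
  (lspan [set h | (exists k, h = phiH 0 k) \/ (exists (j : nat) k, h = psiH j%:Z k)]) h.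
Proof.
set G := [set h | _].
have GS := lspan_subspace G.
have phiG (n : nat) k : lspan G (phiH n%:Z k).
  elim: n k => [|n IH] k; first by apply: sub_lspan; left; exists k.
  rewrite (_ : n.+1%:Z = n%:Z + 1); last by lia.
  rewrite phiH_reconstruction; apply: subspaceB => //.
    by apply: subspace_big => // i _; apply: subspaceZ => //; exact: IH.
  apply: subspace_big => // i _; apply: subspaceZ => //; apply: sub_lspan; right.
  by exists n, (coarse_index M k i).
have := @splines_total R m m0 h.
apply: ipclosure_trans; first exact: L2_semi_inner.
apply: subset_trans (sub_ipclosure L2_semi_inner (S := lspan G)).
apply: lspan_min => // g [n [k gE]].
by rewrite (_ : g = phiH n%:Z k)//; apply/LfuneqP => x; rewrite gE.
Qed.

(** The reconstruction formula presents [phi (j + 1) k] modulo the wavelets as the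
    subdivision of the [phi j l] by the mask [s], the coefficients of [B(-X)] read
    backwards from the index [2 * M + 1]. *)
Lemma wavelets_total (h : @L2T R) :
  ipclosure ipH (lspan [set h | exists j k, h = psiH j k]) h.
Proof.
pose s (i : int) : R :=
  2 `^ (2^-1) * ((-1) ^+ `|(2 * M).+1%:Z - i|%N * B`_(`|(2 * M).+1%:Z - i|%N)).
have [K [r Hgram]] := dilate_gram (local_phi m : local (phi m : R -> R)).
apply: (@affine_system_total _ _ _ L2_semi_inner phiH _
  [seq (2 * M).+1%:Z - i%:Z | i <- iota 0 (size B)] s K r).
- move=> j k; rewrite phiH_reconstruction big_map.
  rewrite (_ : iota 0 (size B) = index_iota 0 (size B)); last by rewrite /index_iota subn0.
  rewrite big_mkord.
  rewrite (_ : \sum_(i < size B) s _ *: _ =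
    \sum_(i < size B) (2 `^ (2^-1) * parity_filter M B k i) *: phiH j (coarse_index M k i)).
    rewrite addrAC subrr add0r; apply: subspaceN; first exact: lspan_subspace.
    apply: subspace_big; first exact: lspan_subspace.
    move=> i _; apply: subspaceZ; first exact: lspan_subspace.
    by apply: sub_lspan; exists j, (coarse_index M k i).
  apply: eq_bigr => i _; rewrite /parity_filter /coarse_index /s.
  have -> : k - ((2 * M).+1%:Z - i%:Z) = k - (2 * M).+1%:Z + i%:Z by ring.
  have -> : `|((2 * M).+1%:Z - ((2 * M).+1%:Z - i%:Z))%R|%N = i by rewrite subKr.
  by case: ifP => _; rewrite ?mulr0 ?scale0r ?scaler0.
- by move=> j k l; have [H1 _] := Hgram j; exact: H1.
- by move=> j k l kl; have [_ H2] := Hgram j; exact: H2.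
- by move=> i l k e e0; exact: (dilate_weak_decay (local_phi m) (local_phi m)).
- move=> h'; have := @splines_total R m m0 h'.
  apply: ipclosure_trans; first exact: L2_semi_inner.
  apply: subset_trans (sub_ipclosure L2_semi_inner (S := _)).
  apply: lspan_mono => g [n [k gE]]; apply: sub_lspan; exists n%:Z, k.
  by apply/LfuneqP => x; rewrite gE.
Qed.

End Wavelets.
End GeneratedSpaces.

(** * Functionals that separate wavelets from splines *)

Section Duals.
Context {R : realType}.
Local Notation mu := (@lebesgue_measure R).
Local Notation toR := (fun h : @L2T R => h : R -> R).
Local Notation ipH := (fun f g : @L2T R => l2ip f g).
Implicit Types f g : R -> R.

Lemma l2ip_suml (n : nat) (c : 'I_n -> R) (F : 'I_n -> R -> R) g :
  (forall i, local (F i)) -> local g ->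
  l2ip (fun x => \sum_(i < n) c i * F i x) g = \sum_(i < n) c i * l2ip (F i) g.
Proof.
move=> LF lg; rewrite /l2ip.
under eq_Rintegral do rewrite mulr_suml.
have L1 i : local (fun x => F i x * g x) by exact: localM.
rewrite Rintegral_local_sum//; last first.
  by move=> i; under eq_fun do rewrite -mulrA; exact: localZ.
apply: eq_bigr => i _; under eq_Rintegral do rewrite -mulrA.
by rewrite RintegralZl//; exact: local_integrable.
Qed.

Lemma l2ip_sumr (n : nat) (c : 'I_n -> R) (F : 'I_n -> R -> R) g :
  (forall i, local (F i)) -> local g ->
  l2ip g (fun x => \sum_(i < n) c i * F i x) = \sum_(i < n) c i * l2ip g (F i).
Proof.
move=> LF lg; rewrite l2ipC l2ip_suml//.
by apply: eq_bigr => i _; rewrite l2ipC.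
Qed.

Lemma l2ip_half f g (a c : int) : local f -> local g ->
  l2ip (fun x => f (2 * x - a%:~R)) (fun x => g (2 * x - c%:~R)) =
  2^-1 * l2ip f (fun x => g (x + (a - c)%:~R)).
Proof.
move=> lf lg; have two0 : 0 < 2 :> R by [].
have lg' : local (fun x => g (x + (a - c)%:~R)) by exact: local_translate.
rewrite -(l2ip_affine (- a%:~R) two0 (local_L2 lf) (local_L2 lg')).
apply: eq_Rintegral => x _; congr (_ * g _).
by rewrite intrB; ring.
Qed.

Lemma l2ip_translate f g (d : int) : local f -> local g ->
  l2ip f (fun x => g (x + d%:~R)) = l2ip (fun x => f (x - d%:~R)) g.
Proof.
move=> lf lg; have lg' : local (fun x => g (x + d%:~R)) by exact: local_translate.
have := l2ip_affine (- d%:~R) ltr01 (local_L2 lf) (local_L2 lg').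
rewrite invr1 mul1r => <-; apply: eq_Rintegral => x _.
by congr (f _ * g _); rewrite mul1r// subrK.
Qed.

Lemma coefM_pairs (P Q : {poly R}) (n : int) :
  \sum_(i < size P) \sum_(j < size Q) P`_i * Q`_j * (i%:Z + j%:Z == n)%:R =
  if (0 <= n) then (P * Q)`_(`|n|%N) else 0.
Proof.
case: ifP => n0; last first.
  rewrite big1// => i _; rewrite big1// => j _.
  by rewrite (_ : (_ == n) = false) ?mulr0//; apply/negbTE; apply: contraFneq n0 => <-.
case: n n0 => // n _; rewrite absz_nat.
have -> : P * Q = (\sum_(i < size P) P`_i *: 'X^i) * (\sum_(j < size Q) Q`_j *: 'X^j).
  by rewrite -!poly_def !coefK.
rewrite mulr_suml coef_sum; apply: eq_bigr => i _.
rewrite mulr_sumr coef_sum; apply: eq_bigr => j _.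
have -> : (P`_i *: 'X^i) * (Q`_j *: 'X^j) = (P`_i * Q`_j) *: 'X^(i + j)%N :> {poly R}.
  by rewrite exprD -scalerAl -scalerAr scalerA.
by rewrite coefZ coefXn eq_sym.
Qed.

(** The modulated product of a polynomial with itself is even. *)
Lemma coef_modulated_sqr (A : {poly R}) n : odd n -> ((A \Po (- 'X)) * A)`_n = 0.
Proof.
move=> on; have E : ((A \Po (- 'X)) * A) \Po (- 'X) = (A \Po (- 'X)) * A.
  rewrite comp_polyM -comp_polyA (_ : (- 'X) \Po (- 'X) = 'X :> {poly R}).
    by rewrite comp_polyXr mulrC.
  by rewrite raddfN/= comp_polyX opprK.
have := coef_compN ((A \Po (- 'X)) * A) n.
rewrite E -signr_odd on expr1 mulN1r => /eqP; rewrite -subr_eq0 opprK -mulr2n.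
by rewrite mulrn_eq0 => /eqP.
Qed.

(** On the coefficient of an odd power the two products in the determinant differ only
    in sign. *)
Lemma coef_modulated_det (A B : {poly R}) (N n : nat) : odd N -> odd n ->
  A * (B \Po (- 'X)) - (A \Po (- 'X)) * B = 'X^N ->
  ((A \Po (- 'X)) * B)`_n = - 2^-1 * (n == N)%:R.
Proof.
move=> oN on det.
have E : ((A \Po (- 'X)) * B) \Po (- 'X) = A * (B \Po (- 'X)).
  rewrite comp_polyM -comp_polyA (_ : (- 'X) \Po (- 'X) = 'X :> {poly R}).
    by rewrite comp_polyXr.
  by rewrite raddfN/= comp_polyX opprK.
have := coef_compN ((A \Po (- 'X)) * B) n.
rewrite E -signr_odd on expr1 mulN1r.
have := congr1 (fun P : {poly R} => P`_n) det; rewrite coefB coefXn => <-.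
by move=> ->; field.
Qed.

(** On the unit interval the translates of the spline that do not vanish there are
    linearly independent polynomials; a Gram dual of them isolates one translate. *)
Lemma phi_dual m : (0 < m)%N -> exists2 eta : R -> R, local eta &
  forall k : int, l2ip (phi m) (fun x => eta (x + k%:~R)) = (k == 0)%:R.
Proof.
case: m => // n _.
have [|v vP] := @gram_dual R n.+1 (fun i => pieces n i%:Z).
  move=> c c0 i.
  pose c' (z : int) : R := if insub `|z|%N is Some i then c i else 0.
  have c'E (j : 'I_n.+1) : c' j%:Z = c j by rewrite /c' absz_nat valK.
  rewrite -c'E; apply: (@pieces_free R n c'); last by rewrite -ltnS.
  by rewrite -[RHS]c0; apply: eq_bigr => j _; rewrite c'E.
have hn : (n.+1./2 < n.+1)%N by lia.
exists (box (v (Ordinal hn))) => [|k]; first exact: local_box.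
rewrite l2ip_translate; [|exact: local_phi|exact: local_box].
have -> : l2ip (fun x => phi n.+1 (x - k%:~R)) (box (v (Ordinal hn))) =
    l2ip (box (v (Ordinal hn))) (box (pieces n (n.+1./2%:Z - k))).
  rewrite l2ipC; apply: eq_Rintegral => x _; rewrite /box indicE mem_setE in_itv/=.
  case: (boolP (0 <= x < 1)) => x01; last by rewrite !mul0r.
  rewrite !mul1r -(bspline_pieces _ _ x01) /phi; congr (_ * bspline_rec n _).
  by rewrite intrB; ring.
have [hk|hk] := boolP ((n.+1./2%:Z - k < 0) || (n%:Z < n.+1./2%:Z - k)).
  rewrite pieces_out//; have -> : (k == 0) = false by lia.
  by rewrite l2ip_box mulr0 Pint0 horner0.
have hk' : (`|(n.+1./2%:Z - k)%R|%N < n.+1)%N by lia.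
have -> : n.+1./2%:Z - k = (Ordinal hk' : nat)%:Z by rewrite /=; lia.
rewrite vP; congr (_%:R); congr nat_of_bool.
rewrite -val_eqE /=; move: hk; rewrite negb_or -!leNgt => /andP[h1 h2].
by apply/eqP/eqP => h3; lia.
Qed.

Section HighpassDual.
Variables (m : nat) (M : nat) (eta : R -> R).
Hypotheses (leta : local eta)
  (etaP : forall k : int, l2ip (phi m) (fun x => eta (x + k%:~R)) = (k == 0)%:R).
Let A : {poly R} := mask_poly m M.

(** The functional with the high-pass mask of the generator.  Against a function of mask
    [P] it reads off an odd coefficient of [A(-X) P]: for [P = A] this vanishes by
    parity, for [P = B] the determinant makes it a Kronecker symbol. *)
Definition highpass_dual (x : R) : R := \sum_(j < size A)
  (- 2 * ((A \Po (- 'X))`_j)) * eta (2 * x - ((2 * M).+1%:Z - j%:Z)%:~R).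

Lemma local_highpass_dual : local highpass_dual.
Proof. by apply: local_sum => j; apply: localZ; exact: local_affine. Qed.

Lemma size_modulated (P : {poly R}) : size (P \Po (- 'X)) = size P.
Proof. by rewrite size_comp_poly2// size_polyN size_polyX. Qed.

Lemma highpass_dualP (P : {poly R}) (f : R -> R) (l : int) :
  (forall x, f (x - l%:~R) = \sum_(i < size P)
    2 * P`_i * phi m (2 * x - (2 * l + i%:Z - (2 * M)%:Z)%:~R)) ->
  l2ip (fun x => f (x - l%:~R)) highpass_dual =
  if 0 <= (4 * M).+1%:Z - 2 * l then
    - 2 * ((A \Po (- 'X)) * P)`_(`|((4 * M).+1%:Z - 2 * l)%R|%N) else 0.
Proof.
move=> fE.
have lp (z : int) : local (fun x : R => phi m (2 * x - z%:~R)).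
  by apply: local_affine => //; exact: local_phi.
have le (z : int) : local (fun x : R => eta (2 * x - z%:~R)) by exact: local_affine.
under eq_fun do rewrite fE.
rewrite l2ip_suml//; last exact: local_highpass_dual.
transitivity (- 2 * \sum_(i < size P) \sum_(j < size (A \Po (- 'X)))
    P`_i * (A \Po (- 'X))`_j * (i%:Z + j%:Z == (4 * M).+1%:Z - 2 * l)%:R).
  rewrite mulr_sumr; apply: eq_bigr => i _.
  rewrite l2ip_sumr// size_modulated !mulr_sumr; apply: eq_bigr => j _.
  rewrite l2ip_half//; last exact: local_phi.
  rewrite etaP (_ : (2 * l + i%:Z - (2 * M)%:Z - ((2 * M).+1%:Z - j%:Z) == 0) =
    (i%:Z + j%:Z == (4 * M).+1%:Z - 2 * l)); last by lia.
  by field.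
by rewrite coefM_pairs; case: ifP => _; rewrite ?mulr0// mulrC [P * _]mulrC mulrC.
Qed.
End HighpassDual.

(** * Functionals that separate quarklets from piecewise polynomials *)

Lemma quark1 q : quark 1 q = box 'X^q :> (R -> R).
Proof.
apply/funext => x.
by rewrite /quark /bspline /= addr0 divr1 /box hornerXn mulrC.
Qed.

(** The monomial on the right half of the interval is expanded about the midpoint. *)
Lemma box_monomial_refine q (x : R) : box 'X^q x = 2^-1 ^+ q *
  (box 'X^q (2 * x) + \sum_(s < q.+1) 'C(q, s)%:R * box 'X^s (2 * x - 1)).
Proof.
have -> : \sum_(s < q.+1) 'C(q, s)%:R * box 'X^s (2 * x - 1) =
    \1_(`[0, 1[ : set R) (2 * x - 1) * (2 * x) ^+ q.
  have -> : (2 * x) ^+ q = (1 + (2 * x - 1)) ^+ q by congr (_ ^+ q); ring.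
  rewrite exprDn mulr_sumr; apply: eq_bigr => s _.
  by rewrite /box expr1n mul1r hornerXn -mulr_natr; ring.
have := @unit_indic_refine R x; rewrite /= => E.
by rewrite /box E !hornerXn -mulrDl mulrCA -exprMn mulKf.
Qed.

Lemma quark1_refine q (x : R) : quark 1 q x = \sum_(i < q.+2)
  (if val i is s.+1 then 2^-1 ^+ q * 'C(q, s)%:R else 2^-1 ^+ q) *
  quark 1 (if val i is s.+1 then s else q)
    (2 * x - (if val i is _.+1 then 1 else 0 : int)%:~R).
Proof.
rewrite big_ord_recl/= subr0 !quark1 box_monomial_refine mulrDr mulr_sumr.
by congr (_ + _); apply: eq_bigr => s _; rewrite quark1 mulrA.
Qed.

(** A common element lies in the closed span of the splines, hence is orthogonal to the
    translates of the [theta q]; in the closed span of the quarklets it is then zero. *)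
Lemma Vspace_Wspace_ae0 (m p : nat) (b : int -> R) (theta : nat -> R -> R) :
  (forall q, local (quarklet m b q)) -> (forall q, local (theta q)) ->
  (forall q q' (d : int), (q <= p)%N -> (q' <= p)%N ->
    l2ip (fun x => quark m q' (x - d%:~R)) (theta q) = 0) ->
  (forall q q' (d : int), (q' < q <= p)%N ->
    l2ip (fun x => quarklet m b q' (x - d%:~R)) (theta q) = 0) ->
  (forall q (d : int), (q <= p)%N ->
    l2ip (fun x => quarklet m b q (x - d%:~R)) (theta q) = (d == 0)%:R) ->
  forall j f g, Wspace m b p j f -> Vspace m p j g -> f = g %[ae mu] -> f = 0 %[ae mu].
Proof.
move=> Lw Lt tv tw0 tw1 j f g /(generated_spaceP p j _ Lw)[x Wx <-].
move=> /(generated_spaceP p j _ (local_quark m))[y Vy <-] xy.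
pose dH F (LF : local F) k : @L2T R := L2fun (local_L2 (local_dilate j k LF)).
have dHE F LF G LG k l : l2ip (dH F LF k) (dH G LG l) =
    l2ip (fun x => F (x - (k - l)%:~R)) G.
  by rewrite -l2ip_translate// -(l2ip_dilate j).
have Vx : ipclosure ipH (lspan [set h : @L2T R | generators (quark m) p j h]) x.
  apply: (ipclosure_eq L2_semi_inner) Vy.
  by apply: L2_ae_eq_nrm; apply: ae_imp xy => z hz /hz.
have xt q k : (q < p.+1)%N -> l2ip x (dH _ (Lt q) k) = 0.
  move=> qp; apply: (ipclosure_orthogonal L2_semi_inner _ Vx) => h [q' [k' [qp' hE]]].
  by rewrite (_ : h = dH _ (local_quark m q') k') ?dHE ?tv//; apply/LfuneqP => z; rewrite hE.
apply: l2nrm0_ae.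
apply: (@triangular_dual_eq0 _ _ _ L2_semi_inner (fun q k => dH _ (Lw q) k)
  (fun q k => dH _ (Lt q) k) p.+1 x).
- move=> q _; have [K [r Hg]] := dilate_gram (Lw q); exists K, r; exact: Hg.
- move=> q _; have [K [r Hg]] := dilate_gram (Lt q); exists K, r; exact: Hg.
- by move=> q' q k l qq; rewrite dHE tw0.
- by move=> q k l qp; rewrite dHE tw1// subr_eq0.
- exact: xt.
- apply: (ipclosure_trans L2_semi_inner) Wx.
  apply: subset_trans (sub_ipclosure L2_semi_inner (S := _)).
  apply: lspan_mono => h [q [k [qp hE]]]; apply: sub_lspan; exists q, k; split => //.
  by apply/LfuneqP => z; rewrite hE.
Qed.

Lemma quark1_dual p : exists2 eta : nat -> R -> R, (forall r, local (eta r)) &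
  forall r s (k : int), (r <= p)%N -> (s <= p)%N ->
    l2ip (quark 1 s) (fun x => eta r (x + k%:~R)) = ((k == 0) && (r == s))%:R.
Proof.
have [|v vP] := @gram_dual R p.+1 (fun i => 'X^i).
  move=> c c0 i; have := congr1 (fun P : {poly R} => P`_i) c0.
  rewrite coef0 coef_sum (bigD1 i)//= coefZ coefXn eqxx mulr1 big1 ?addr0// => j ji.
  by rewrite coefZ coefXn val_eqE eq_sym (negPf ji) mulr0.
exists (fun r => box (v (inord r))) => [r|r s k rp sp]; first exact: local_box.
have [->|k0] := eqVneq k 0; last first.
  rewrite quark1 /l2ip [RHS](_ : _ = \int[mu]_x 0); last by rewrite /Rintegral integral0.
  apply: eq_Rintegral => x _; rewrite /box !indicE !mem_setE !in_itv/=.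
  case: (boolP (0 <= x < 1)) => x01; last by rewrite !mul0r.
  case: (boolP (0 <= x + k%:~R < 1)) => xk; last by rewrite mul0r mulr0.
  have k1 : ((-1)%:~R < k%:~R :> R) && (k%:~R < 1%:~R :> R).
    by rewrite mulrN1z mulr1z; apply/andP; split; lra.
  by move: k1; rewrite !ltr_int; lia.
rewrite quark1 l2ipC; under eq_fun do rewrite addr0.
have := vP (inord r) (inord s); rewrite inordK// => ->.
by rewrite -val_eqE/= !inordK.
Qed.

Section HaarDual.
Variables (p : nat) (eta : nat -> R -> R).
Hypotheses (leta : forall r, local (eta r))
  (etaP : forall r s (k : int), (r <= p)%N -> (s <= p)%N ->
    l2ip (quark 1 s) (fun x => eta r (x + k%:~R)) = ((k == 0) && (r == s))%:R).

(** In the local coordinates of the two halves of the unit interval, the monomial of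
    degree [s] has the coefficients [(r == s)%:R] on the left and ['C(s, r)%:R] on the
    right, up to a common factor.  Both terms of the functional therefore read off
    ['C(s, q)%:R] and cancel; on a quarklet they meet different translates. *)
Definition haar_dual q (x : R) : R :=
  \sum_(r < p.+1) 'C(r, q)%:R * eta r (2 * x - 0%:~R) - eta q (2 * x - 1%:~R).

Let le r (z : int) : local (fun x : R => eta r (2 * x - z%:~R)).
Proof. by apply: local_affine. Qed.

Lemma local_haar_dual q : local (haar_dual q).
Proof.
apply: localD; first by apply: local_sum => r; exact: localZ.
by under eq_fun do rewrite -mulN1r; exact: localZ.
Qed.

Lemma quark1_haar_dual q s (z : int) : (q <= p)%N -> (s <= p)%N ->
  l2ip (fun x => quark 1 s (2 * x - z%:~R)) (haar_dual q) =
  2^-1 * ((z == 0)%:R * 'C(s, q)%:R - (z == 1)%:R * (q == s)%:R).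
Proof.
move=> qp sp; have lq : local (fun x : R => quark 1 s (2 * x - z%:~R)).
  by apply: local_affine => //; exact: local_quark.
have -> : haar_dual q = fun x => \sum_(i < 2) (if val i is 0 then 1 else -1) *
    (if val i is 0 then \sum_(r < p.+1) 'C(r, q)%:R * eta r (2 * x - 0%:~R)
     else eta q (2 * x - 1%:~R)).
  by apply/funext => x; rewrite big_ord_recl big_ord1/= mul1r mulN1r.
rewrite l2ip_sumr => [|[[|i] ?]//=|//]; last first.
  by apply: local_sum => r; exact: localZ.
rewrite big_ord_recl big_ord1/= mul1r mulN1r mulrBr; congr (_ - _); last first.
  rewrite l2ip_half//; last exact: local_quark.
  by rewrite etaP// subr_eq0 -natrM mulnb.
rewrite l2ip_sumr//.
transitivity (\sum_(r < p.+1) (2^-1 : R) * ((z == 0)%:R * ('C(r, q)%:R * (val r == s)%:R))) => [|].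
  apply: eq_bigr => r _; rewrite l2ip_half//; last exact: local_quark.
  rewrite etaP// ?subr0; last by rewrite -ltnS.
  by rewrite -mulnb natrM; ring.
rewrite -!mulr_sumr; congr (_ * (_ * _)).
rewrite (bigD1 (inord s))//= inordK// eqxx mulr1 big1 ?addr0// => i.
by rewrite -val_eqE/= inordK// => /negPf ->; rewrite mulr0.
Qed.

Lemma quark1_translate_haar_dual q s (d : int) : (q <= p)%N -> (s <= p)%N ->
  l2ip (fun x => quark 1 s (x - d%:~R)) (haar_dual q) = 0.
Proof.
move=> qp sp.
have -> : (fun x : R => quark 1 s (x - d%:~R)) = fun x : R => \sum_(i < s.+2)
    (if val i is t.+1 then 2^-1 ^+ s * 'C(s, t)%:R else 2^-1 ^+ s) *
    quark 1 (if val i is t.+1 then t else s)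
      (2 * x - (2 * d + (if val i is _.+1 then 1 else 0 : int))%:~R).
  apply/funext => x; rewrite quark1_refine; apply: eq_bigr => i _.
  by congr (_ * quark 1 _ _); rewrite intrD intrM; ring.
rewrite l2ip_suml; last 2 first.
- by move=> i; apply: local_affine => //; exact: local_quark.
- exact: local_haar_dual.
rewrite big_ord_recl/= quark1_haar_dual// addr0.
rewrite (_ : (2 * d == 1) = false); last by lia.
rewrite mul0r subr0.
under eq_bigr => i _.
  have ip : (i <= p)%N by rewrite (leq_trans _ sp)// -ltnS.
  have d1 : (2 * d + 1 == 0) = false by lia.
  have d2 : (2 * d + 1 == 1) = (2 * d == 0) by lia.
  rewrite (quark1_haar_dual _ qp ip) d1 d2.
  over.
rewrite (bigID (fun i : 'I_s.+1 => q == i))/= [X in _ + (_ + X)]big1 ?addr0; last first.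
  by move=> i /negPf ->; rewrite mulr0 mul0r subr0 !mulr0.
have [qs|qs] := leqP q s; last first.
  rewrite bin_small// big1 => [|i /eqP qi]; first by rewrite !mulr0 addr0.
  by move: (ltn_ord i); rewrite -qi; lia.
rewrite (eq_bigl (fun i : 'I_s.+1 => i == inord q)); last first.
  by move=> i; rewrite eq_sym -val_eqE/= inordK.
by rewrite big_pred1_eq /= inordK// eqxx add0n/=; ring.
Qed.

End HaarDual.

Section ZeroOrder.
Variables (m : nat) (b : int -> R) (M : nat) (B : {poly R}).
Hypothesis bM : forall k, b k != 0 -> (`|k| <= 2 * M)%N.
Hypothesis sB : (size B <= (4 * M).+1)%N.
Hypothesis bB : forall i : nat, b (i%:Z - (2 * M)%:Z) = 2 * B`_i.
Hypothesis m0 : (0 < m)%N.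
Hypothesis mM : (m./2 <= 2 * M)%N.
Hypothesis det : mask_poly m M * (B \Po (- 'X)) - (mask_poly m M \Po (- 'X)) * B = 'X^((4 * M).+1).

Lemma Vspace0_Wspace0_ae0 j f g : Wspace m b 0 j f -> Vspace m 0 j g ->
  f = g %[ae mu] -> f = 0 %[ae mu].
Proof.
have [eta leta etaP] := phi_dual m0.
have oddZ (d : int) : odd `|((4 * M).+1%:Z - 2 * d)%R|%N by lia.
apply: (@Vspace_Wspace_ae0 _ _ _ (fun=> highpass_dual m M eta)).
- exact: (local_quarklet m bM sB bB).
- by move=> _; exact: local_highpass_dual.
- move=> q q' d _; rewrite leqn0 => /eqP ->; rewrite quark0.
  rewrite (highpass_dualP leta etaP (P := mask_poly m M)); last first.
    by move=> x; exact: phi_refine.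
  by case: ifP => // _; rewrite coef_modulated_sqr// mulr0.
- by move=> q q' d; lia.
- move=> q d; rewrite leqn0 => /eqP ->.
  rewrite (highpass_dualP leta etaP (P := B)); last first.
    by move=> x; exact: (psi_refine _ bM sB bB).
  case: ifP => d0; last by have -> : (d == 0) = false by lia.
  rewrite (coef_modulated_det _ _ det)//; last by lia.
  rewrite (_ : (_ == (4 * M).+1)%N = (d == 0)); last by lia.
  by rewrite mulrA mulrNN mulfV// mul1r.
Qed.

Lemma Vspace0_mono j : Vspace m 0 j `<=` (Vspace m 0 (j + 1) : set (R -> R)).
Proof.
apply: generated_space_mono => _ [q [k [q0 ->]]].
move: q0; rewrite leqn0 => /eqP ->; rewrite quark0.
apply: (@generators_refine _ _ _ _ _ _ (size (mask_poly m M)) (fun i => 2 * (mask_poly m M)`_i)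
  (fun=> 0) (fun i => i%:Z - (2 * M)%:Z)) => // x.
rewrite quark0; have := phi_refine m0 mM x 0; rewrite subr0 => ->.
by apply: eq_bigr => i _; rewrite mulr0 add0r.
Qed.

End ZeroOrder.

Section Haar.
Variables (p : nat) (b : int -> R) (M : nat) (B : {poly R}).
Hypothesis bM : forall k, b k != 0 -> (`|k| <= 2 * M)%N.
Hypothesis sB : (size B <= (4 * M).+1)%N.
Hypothesis bB : forall i : nat, b (i%:Z - (2 * M)%:Z) = 2 * B`_i.
Hypothesis det : mask_poly 1 M * (B \Po (- 'X)) - (mask_poly 1 M \Po (- 'X)) * B = 'X^((4 * M).+1).

(** For the mask [(1 + z) / 2] the determinant says that [B] takes equal values at the
    indices [2 n] and [2 n + 1], except for one [n], where they differ by 1. *)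
Lemma Vspace_Wspace_haar_ae0 j f g : Wspace 1 b p j f -> Vspace 1 p j g ->
  f = g %[ae mu] -> f = 0 %[ae mu].
Proof.
have [eta leta etaP] := quark1_dual p.
have lw q : local (quarklet 1 b q) by exact: (local_quarklet 1 bM sB bB).
have detE n : odd n -> B`_n.-1 - B`_n = (n == (2 * M).+1)%:R.
  move=> on; have := congr1 (fun P : {poly R} => P`_(2 * M + n)) det.
  have n0 : (n == 0)%N = false by case: (n) on.
  have mE : mask_poly 1 M = 2^-1 *: ('X^(2 * M) * (1 + 'X)) :> {poly R}.
    by rewrite /mask_poly subn0 expr1 scalerAr.
  have mE' : mask_poly 1 M \Po (- 'X) = 2^-1 *: ('X^(2 * M) * (1 - 'X)) :> {poly R}.
    rewrite mE comp_polyZ comp_polyM comp_polyD comp_Xn_poly comp_polyX exprNn.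
    by rewrite -signr_odd oddM/= expr0 mul1r -polyC1 comp_polyC.
  rewrite coefB coefXn mE' mE -!scalerAl !coefZ -!mulrA !coefXnM ltnNge leq_addr/= addKn.
  rewrite mulrDl mulrBl mul1r mul1r coefD coefB !coefXM n0 !coef_compN.
  rewrite -(signr_odd _ n) -(signr_odd _ n.-1) on (_ : odd n.-1 = false); last first.
    by case: (n) on => //= ? /negPf.
  rewrite (_ : (2 * M + n == (4 * M).+1)%N = (n == (2 * M).+1)); last by lia.
  by move=> <-; rewrite expr0 expr1; field.
have wE q q' d : (q <= p)%N -> (q' <= p)%N ->
    l2ip (fun x => quarklet 1 b q' (x - d%:~R)) (haar_dual p eta q) =
    (if 0 <= (2 * M)%:Z - 2 * d then B`_(`|((2 * M)%:Z - 2 * d)%R|%N) else 0) * 'C(q', q)%:R -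
    (if 0 <= (2 * M).+1%:Z - 2 * d then B`_(`|((2 * M).+1%:Z - 2 * d)%R|%N) else 0) * (q == q')%:R.
  move=> qp qp'.
  have lq (z : int) : local (fun x : R => quark 1 q' (2 * x - z%:~R)).
    by apply: local_affine => //; exact: local_quark.
  have -> : (fun x : R => quarklet 1 b q' (x - d%:~R)) = fun x : R =>
      \sum_(i < (4 * M).+1) 2 * B`_i * quark 1 q' (2 * x - (2 * d + i%:Z - (2 * M)%:Z)%:~R).
    apply/funext => x; rewrite (quarkletE _ bM sB bB); apply: eq_bigr => i _.
    by congr (_ * quark 1 _ _); rewrite !intrB intrD intrM; ring.
  rewrite l2ip_suml//; last exact: local_haar_dual.
  have pick (z : int) : \sum_(i < (4 * M).+1) B`_i * (i%:Z == z)%:R =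
      if 0 <= z then B`_(`|z|%N) else 0.
    case: ifP => z0; last first.
      by rewrite big1// => i _; rewrite (_ : (_ == z) = false) ?mulr0//; lia.
    case: z z0 => // n _; rewrite absz_nat.
    have [nM|nM] := ltnP n (4 * M).+1; last first.
      rewrite nth_default ?(leq_trans sB)// big1// => i _.
      by rewrite (_ : (_ == _) = false) ?mulr0//; have := ltn_ord i; lia.
    rewrite (bigD1 (Ordinal nM))//= eqxx mulr1 big1 ?addr0// => i.
    by rewrite -val_eqE/= => /negPf ni; rewrite eqz_nat ni mulr0.
  rewrite -!pick !mulr_suml -sumrB; apply: eq_bigr => i _.
  rewrite (quark1_haar_dual leta etaP)//.
  rewrite (_ : (2 * d + i%:Z - (2 * M)%:Z == 0) = (i%:Z == (2 * M)%:Z - 2 * d)); last by lia.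
  rewrite (_ : (2 * d + i%:Z - (2 * M)%:Z == 1) = (i%:Z == (2 * M).+1%:Z - 2 * d)); last by lia.
  by field.
apply: (@Vspace_Wspace_ae0 _ _ _ (haar_dual p eta)) => //.
- by move=> q; exact: local_haar_dual.
- by move=> q q' d qp qp'; exact: quark1_translate_haar_dual.
- move=> q q' d /andP[qq qp]; rewrite wE//; last by lia.
  by rewrite bin_small// gtn_eqF// !mulr0 subr0.
- move=> q d qp; rewrite wE// binn eqxx !mulr1.
  have [d0|d0] := lerP 0 ((2 * M)%:Z - 2 * d); last first.
    rewrite ifF; last by lia.
    by rewrite subr0; have -> : (d == 0) = false by lia.
  rewrite ifT; last by lia.
  have := detE `|((2 * M).+1%:Z - 2 * d)%R|%N.
  rewrite (_ : _.-1 = `|((2 * M)%:Z - 2 * d)%R|%N); last by lia.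
  move=> ->; last by lia.
  by congr (nat_of_bool _)%:R; lia.
Qed.

Lemma Vspace_haar_mono j : Vspace 1 p j `<=` (Vspace 1 p (j + 1) : set (R -> R)).
Proof.
apply: generated_space_mono => _ [q [k [qp ->]]].
apply: (@generators_refine _ _ _ _ _ _ _ _ (fun i : 'I_q.+2 => if val i is s.+1 then s else q) _ _
  (quark1_refine q)) => -[[|i] Hi]//=.
by rewrite (leq_trans _ qp).
Qed.

End Haar.
End Duals.

(** * The decompositions *)

Section Sums.
Context {R : realType}.
Local Notation mu := (@lebesgue_measure R).
Local Notation toR := (fun h : @L2T R => h : R -> R).
Local Notation ipH := (fun f g : @L2T R => l2ip f g).

Lemma L2_eq_closure_sum (I : choiceType) (U : I -> set (R -> R)) (G : set (@L2T R)) :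
  (forall i, is_subspace (U i)) ->
  (forall h, G h -> exists i, U i (toR h)) -> (forall h, ipclosure ipH (lspan G) h) ->
  L2 = L2closure (subspace_sum U).
Proof.
move=> Usub GU dense; apply/seteqP; split => [f Lf|f []//].
have [S0 SD] := subspace_sum_subspace Usub.
have GS : lspan G `<=` [set h : @L2T R | subspace_sum U (toR h)].
  apply: lspan_min => [|h /GU[i Ui]]; last exact: sub_subspace_sum Ui.
  by split => // a x y; exact: SD.
have [|_ nf] := (L2closureE (lspan G) f).2; first by exists (L2fun Lf).
by split => // e e0; have [_ [h /GS hS <-]] := nf e e0; exists (toR h).
Qed.

Lemma exists_max_rank (I : eqType) (rank : I -> int) (s : seq I) : s != [::] ->
  exists2 J, J \in s & forall i, i \in s -> rank i <= rank J.
Proof.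
elim: s => // i s IH _; have [->|/IH[J Js Jmax]] := eqVneq s [::].
  by exists i => [|j]; rewrite !inE// => /eqP ->.
have [iJ|Ji] := lerP (rank i) (rank J).
  exists J => [|j]; first by rewrite inE Js orbT.
  by rewrite inE => /predU1P[->//|/Jmax].
exists i => [|j]; first by rewrite inE eqxx.
by rewrite inE => /predU1P[->//|/Jmax jJ]; exact: le_trans (ltW Ji).
Qed.

(** The member of largest rank is split off first: the space [X J] contains all spaces
    of lower rank. *)
Lemma direct_of_scales (I : choiceType) (rank : I -> int) (U X : I -> set (R -> R)) :
  injective rank -> (forall i, is_subspace (U i)) -> (forall i, is_subspace (X i)) ->
  (forall i J, rank i < rank J -> U i `<=` X J) ->
  (forall J f g, U J f -> X J g -> f = g %[ae mu] -> f = 0 %[ae mu]) -> direct U.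
Proof.
move=> inj Usub Xsub UX UX0; apply: direct_of_largest => // s s0.
have [|J Js Jmax] := @exists_max_rank _ rank s.
  by apply: contra s0 => /eqP se; apply/eqP/fsetP => i; rewrite inE -[LHS]/(i \in enum_fset s) se.
exists J => //; exists (X J); split => // [i si iJ|]; last exact: UX0.
by apply: UX; rewrite lt_neqAle Jmax// andbT; apply: contra iJ => /eqP/inj ->.
Qed.

Section Multiresolution.
Variables (m p : nat) (b : int -> R) (M : nat) (B : {poly R}).
Hypothesis bM : forall k, b k != 0 -> (`|k| <= 2 * M)%N.
Hypothesis sB : (size B <= (4 * M).+1)%N.
Hypothesis bB : forall i : nat, b (i%:Z - (2 * M)%:Z) = 2 * B`_i.

Let Lw q : local (quarklet m b q) := local_quarklet m bM sB bB q.

Lemma VWspace_subspace i : is_subspace (VWspace m b p i).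
Proof. by case: i => [j|]; apply: generated_space_subspace => // q; exact: local_quark. Qed.

Section Total.
Hypothesis m0 : (0 < m)%N.
Hypothesis mM : (m./2 <= 2 * M)%N.
Hypothesis det : mask_poly m M * (B \Po (- 'X)) - (mask_poly m M \Po (- 'X)) * B = 'X^((4 * M).+1).

Lemma Wspace_total : L2 = L2closure (subspace_sum (Wspace m b p)).
Proof.
apply: (L2_eq_closure_sum _ _ (wavelets_total bM sB bB m0 mM det)) => [j|h].
  exact: generated_space_subspace.
by move=> [j [k ->]]; exists j; apply: sub_generated_space => //; exists 0, k.
Qed.

Lemma VWspace_total : L2 = L2closure (subspace_sum (VWspace m b p)).
Proof.
apply: (L2_eq_closure_sum _ _ (multilevel_total bM sB bB m0 mM det)) => [j|h].
  exact: VWspace_subspace.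
case=> [[k ->]|[j [k ->]]].
  exists None; apply: sub_generated_space; first by move=> q; exact: local_quark.
  by exists 0, k; rewrite quark0.
by exists (Some j); apply: sub_generated_space => //; exists 0, k.
Qed.
End Total.

Section Direct.
Hypothesis Vmono : forall j, Vspace m p j `<=` (Vspace m p (j + 1) : set (R -> R)).
Hypothesis VW0 : forall j f g, Wspace m b p j f -> Vspace m p j g ->
  f = g %[ae mu] -> f = 0 %[ae mu].

Lemma Vspace_mono i j : i <= j -> Vspace m p i `<=` (Vspace m p j : set (R -> R)).
Proof.
move=> ij; have [n ->] : exists n : nat, j = i + n%:Z by exists `|(j - i)%R|%N; lia.
elim: n {ij} => [|n IH]; first by rewrite addr0.
rewrite (_ : i + n.+1%:Z = i + n%:Z + 1); last by lia.
by move=> f /IH; exact: Vmono.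
Qed.

Lemma Wspace_sub_Vspace_lt i j : i < j -> Wspace m b p i `<=` Vspace m p j.
Proof.
by move=> ij f /(Wspace_sub_Vspace bM sB bB); apply: Vspace_mono; lia.
Qed.

Lemma Wspace_direct : direct (Wspace m b p).
Proof.
apply: (@direct_of_scales _ id _ (Vspace m p)) => // [j|j|i J].
- exact: generated_space_subspace.
- by apply: generated_space_subspace => q; exact: local_quark.
- exact: Wspace_sub_Vspace_lt.
Qed.

(** The space [V_0] gets the rank below all wavelet scales; nothing is below it. *)
Lemma VWspace_direct : direct (VWspace m b p).
Proof.
pose rank (i : option nat) : int := if i is Some j then j%:Z else -1.
pose X (i : option nat) : set (R -> R) := if i is Some j then Vspace m p j%:Z else [set 0].
apply: (@direct_of_scales _ rank _ X) => [[i|] [j|]//= [->]//|i|[j|]|[i|] [j|]//=|[j|]//= f g].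
- exact: VWspace_subspace.
- by apply: generated_space_subspace => q; exact: local_quark.
- by split => // a x y -> ->; rewrite scaler0 addr0.
- by move=> ij; apply: Wspace_sub_Vspace_lt.
- by move=> _; exact: Vspace_mono.
- exact: VW0.
- by move=> _ ->.
Qed.
End Direct.
End Multiresolution.
End Sums.

Theorem theorem6p6 (R : realType) (m mt p : nat) (b : int -> R) :
  (0 < m)%N -> (m <= mt)%N -> ~~ odd (m + mt) ->
  cdf_coefficients m mt b ->
  (L2 = L2closure (subspace_sum (Wspace m b p)) /\
   L2 = L2closure (subspace_sum (VWspace m b p))) /\
  (m = 1%N \/ p = 0%N ->
   (direct (Wspace m b p) /\
    L2 = L2closure (subspace_sum (Wspace m b p))) /\
   (direct (VWspace m b p) /\
    L2 = L2closure (subspace_sum (VWspace m b p)))).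
Proof.
move=> m0 _ even_mmt cdf.
have [M [B [mM bM sB bB det]]] := cdf_determinant m0 even_mmt cdf.
have TW := Wspace_total p bM sB bB m0 mM det.
have TVW := VWspace_total p bM sB bB m0 mM det.
split; first by split.
move=> m1p0.
have Vmono j : Vspace m p j `<=` (Vspace m p (j + 1) : set (R -> R)).
  by case: m1p0 => [->|p0]; [exact: Vspace_haar_mono | rewrite p0; exact: (Vspace0_mono m0 mM)].
have VW0 j f g : Wspace m b p j f -> Vspace m p j g ->
    f = g %[ae @lebesgue_measure R] -> f = 0 %[ae @lebesgue_measure R].
  case: m1p0 => [m1|p0]; last by rewrite p0; exact: (Vspace0_Wspace0_ae0 bM sB bB m0 mM det).
  by rewrite m1 in det *; exact: (Vspace_Wspace_haar_ae0 bM sB bB det).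
split; split => //.
  exact: (Wspace_direct bM sB bB).
exact: (VWspace_direct bM sB bB).
Qed.
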